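(* Let $N\ge 2$ and let $a:\mathbb{R}^N\to(0,\infty)$ be continuous, $\mathbb{Z}^N$-periodic (i.e. $a(x+ke_i)=a(x)$ for all $x\in\mathbb{R}^N$, $k\in\mathbb{Z}$, $i=1,\dots,N$), with $\theta\le a(x)\le\Theta$ for all $x\in\mathbb{R}^N$, where $0<\theta<\Theta$. Let $W(u)=(1-u^2)^2$, let $\sigma:\mathbb{S}^{N-1}\to[0,\infty)$ be the anisotropic surface energy defined in the context, let $h_\nu$ be the signed $d_{\sqrt a}$-distance function to $\Sigma_\nu$ defined in the context, and let $q(z)=\tanh(\sqrt2 z)$ for $z\in\mathbb{R}$. For $\nu\in\mathbb{S}^{N-1}$ define $$\underline{\lambda}(\nu):=\liminf_{T\to\infty}\frac{1}{T^{N-1}}\int_{TQ_\nu}\Big[a(y)W(q\circ h_\nu)+\frac12|\nabla(q\circ h_\nu)|^2\Big]\,dy,$$ $$\overline{\lambda}(\nu):=\limsup_{T\to\infty}\frac{1}{T^{N-1}}\int_{TQ_\nu}\Big[a(y)W(q\circ h_\nu)+\frac12|\nabla(q\circ h_\nu)|^2\Big]\,dy.$$ Then there exist a constant $\Lambda_0>0$ depending only on $\theta$ and $\Theta$ (in particular independent of $\nu$) and a function $\lambda_0:\mathbb{S}^{N-1}\to[0,\Lambda_0]$ such that for every $\nu\in\mathbb{S}^{N-1}$ $$\overline{\lambda}(\nu)-\lambda_0(\nu)\le\sigma(\nu)\le\underline{\lambda}(\nu).$$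
   Context: $\{e_1,\dots,e_N\}$ is the standard orthonormal basis of $\mathbb{R}^N$. For $\nu\in\mathbb{S}^{N-1}$, $Q_\nu$ denotes a (fixed) unit cube centered at the origin with two faces orthogonal to $\nu$, and $\Sigma_\nu=\{x\in\mathbb{R}^N:x\cdot\nu=0\}$. Surface energy: let $\rho\in C_c^\infty(B(0,1))$ with $0\le\rho\le1$ and $\int_{\mathbb{R}^N}\rho\,dx=1$; let $u_{0,\nu}(y)=-1$ if $y\cdot\nu\le0$ and $u_{0,\nu}(y)=1$ if $y\cdot\nu>0$; let $\mathcal{C}(TQ_\nu)=\{u\in H^1(TQ_\nu;\mathbb{R}):u=\rho*u_{0,\nu}\text{ on }\partial(TQ_\nu)\}$. Then $$\sigma(\nu):=\lim_{T\to\infty}\frac1{T^{N-1}}\inf\Big\{\int_{TQ_\nu}\Big[a(y)W(u)+\frac12|\nabla u|^2\Big]dy:\ u\in\mathcal{C}(TQ_\nu)\Big\}$$ (the existence of this limit is known). Distance: for $y_0,y_1\in\mathbb{R}^N$, $d_{\sqrt a}(y_0,y_1):=\inf_\gamma\int_0^1\sqrt{a(\gamma(t))}\,|\dot\gamma(t)|\,dt$, where the infimum is over Lipschitz curves $\gamma:[0,1]\to\mathbb{R}^N$ with $\gamma(0)=y_0$, $\gamma(1)=y_1$. The signed distance function is $h_\nu(y):=\mathrm{sign}(y\cdot\nu)\inf_{z\in\Sigma_\nu}d_{\sqrt a}(y,z)$. It is Lipschitz, so $\nabla(q\circ h_\nu)$ exists a.e. *)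

(* Defs.v *)
From HB Require Import structures.
From mathcomp Require Import all_boot all_order all_algebra.
From mathcomp Require Import all_classical all_reals all_analysis.

Set Implicit Arguments.
Unset Strict Implicit.
Unset Printing Implicit Defensive.

Import Order.TTheory GRing.Theory Num.Theory.
Import numFieldNormedType.Exports.

Local Open Scope classical_set_scope.
Local Open Scope ring_scope.

(* Points of R^n are row vectors.  Their library norm is the sup norm, so the
   Euclidean structure is introduced below; the topology is the same.  The
   sigma-algebra on R^n is the Borel one, i.e. the product sigma-algebra, as
   the library does for n.-tuple. *)

Definition rV_display : measure_display.
Proof. exact: default_measure_display. Qed.

Section measurable_rV.
Context {R : realType} (n : nat).

Let coors : 'I_n -> 'rV[R]_n -> R := fun i x => x ord0 i.

Let rV_set0 : g_sigma_preimage coors set0.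
Proof. exact: sigma_algebra0. Qed.

Let rV_setC A : g_sigma_preimage coors A -> g_sigma_preimage coors (~` A).
Proof. exact: sigma_algebraC. Qed.

Let rV_bigcup (F : _^nat) : (forall i, g_sigma_preimage coors (F i)) ->
  g_sigma_preimage coors (\bigcup_i (F i)).
Proof. exact: sigma_algebra_bigcup. Qed.

HB.instance Definition _ := @isMeasurable.Build rV_display
  'rV[R]_n (g_sigma_preimage coors) rV_set0 rV_setC rV_bigcup.

End measurable_rV.

Section lebesgue_rV.
Context {R : realType}.
Local Open Scope ereal_scope.

Definition rV_cons n (p : measurableTypeR R * 'rV[R]_n) : 'rV[R]_n.+1 :=
  row_mx (p.1%:M : 'rV[R]_1) p.2.

Lemma measurable_rV_coord n (i : 'I_n) :
  measurable_fun [set: 'rV[R]_n] (fun x : 'rV[R]_n => x ord0 i).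
Proof.
move=> _ Y mY; rewrite setTI; apply: sub_sigma_algebra => /=.
rewrite -bigcup_seq/=; exists i => /=; first by rewrite mem_index_enum.
by exists Y => //; rewrite setTI.
Qed.

Lemma measurable_rVP d (T : measurableType d) n (f : T -> 'rV[R]_n) :
  (forall i, measurable_fun [set: T] (fun t => f t ord0 i)) ->
  measurable_fun [set: T] f.
Proof.
move=> mf _ A mA; rewrite setTI.
pose M := [set B : set 'rV[R]_n | measurable (f @^-1` B)].
suff sM : measurable `<=` M by exact: sM.
apply: smallest_sub.
  split.
  - by rewrite /M /= preimage_set0.
  - move=> B mB; rewrite /M /= setTD preimage_setC; exact: measurableC.
  - by move=> F mF; rewrite /M /= preimage_bigcup; apply: bigcupT_measurable => k; exact: mF.
move=> B; rewrite -bigcup_seq/= => -[i _ [Y mY <-]].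
by have := mf i measurableT Y mY; rewrite !setTI.
Qed.

Lemma rV_cons0 n (p : measurableTypeR R * 'rV[R]_n) :
  rV_cons p ord0 ord0 = p.1.
Proof.
rewrite /rV_cons mxE; case: splitP => [j|j] //=.
by rewrite (ord1 j) mxE eqxx mulr1n.
Qed.

Lemma rV_consS n (p : measurableTypeR R * 'rV[R]_n) (i : 'I_n) :
  rV_cons p ord0 (lift ord0 i) = p.2 ord0 i.
Proof.
rewrite /rV_cons mxE; case: splitP => [j|j] /=.
  by rewrite (ord1 j).
by rewrite /bump leq0n !add1n => -[] /val_inj ->.
Qed.

Lemma measurable_rV_cons n : measurable_fun setT (@rV_cons n).
Proof.
apply: measurable_rVP => i.
have [j ->|->] := unliftP ord0 i.
  under eq_fun do rewrite rV_consS.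
  exact: (measurableT_comp (measurable_rV_coord j) measurable_snd).
under eq_fun do rewrite rV_cons0.
exact: measurable_fst.
Qed.

Definition rV_uncons n (x : 'rV[R]_n.+1) : measurableTypeR R * 'rV[R]_n :=
  (x ord0 ord0, \row_i x ord0 (lift ord0 i)).

Lemma rV_consK n : cancel (@rV_cons n) (@rV_uncons n).
Proof.
move=> [t y]; rewrite /rV_uncons rV_cons0; congr pair.
by apply/rowP => i; rewrite mxE rV_consS.
Qed.

Lemma measurable_rV_uncons n : measurable_fun setT (@rV_uncons n).
Proof.
apply/measurable_fun_pairP; split; first exact: measurable_rV_coord.
apply: measurable_rVP => i.
under eq_fun do rewrite /= mxE.
exact: measurable_rV_coord.
Qed.

Section lebesgue_step.
Variables (n : nat) (m : {sigma_finite_measure set 'rV[R]_n -> \bar R}).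

Let prod : {measure set (measurableTypeR R * 'rV[R]_n)%type -> \bar R} :=
  (@lebesgue_measure R \x m).

Definition lebesgue_step : set 'rV[R]_n.+1 -> \bar R :=
  pushforward (lebesgue_measure \x m) (@rV_cons n).

Let mpre (A : set 'rV[R]_n.+1) : measurable A -> measurable (@rV_cons n @^-1` A).
Proof. by move=> mA; rewrite -[X in measurable X]setTI; exact: measurable_rV_cons. Qed.

Let step0 : lebesgue_step set0 = 0.
Proof. by rewrite /lebesgue_step /pushforward preimage_set0 measure0. Qed.

Let step_ge0 A : 0 <= lebesgue_step A.
Proof. exact: (measure_ge0 prod). Qed.

Let step_sigma_additive : semi_sigma_additive lebesgue_step.
Proof.
move=> F mF tF mUF; rewrite /lebesgue_step /pushforward preimage_bigcup.
apply: (measure_semi_sigma_additive (s := prod)).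
- by move=> k; exact: mpre.
- apply/trivIsetP => /= i j _ _ ij; rewrite -preimage_setI.
  by move/trivIsetP : tF => /(_ _ _ _ _ ij) ->//; rewrite preimage_set0.
- by rewrite -preimage_bigcup; exact: mpre.
Qed.

HB.instance Definition _ := isMeasure.Build _ _ _ lebesgue_step
  step0 step_ge0 step_sigma_additive.

Let step_sigma_finite : sigma_finite setT lebesgue_step.
Proof.
have /sigma_finiteP[F [TF ndF Foo]] := sigma_finiteT (@lebesgue_measure R).
have /sigma_finiteP[G [TG ndG Goo]] := sigma_finiteT m.
exists (fun k => @rV_uncons n @^-1` (F k `*` G k)).
  rewrite -preimage_bigcup -(preimage_setT (@rV_uncons n)); congr (_ @^-1` _).
  rewrite -setXTT TF TG; apply/seteqP; split=> [[x y] [[/= i _ Fx] [j _ Gy]]|].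
    exists (maxn i j) => //; split.
      by move: x Fx; exact/subsetPset/ndF/leq_maxl.
    by move: y Gy; exact/subsetPset/ndG/leq_maxr.
  by move=> [x y] [i _ [Fx Gy]]; split; exists i.
move=> k; have [mF Fk] := Foo k; have [mG Gk] := Goo k; split.
  rewrite -[X in measurable X]setTI; apply: measurable_rV_uncons => //.
  exact: measurableX.
rewrite /lebesgue_step /pushforward -comp_preimage.
rewrite (_ : _ \o _ = id) ?preimage_id.
  by rewrite product_measure1E// lte_mul_pinfty// ge0_fin_numE.
by apply/funext => p /=; rewrite rV_consK.
Qed.

HB.instance Definition _ := Measure_isSigmaFinite.Build _ _ _ lebesgue_step
  step_sigma_finite.

End lebesgue_step.

(* Lebesgue measure on R^n: the point mass for n = 0, then the image of
   lebesgue_measure \x lebesgue_rV n under (t, y) |-> row_mx t y. *)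
Fixpoint lebesgue_rV n : {sigma_finite_measure set 'rV[R]_n -> \bar R} :=
  if n is k.+1 then lebesgue_step (lebesgue_rV k) else \d_(0%R : 'rV[R]_0).

Lemma lebesgue_rV_box n (A : 'I_n -> set (measurableTypeR R)) :
  (forall i, measurable (A i)) ->
  lebesgue_rV n [set x | forall i, A i (x ord0 i)] =
  \prod_(i < n) lebesgue_measure (A i).
Proof.
elim: n A => [|n IH] A mA.
  by rewrite big_ord0 /= diracE mem_set//; case.
set B := [set x : 'rV[R]_n | forall i, A (lift ord0 i) (x ord0 i)].
have mB : measurable B.
  rewrite (_ : B = \bigcap_(i in [set` index_enum 'I_n])
      ((fun x : 'rV[R]_n => x ord0 i) @^-1` A (lift ord0 i))).
    rewrite bigcap_seq; apply: bigsetI_measurable => i _.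
    by have := measurable_rV_coord i measurableT (mA (lift ord0 i)); rewrite setTI.
  apply/seteqP; split=> [x xA i _|x xA i]; first exact: xA.
  by apply: xA; rewrite /= mem_index_enum.
rewrite big_ord_recl -IH// -product_measure1E//=.
congr ((_ \x _) _); apply/seteqP; split=> [p /= pA|p /= [p1 p2] i].
  split=> [|i]; first by have := pA ord0; rewrite rV_cons0.
  by have := pA (lift ord0 i); rewrite rV_consS.
by have [j ->|->] := unliftP ord0 i; rewrite ?rV_consS ?rV_cons0.
Qed.

End lebesgue_rV.

Section euclidean.
Context {R : realType} {N : nat}.
Implicit Types x y : 'rV[R]_N.

Definition dotv x y : R := \sum_(i < N) x ord0 i * y ord0 i.

Definition enorm x : R := Num.sqrt (dotv x x).

Definition sphere : set 'rV[R]_N := [set nu | enorm nu = 1].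

Definition basis_vec (i : 'I_N) : 'rV[R]_N := delta_mx ord0 i.

(* A unit cube centred at the origin with two faces orthogonal to nu: the rows
   of the orthogonal matrix B are the directions of its edges. *)
Definition unit_cube (nu : 'rV[R]_N) (Q : set 'rV[R]_N) : Prop :=
  exists B : 'M[R]_N, [/\ B *m B^T = 1%:M, exists i, row i B = nu &
    Q = [set x | forall i, `|dotv x (row i B)| < 2^-1]].

Definition dilate (T : R) (A : set 'rV[R]_N) : set 'rV[R]_N :=
  [set T *: x | x in A].

End euclidean.
Arguments sphere : clear implicits.

Section smooth_functions.
Context {R : realType} {N : nat}.
Implicit Types f phi : 'rV[R]_N -> R.

(* Pointwise partial derivatives; for a Lipschitz f they exist almost
   everywhere. *)
Definition partial (i : 'I_N) f : 'rV[R]_N -> R :=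
  fun x => 'D_(basis_vec i) f x.

Definition grad f : 'rV[R]_N -> 'rV[R]_N := fun x => \row_i partial i f x.

Fixpoint partials (s : seq 'I_N) f : 'rV[R]_N -> R :=
  if s is i :: s' then partial i (partials s' f) else f.

Definition smooth f : Prop := forall s : seq 'I_N,
  continuous (partials s f) /\
  forall i x, derivable (partials s f) x (basis_vec i).

Definition supp f : set 'rV[R]_N := closure [set x | f x != 0].

(* C_c^oo(D) for open D, each function being extended by 0 outside D. *)
Definition test_function (D : set 'rV[R]_N) phi : Prop :=
  [/\ smooth phi, compact (supp phi) & supp phi `<=` D].

End smooth_functions.

Section sobolev.
Context {R : realType} {N : nat}.
Local Notation E := 'rV[R]_N.
Local Notation mu := (@lebesgue_rV R N).
Implicit Types (D : set E) (u v w : E -> R) (g : E -> E).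

Definition square_integrable D u : Prop :=
  measurable_fun D u /\ (\int[mu]_(x in D) (u x ^+ 2)%:E < +oo)%E.

Definition weak_gradient D u g : Prop :=
  forall phi, test_function D phi -> forall i,
    (\int[mu]_(x in D) (u x * partial i phi x)%:E =
     - \int[mu]_(x in D) (g x ord0 i * phi x)%:E)%E.

(* u is in H^1(D), with weak gradient g. *)
Definition H1 D u g : Prop :=
  [/\ square_integrable D u,
      forall i, square_integrable D (fun x => g x ord0 i) &
      weak_gradient D u g].

(* u is in H^1_0(D), the closure of C_c^oo(D) in H^1(D), with weak gradient g. *)
Definition H10 D u g : Prop :=
  H1 D u g /\ exists phi : nat -> E -> R,
  [/\ forall k, test_function D (phi k),
      (\int[mu]_(x in D) ((phi k x - u x) ^+ 2)%:E)%E @[k --> \oo] --> 0%E &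
      (\int[mu]_(x in D)
         (enorm (grad (phi k) x - g x) ^+ 2)%:E)%E @[k --> \oo] --> 0%E].

End sobolev.

Section energy.
Context {R : realType} {N : nat}.
Local Notation E := 'rV[R]_N.
Local Notation mu := (@lebesgue_rV R N).
Implicit Types (D : set E) (u : E -> R) (g : E -> E) (nu : E).

Definition W (z : R) : R := (1 - z ^+ 2) ^+ 2.

Variable a : E -> R.

(* The gradient is an argument because it is a weak one for the competitors in
   the cell problem, and the pointwise one for q \o h_nu. *)
Definition energy D u g : \bar R :=
  \int[mu]_(y in D) (a y * W (u y) + 2^-1 * enorm (g y) ^+ 2)%:E.

(* T^(1-N) times a quantity e of the dilated cube. *)
Definition normalize (T : R) (e : \bar R) : \bar R :=
  ((T ^+ N.-1)^-1%:E * e)%E.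

Definition phase nu (y : E) : R := if dotv y nu <= 0 then -1 else 1.

Variable rho : E -> R.

Definition mollified_phase nu (x : E) : R :=
  \int[mu]_(y in setT) (rho (x - y) * phase nu y).

(* u belongs to C(D) with weak gradient g; the boundary condition is understood
   in the sense of traces: u - rho * u_(0,nu) is in H^1_0(D). *)
Definition admissible nu D u g : Prop :=
  let w := mollified_phase nu in
  H1 D u g /\ H10 D (fun x => u x - w x) (fun x => g x - grad w x).

Definition cell_inf nu D : \bar R :=
  ereal_inf [set e | exists u g, admissible nu D u g /\ e = energy D u g].

(* sigma(nu) is the limit, whose existence is a known fact; it is given as a
   relation rather than with lim, which returns a default value otherwise. *)
Definition is_surface_energy (Q : E -> set E) (sigma : E -> R) : Prop :=
  forall nu, sphere R N nu ->
    normalize T (cell_inf nu (dilate T (Q nu))) @[T --> +oo] --> (sigma nu)%:E.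

End energy.

Section signed_distance.
Context {R : realType} {N : nat}.
Local Notation E := 'rV[R]_N.
Variable a : E -> R.

(* Only the values of gamma on [0, 1] matter, and derive1 gamma exists almost
   everywhere there. *)
Definition lipschitz_curve (y0 y1 : E) : set (R -> E) :=
  [set gamma | [/\ [lipschitz gamma t | t in `[0, 1] : set R^o],
     gamma 0 = y0 & gamma 1 = y1]].

Definition curve_length (gamma : R -> E) : \bar R :=
  \int[@lebesgue_measure R]_(t in `[0, 1])
     (Num.sqrt (a (gamma t)) * enorm (derive1 gamma t))%:E.

Definition dist_sqrt (y0 y1 : E) : \bar R :=
  ereal_inf [set curve_length gamma | gamma in lipschitz_curve y0 y1].

Definition hyperplane (nu : E) : set E := [set x | dotv x nu = 0].

(* dist_sqrt is finite as soon as a is bounded, so fine loses nothing. *)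
Definition signed_dist (nu y : E) : R :=
  Num.sg (dotv y nu) *
  fine (ereal_inf [set dist_sqrt y z | z in hyperplane nu]).

Definition tanh (z : R) : R := (expR z - expR (- z)) / (expR z + expR (- z)).

Definition q (z : R) : R := tanh (Num.sqrt 2 * z).

Definition planar_profile (nu : E) : E -> R := fun y => q (signed_dist nu y).

Definition planar_energy (Q : E -> set E) (nu : E) (T : R) : \bar R :=
  normalize (N := N) T (energy a (dilate T (Q nu))
    (planar_profile nu) (grad (planar_profile nu))).

Definition lambda_inf (Q : E -> set E) (nu : E) : \bar R :=
  limf_einf (planar_energy Q nu) (pinfty_nbhs R).

Definition lambda_sup (Q : E -> set E) (nu : E) : \bar R :=
  limf_esup (planar_energy Q nu) (pinfty_nbhs R).

End signed_distance.

(* Main.v *)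
(* Write u = q(h_nu).  Since h_nu is sqrt(Theta)-Lipschitz, |h_nu(y)| is at least
   sqrt(theta) |y.nu| and q' = sqrt 2 (1 - q^2), the energy density of u is
   almost everywhere at most 8 Theta (1 + k |y.nu|)^-2 with k = sqrt(2 theta).
   Summing over unit slabs orthogonal to nu bounds the normalized planar energy
   by Lambda0 = 16 Theta (1 + 1/k), whatever the dimension.  As sigma >= 0, the
   left inequality holds with lambda0(nu) the limsup itself.

   For the right inequality, u is glued to w = rho * u_(0,nu) by a cutoff in a
   collar of width 1 near the boundary of T Q_nu.  The density of the glued
   function V is O((1 + k |y.nu|)^-2), so the collar costs O(T^(N-2)).  Adding to
   w a mollification of V - w gives smooth competitors whose energy exceeds that
   of V by O(eps), by Jensen's inequality and Tonelli's theorem. *)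

Require Import Defs.
From HB Require Import structures.
From mathcomp Require Import all_boot all_order all_algebra.
From mathcomp Require Import all_classical all_reals all_analysis.
From mathcomp Require Import measurable_realfun ring lra zify.
Set Implicit Arguments.
Unset Strict Implicit.
Unset Printing Implicit Defensive.
Import Order.TTheory GRing.Theory Num.Theory.
Import numFieldNormedType.Exports.
Local Open Scope classical_set_scope.
Local Open Scope ring_scope.

(** * Borel sets and Lebesgue measure on R^n *)

(** The function glued from [u] and [w] is only Lipschitz, whereas [admissible] asks for a weak
    gradient and for a difference in H^1_0. Mollifying the correction [V - w] alone answers both
    demands: [w] is already smooth, and the correction vanishes in a collar wider than the
    mollification radius, so that its mollification is itself a test function and can be taken as a
    constant approximating sequence. The price is that the smoothed energy on the cube sees [V]
    slightly outside it, which is why cubes of side [T + 2] occur.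

    The collar is cheap for two reasons: near the hyperplane it has measure of order T^(N-2), and
    its faces parallel to the hyperplane are at distance of order T from it, where the density has
    decayed.

    Pointwise gradients of Lipschitz functions are handled almost everywhere, through integrals over
    boxes. The cubes are rotated, so invariance of Lebesgue measure under orthogonal maps is
    established first. Lengths of curves are estimated through measurable functions below the speed,
    which is not assumed measurable. *)

Section rV_measurable.
Context {R : realType} {n : nat}.
Local Notation E := 'rV[R]_n.

Definition obox (a b : E) : set E :=
  [set x | forall i, (`]a ord0 i, b ord0 i[%classic : set R) (x ord0 i)].

Lemma rV_norm_le (x : E) (r : R) :
  0 <= r -> (forall i, `|x ord0 i| <= r) -> `|x| <= r.
Proof.
move=> r0 xr; rewrite -[leLHS]/(mx_norm x) mx_normrE.
by apply/bigmax_leP; split => // -[i j] _; rewrite (ord1 i); exact: xr.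
Qed.

Lemma rV_norm_lt (x : E) (r : R) :
  0 < r -> (forall i, `|x ord0 i| < r) -> `|x| < r.
Proof.
move=> r0 xr; rewrite -[ltLHS]/(mx_norm x) mx_normrE.
by apply/bigmax_ltP; split => // -[i j] _; rewrite (ord1 i); exact: xr.
Qed.

Lemma coord_le_norm (x : E) i : `|x ord0 i| <= `|x|.
Proof.
by rewrite -[leRHS]/(mx_norm x) mx_normrE; apply/bigmax_geP; right; exists (ord0, i).
Qed.

Lemma obox_ball (x : E) (r : R) : 0 < r ->
  obox (\row_i (x ord0 i - r)) (\row_i (x ord0 i + r)) = ball x r.
Proof.
move=> r0; apply/seteqP; split => y /=.
  move=> xy; rewrite -ball_normE /=; apply: rV_norm_lt => // i.
  have := xy i; rewrite !mxE /= in_itv /= => /andP[h1 h2].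
  by rewrite ltr_distlC; apply/andP; split; lra.
rewrite -ball_normE /= => xy i.
have := le_lt_trans (coord_le_norm _ i) xy.
by rewrite !mxE /= in_itv/= ltr_distlC.
Qed.

Lemma measurable_obox (a b : E) : measurable (obox a b).
Proof.
rewrite (_ : obox a b = \bigcap_(i in [set` index_enum 'I_n])
    ((fun x : E => x ord0 i) @^-1` `]a ord0 i, b ord0 i[%classic)).
  rewrite bigcap_seq; apply: bigsetI_measurable => i _.
  rewrite -[X in measurable X]setTI.
  exact: (measurable_rV_coord i measurableT (measurable_itv _)).
apply/seteqP; split=> [x xA i _|x xA i]; first exact: xA.
by apply: xA; rewrite /= mem_index_enum.
Qed.

(** Balls of the sup norm are boxes, and [U] is the union of those with rational centre and radius
    [m.+1%:R^-1] that it contains. *)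
Lemma open_measurable_rV (U : set E) : open U -> measurable U.
Proof.
move=> oU.
pose c (q : 'rV[rat]_n) : E := map_mx ratr q.
pose F (p : 'rV[rat]_n * nat) : set E :=
  if `[< ball (c p.1) p.2.+1%:R^-1 `<=` U >] then ball (c p.1) p.2.+1%:R^-1
  else set0.
rewrite (_ : U = \bigcup_p F p).
  apply: countable_bigcupT_measurable => // p; rewrite /F.
  case: ifPn => // _.
  by rewrite -obox_ball ?invr_gt0// ?ltr0n//; exact: measurable_obox.
apply/seteqP; split=> [x Ux|x [p _]]; last first.
  by rewrite /F; case: ifPn => // /asboolP; apply.
have /nbhs_ballP[e /= e0 xeU] : nbhs x U by exact: open_nbhs_nbhs.
(* The radius is below [e / 2]: a point of the small ball is within one radius of a rational centre,
   itself within one radius of [x]. *)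
pose m := Num.truncn (2 / e).
have m0 : (0 : R) < m.+1%:R^-1 by rewrite invr_gt0 ltr0n.
have me : m.+1%:R^-1 * 2 < e.
  rewrite -ltr_pdivlMr// -[ltRHS]invrK ltf_pV2 ?posrE ?invr_gt0 ?divr_gt0 ?ltr0n//.
  by rewrite invf_div truncnS_gt.
have hq i : exists q : rat, `|x ord0 i - ratr q| < m.+1%:R^-1.
  have h : x ord0 i - m.+1%:R^-1 < x ord0 i + m.+1%:R^-1 by rewrite ltrBlDr -addrA ltrDl addr_gt0.
  have [q] := rat_in_itvoo h.
  by rewrite in_itv/= -ltr_distlC => ?; exists q.
have [f hf] := choice hq.
pose q : 'rV[rat]_n := \row_i f i.
have xq : ball (c q) m.+1%:R^-1 x.
  rewrite -ball_normE /=; apply: rV_norm_lt => // i.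
  by rewrite !mxE distrC; exact: hf.
exists (q, m) => //; rewrite /F /= ifT//; apply/asboolP => y qy.
apply: xeU; move: xq qy; rewrite -!ball_normE /= => xq qy.
rewrite (le_lt_trans (ler_distD (c q) _ _))// (lt_trans _ me)//.
by rewrite mulr_natr mulr2n ltrD// distrC.
Qed.

Lemma continuous_measurable_rV (f : E -> R) : continuous f ->
  measurable_fun setT f.
Proof.
move=> cf; apply: (measurability _ (RGenOInfty.measurableE R)).
move=> _ [_ [r ->] <-]; rewrite setTI; apply: open_measurable_rV.
by move/continuousP : cf; apply; exact: interval_open.
Qed.

(** A half-space [x_i > r] is an increasing union of boxes, and half-spaces generate the product
    sigma-algebra. *)
Lemma rV_measurable_oboxE :
  (measurable : set (set E)) = <<s [set obox a b | a in setT & b in setT] >>.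
Proof.
apply/seteqP; split; last first.
  apply: smallest_sub; first exact: sigma_algebra_measurable.
  by move=> _ [a _ [b _ <-]]; exact: measurable_obox.
set G := [set _ | _ in _ & _ in _].
apply: smallest_sub; first exact: smallest_sigma_algebra.
move=> B; rewrite -bigcup_seq/= => -[i _ [Y mY <-]]; rewrite setTI.
have mS : sigma_algebra setT <<s G >> by exact: smallest_sigma_algebra.
pose H := [set Z : set R | <<s G >> ((fun x : E => x ord0 i) @^-1` Z)].
suff sH : measurable `<=` H by exact: sH.
suff: (@RGenOInfty.G R).-sigma.-measurable `<=` H.
  by rewrite -RGenOInfty.measurableE.
apply: smallest_sub.
  split.
  - by rewrite /H /= preimage_set0; case: mS.
  - by move=> Z mZ; rewrite /H /= setTD preimage_setC -setTD; case: mS => _ + _; exact.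
  - by move=> F mF; rewrite /H /= preimage_bigcup; case: mS => _ _; exact.
move=> Z [r ->]; rewrite /H /=.
pose a (k : nat) : E := \row_j (if j == i then r else - k%:R).
pose b (k : nat) : E := \row_j k%:R.
rewrite (_ : _ @^-1` _ = \bigcup_k obox (a k) (b k)).
  case: mS => _ _; apply => k; apply: sub_sigma_algebra.
  by exists (a k) => //; exists (b k).
apply/seteqP; split=> x /=; last first.
  by move=> [k _ /(_ i)]; rewrite /= !mxE eqxx !in_itv/= andbT => /andP[].
rewrite in_itv/= andbT => rx.
exists (Num.truncn (`|x|)).+1 => // j; rewrite /= !mxE in_itv/=.
have : `|x ord0 j| < (Num.truncn `|x|).+1%:R.
  by rewrite (le_lt_trans (coord_le_norm _ _))// truncnS_gt.
rewrite ltr_norml => /andP[h1 h2]; rewrite h2 andbT.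
by case: eqP => [->|].
Qed.

(** Boxes are stable under intersection, and the boxes []-k, k[^n] exhaust the space with finite
    measure. *)
Lemma rV_measure_unique (m1 m2 : {measure set E -> \bar R}) :
  (forall a b, m1 (obox a b) = m2 (obox a b)) ->
  (forall a b, (m1 (obox a b) < +oo)%E) ->
  forall A, measurable A -> m1 A = m2 A.
Proof.
move=> m12 m1oo.
pose g k : set E := obox (\row__ - k%:R) (\row__ k%:R).
apply: (@measure_unique _ _ _ _ g rV_measurable_oboxE).
- move=> _ _ [a1 _ [b1 _ <-]] [a2 _ [b2 _ <-]].
  exists (\row_i Num.max (a1 ord0 i) (a2 ord0 i)) => //.
  exists (\row_i Num.min (b1 ord0 i) (b2 ord0 i)) => //.
  apply/seteqP; split => x /=.
    move=> h; split=> i; have := h i;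
      by rewrite /= !mxE !in_itv/= gt_max lt_min => /andP[/andP[h1 h2] /andP[h3 h4]];
      apply/andP.
  move=> [h1 h2] i; have := h1 i; have := h2 i.
  by rewrite /= !mxE !in_itv/= gt_max lt_min => /andP[-> ->] /andP[-> ->].
- by move=> k; exists (\row__ - k%:R) => //; exists (\row__ k%:R).
- apply/seteqP; split=> // x _; exists (Num.truncn (`|x|)).+1 => // j.
  rewrite /= !mxE in_itv/= -ltr_norml.
  by rewrite (le_lt_trans (coord_le_norm _ _))// truncnS_gt.
- by move=> _ [a _ [b _ <-]].
- by move=> k; exact: m1oo.
Qed.

Lemma lebesgue_rV_obox (a b : E) :
  lebesgue_rV n (obox a b) =
  (\prod_(i < n) Num.max 0 (b ord0 i - a ord0 i))%:E.
Proof.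
have := @lebesgue_rV_box R n (fun i => `]a ord0 i, b ord0 i[%classic)
  (fun i => measurable_itv _).
rewrite /obox => ->.
rewrite -prodEFin; apply: eq_bigr => i _; rewrite lebesgue_measure_itv/= lte_fin.
case: ltP => ab; first by rewrite -EFinD max_r// subr_ge0 ltW.
by rewrite max_l// subr_le0.
Qed.

Lemma lebesgue_rV_obox_fin (a b : E) : (lebesgue_rV n (obox a b) < +oo)%E.
Proof. by rewrite lebesgue_rV_obox ltry. Qed.

End rV_measurable.

(** * Euclidean structure and Lipschitz functions *)

Section euclid.
Context {R : realType} {n : nat}.
Local Notation E := 'rV[R]_n.
Implicit Types x y z : E.

Lemma dotvE x y : dotv x y = (x *m y^T) ord0 ord0.
Proof. by rewrite mxE; apply: eq_bigr => i _; rewrite mxE. Qed.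

Lemma dotvC x y : dotv x y = dotv y x.
Proof. by apply: eq_bigr => i _; rewrite mulrC. Qed.

Lemma dotvDl x y z : dotv (x + y) z = dotv x z + dotv y z.
Proof. by rewrite !dotvE mulmxDl mxE. Qed.

Lemma dotvNl x z : dotv (- x) z = - dotv x z.
Proof. by rewrite !dotvE mulNmx mxE. Qed.

Lemma dotvBl x y z : dotv (x - y) z = dotv x z - dotv y z.
Proof. by rewrite dotvDl dotvNl. Qed.

Lemma dotvZl (k : R) x z : dotv (k *: x) z = k * dotv x z.
Proof. by rewrite !dotvE -scalemxAl mxE. Qed.

Lemma dotvDr x y z : dotv x (y + z) = dotv x y + dotv x z.
Proof. by rewrite dotvC dotvDl !(dotvC x). Qed.

Lemma dotvZr (k : R) x z : dotv x (k *: z) = k * dotv x z.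
Proof. by rewrite dotvC dotvZl dotvC. Qed.

Lemma dotvNr x z : dotv x (- z) = - dotv x z.
Proof. by rewrite dotvC dotvNl dotvC. Qed.

Lemma dotv_ge0 x : 0 <= dotv x x.
Proof. by apply: sumr_ge0 => i _; rewrite -expr2 sqr_ge0. Qed.

Lemma enorm_ge0 x : 0 <= enorm x. Proof. exact: sqrtr_ge0. Qed.

Lemma enorm_sqr x : enorm x ^+ 2 = dotv x x.
Proof. by rewrite /enorm sqr_sqrtr// dotv_ge0. Qed.

Lemma enorm_sqrE x : enorm x ^+ 2 = \sum_(i < n) x ord0 i ^+ 2.
Proof. by rewrite enorm_sqr; apply: eq_bigr => i _; rewrite expr2. Qed.

Lemma enorm_le_sqr x (r : R) : 0 <= r -> (enorm x <= r) = (dotv x x <= r ^+ 2).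
Proof. by move=> r0; rewrite -enorm_sqr ler_sqr// nnegrE enorm_ge0. Qed.

Lemma enormN x : enorm (- x) = enorm x.
Proof. by rewrite /enorm dotvNl dotvNr opprK. Qed.

Lemma enorm_distC x y : enorm (x - y) = enorm (y - x).
Proof. by rewrite -opprB enormN. Qed.

Lemma enormZ (k : R) x : enorm (k *: x) = `|k| * enorm x.
Proof.
by rewrite /enorm dotvZl dotvZr mulrA -expr2 sqrtrM ?sqr_ge0// sqrtr_sqr.
Qed.

Lemma enorm0 : enorm (0 : E) = 0.
Proof. by rewrite -[0 : E](scale0r 0) enormZ normr0 mul0r. Qed.

Lemma dotv_enorm0 x : enorm x = 0 -> x = 0.
Proof.
move=> x0; have : enorm x ^+ 2 = 0 by rewrite x0 expr0n.
rewrite enorm_sqrE => /psumr_eq0P h; apply/rowP => i.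
by rewrite mxE; apply/eqP; rewrite -sqrf_eq0; apply/eqP/h => // j _; rewrite sqr_ge0.
Qed.

Lemma cauchy_schwarz x y : `|dotv x y| <= enorm x * enorm y.
Proof.
have [y0|yn0] := eqVneq y 0.
  by rewrite y0 -(scale0r 0) dotvZr mul0r normr0 mulr_ge0// enorm_ge0.
have yp : 0 < dotv y y.
  rewrite -enorm_sqr exprn_gt0// lt_neqAle enorm_ge0 andbT eq_sym.
  by apply: contraNneq yn0 => /dotv_enorm0 ->.
rewrite -ler_sqr ?nnegrE ?mulr_ge0 ?enorm_ge0// real_normK ?num_real//.
rewrite exprMn !enorm_sqr -(ler_pM2l yp).
(* This vector is [dotv y y] times the component of [x] orthogonal to [y]. *)
have := dotv_ge0 (dotv y y *: x - dotv x y *: y).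
rewrite dotvBl !dotvZl dotvDr dotvNr !dotvZr (dotvDr y) dotvNr !dotvZr (dotvC y x).
rewrite -/(dotv y y); set a := dotv x x; set b := dotv x y; set c := dotv y y => h.
nra.
Qed.

Lemma enormD x y : enorm (x + y) <= enorm x + enorm y.
Proof.
rewrite enorm_le_sqr ?addr_ge0 ?enorm_ge0//.
rewrite dotvDl !dotvDr (dotvC y x) sqrrD !enorm_sqr.
have := ler_norm (dotv x y); have := cauchy_schwarz x y.
set a := dotv x x; set b := dotv x y; set c := dotv y y; nra.
Qed.

Lemma enormB_triangle x y z : enorm (x - z) <= enorm (x - y) + enorm (y - z).
Proof. by rewrite -[x - z](subrKA y); exact: enormD. Qed.

Lemma coord_le_enorm x i : `|x ord0 i| <= enorm x.
Proof.
rewrite -ler_sqr ?nnegrE ?enorm_ge0// real_normK ?num_real// enorm_sqrE.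
by rewrite (bigD1 i)//= lerDl sumr_ge0// => j _; rewrite sqr_ge0.
Qed.

Lemma norm_le_enorm x : `|x| <= enorm x.
Proof. by apply: rV_norm_le => [|i]; [exact: enorm_ge0|exact: coord_le_enorm]. Qed.

Lemma enorm_le_norm x : enorm x <= Num.sqrt n%:R * `|x|.
Proof.
rewrite enorm_le_sqr ?mulr_ge0 ?sqrtr_ge0// exprMn sqr_sqrtr ?ler0n//.
rewrite -enorm_sqr enorm_sqrE mulr_natl -[X in _ *+ X]card_ord -sumr_const.
apply: ler_sum => i _; rewrite -real_normK ?num_real// ler_sqr ?nnegrE//.
exact: coord_le_norm.
Qed.

(** With the Euclidean norm the signed distance has constant [Num.sqrt Theta]; the sup norm would
    let the dimension enter the bounds. *)
Definition lip (K : R) (f : E -> R) :=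
  forall x y, `|f x - f y| <= K * enorm (x - y).

Lemma lip_continuous (K : R) (f : E -> R) : lip K f -> continuous f.
Proof.
move=> fK x; have FF := @nbhs_filter E x.
have n1 : 0 < `|K| * Num.sqrt n%:R + 1 :> R.
  by rewrite ltr_wpDl// mulr_ge0// sqrtr_ge0.
apply/cvgrPdist_lt => e e0; near=> y; rewrite (le_lt_trans (fK _ _))//.
have : `|x - y| < e / (`|K| * Num.sqrt n%:R + 1).
  by near: y; apply: cvgr_dist_lt; rewrite ?divr_gt0.
rewrite ltr_pdivlMr// mulrDr mulr1; apply: le_lt_trans.
rewrite ler_wpDr// [leRHS]mulrC -mulrA.
rewrite (le_trans (ler_wpM2r _ (ler_norm _))) ?enorm_ge0//.
by rewrite ler_wpM2l// enorm_le_norm.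
Unshelve. all: by end_near. Qed.

Lemma enorm_lip : lip 1 (@enorm R n).
Proof.
move=> x y; rewrite mul1r ler_norml.
have := enormB_triangle x y 0; have := enormB_triangle y x 0.
by rewrite !subr0 (enorm_distC y x) => h1 h2; apply/andP; split; lra.
Qed.

Lemma dotv_lip (y : E) : lip (enorm y) (fun x => dotv x y).
Proof. by move=> x z; rewrite -dotvBl mulrC; exact: cauchy_schwarz. Qed.

Lemma dotv_orthogonal (P : 'M[R]_n) x y : P *m P^T = 1%:M ->
  dotv (x *m P) (y *m P) = dotv x y.
Proof.
by move=> PP; rewrite !dotvE trmx_mul mulmxA -(mulmxA x) PP mulmx1.
Qed.

Lemma enorm_orthogonal (P : 'M[R]_n) x : P *m P^T = 1%:M ->
  enorm (x *m P) = enorm x.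
Proof. by move=> PP; rewrite /enorm dotv_orthogonal. Qed.

End euclid.

(** * Invariance of Lebesgue measure under isometries *)

Section invariance.
Context {R : realType} {n : nat}.
Local Notation E := 'rV[R]_n.
Local Notation mu := (@lebesgue_rV R n).

Definition mpres (phi : E -> E) := measurable_fun setT phi /\
  forall A, measurable A -> mu (phi @^-1` A) = mu A.

Lemma integral_mpres (phi : E -> E) (D : set E) (f : E -> \bar R) :
  mpres phi -> measurable D -> measurable_fun D f ->
  (\int[mu]_(x in phi @^-1` D) f (phi x) = \int[mu]_(x in D) f x)%E.
Proof.
move=> [mphi phiE] mD mf.
suff h (g : E -> \bar R) : measurable_fun D g -> (forall x, 0 <= g x)%E ->
    (\int[mu]_(x in phi @^-1` D) g (phi x) = \int[mu]_(x in D) g x)%E.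
  rewrite integralE [RHS]integralE; congr (_ - _)%E.
    rewrite -(h _ (measurable_funepos mf) (funepos_ge0 f)).
    by apply: eq_integral => x _; rewrite !funeposE.
  rewrite -(h _ (measurable_funeneg mf) (funeneg_ge0 f)).
  by apply: eq_integral => x _; rewrite !funenegE.
move=> mg g0.
have := @ge0_integral_pushforward _ _ _ _ R phi mphi mu D g mD mg (fun x _ => g0 x).
rewrite /comp => <-; apply: eq_measure_integral => A mA _.
exact: phiE.
Qed.

Lemma Rintegral_mpres (phi : E -> E) (D : set E) (f : E -> R) :
  mpres phi -> measurable D -> measurable_fun D f ->
  \int[mu]_(x in phi @^-1` D) f (phi x) = \int[mu]_(x in D) f x.
Proof.
move=> mp mD mf; congr fine; rewrite -[RHS](integral_mpres mp)//.
exact/measurable_EFinP.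
Qed.

Lemma measurable_addv (v : E) : measurable_fun setT (fun x : E => x + v).
Proof.
apply: measurable_rVP => i; under eq_fun do rewrite mxE.
by apply: measurable_funD => //; exact: measurable_rV_coord.
Qed.

Lemma measurable_mulmx (P : 'M[R]_n) : measurable_fun setT (fun x : E => x *m P).
Proof.
apply: measurable_rVP => i; under eq_fun do rewrite mxE.
apply: measurable_sum => j; apply: measurable_funM => //.
exact: measurable_rV_coord.
Qed.

Lemma mpres_addv (v : E) : mpres (fun x : E => x + v).
Proof.
split; first exact: measurable_addv.
move=> A mA.
pose m := @measure_function_pushforward__canonical__measure_function_Measure
  _ _ _ _ R mu _ (measurable_addv v).
have boxE a b : m (obox a b) = mu (obox (a - v) (b - v)).
  rewrite /m /= /pushforward; congr (mu _); apply/seteqP.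
  by split=> x /= h i; have := h i;
    rewrite /= !mxE !in_itv/= ltrBlDr ltrBrDr.
apply: (@rV_measure_unique R n m mu) => // a b.
  etransitivity; first exact: boxE.
  etransitivity; first exact: lebesgue_rV_obox.
  apply/esym; etransitivity; first exact: lebesgue_rV_obox.
  by congr (_%:E); apply: eq_bigr => i _; rewrite !mxE opprB addrA subrK.
by rewrite boxE lebesgue_rV_obox_fin.
Qed.

(** Invariance under [x |-> - x] comes only later, as [mpresN], from [mpres_orthogonal], which
    relies on this lemma; the symmetry of [B] takes its place here. *)
Lemma symmetric_ball_translate (y : E) (B : set E) :
  measurable B -> (forall x, B (- x) -> B x) ->
  mu [set x | B (y - x)] = mu B.
Proof.
move=> mB Bsym; rewrite -[RHS](mpres_addv (- y)).2//.
congr (mu _); apply/seteqP; split=> x /= h.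
  by apply: Bsym; rewrite opprB.
by apply: Bsym; rewrite opprB.
Qed.

Lemma measurable_lincomb2 (P Q : 'M[R]_n) :
  measurable_fun setT (fun p : E * E => p.1 *m P + p.2 *m Q).
Proof.
apply: measurable_rVP => i; under eq_fun do rewrite mxE.
apply: measurable_funD.
  apply: (@measurableT_comp _ _ _ _ _ _ (fun x : E => (x *m P) ord0 i)) => //.
  apply: (@measurableT_comp _ _ _ _ _ _ (fun x : E => x ord0 i)) => //.
    exact: measurable_rV_coord.
  exact: measurable_mulmx.
apply: (@measurableT_comp _ _ _ _ _ _ (fun x : E => (x *m Q) ord0 i)) => //.
apply: (@measurableT_comp _ _ _ _ _ _ (fun x : E => x ord0 i)) => //.
  exact: measurable_rV_coord.
exact: measurable_mulmx.
Qed.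

Lemma measurable_subp : measurable_fun setT (fun p : E * E => p.1 - p.2).
Proof.
have := measurable_lincomb2 1%:M (- 1%:M).
by under eq_fun do rewrite mulmxN !mulmx1.
Qed.

Lemma measurable_preimageT d1 d2 (T1 : measurableType d1) (T2 : measurableType d2)
  (f : T1 -> T2) (A : set T2) : measurable_fun setT f -> measurable A ->
  measurable (f @^-1` A).
Proof. by move=> mf mA; rewrite -[X in measurable X]setTI; exact: mf. Qed.

Definition eball (r : R) : set E := [set x | enorm x < r].

Lemma measurable_eball r : measurable (eball r).
Proof.
rewrite (_ : eball r = (@enorm R n) @^-1` `]-oo, r[%classic).
  apply: measurable_preimageT => //; apply: continuous_measurable_rV.
  exact: lip_continuous (enorm_lip).
by apply/seteqP; split=> x; rewrite /= in_itv.
Qed.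

Lemma bounded_lebesgue_fin (A : set E) (r : R) : measurable A ->
  (forall x, A x -> `|x| < r) -> (mu A < +oo)%E.
Proof.
move=> mA Ar; apply: le_lt_trans (lebesgue_rV_obox_fin (\row__ (- r)) (\row__ r)).
apply: le_measure; rewrite ?inE//; first exact: measurable_obox.
move=> x /Ar xr i; rewrite /= !mxE in_itv/= -ltr_norml.
exact: le_lt_trans (coord_le_norm _ _) xr.
Qed.

Lemma eball_fin r : (mu (eball r) < +oo)%E.
Proof.
apply: (@bounded_lebesgue_fin _ r); first exact: measurable_eball.
by move=> x; exact: le_lt_trans (norm_le_enorm _).
Qed.

Lemma lebesgue_ball_gt0 (x : E) r : 0 < r -> (0 < mu (ball x r))%E.
Proof.
move=> r0; rewrite -obox_ball// lebesgue_rV_obox lte_fin prodr_gt0// => i _.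
by rewrite !mxE lt_max; apply/orP; right; lra.
Qed.

Lemma eball_gt0 r : 0 < r -> (0 < mu (eball r))%E.
Proof.
move=> r0; have n1 : 0 < Num.sqrt n%:R + 1 :> R by rewrite ltr_wpDl// sqrtr_ge0.
have := @lebesgue_ball_gt0 0 (r / (Num.sqrt n%:R + 1)).
rewrite divr_gt0// => /(_ isT) /lt_le_trans; apply.
apply: le_measure; rewrite ?inE//; [|exact: measurable_eball|].
  by rewrite -obox_ball ?divr_gt0//; exact: measurable_obox.
move=> x; rewrite -ball_normE /= sub0r normrN ltr_pdivlMr// => xr.
rewrite /eball /= (le_lt_trans (enorm_le_norm _))//.
by apply: le_lt_trans xr; rewrite mulrC ler_wpM2l// lerDl.
Qed.

Lemma indic_prod_int (A : set E) (c : \bar R) : measurable A -> (0 <= c)%E ->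
  (\int[mu]_x (c * (\1_A x)%:E) = c * mu A)%E.
Proof.
move=> mA c0; rewrite ge0_integralZl//.
  by rewrite integral_indic// setIT.
by apply/measurable_EFinP.
Qed.

(* Both iterated integrals of [1_A (x P + y) 1_B y] for the Euclidean ball [B],
   which is symmetric and invariant under [P]: translation invariance evaluates
   one of them to [mu (P^-1 A) mu B], the other to [mu A mu B]. *)
Lemma mpres_orthogonal (P : 'M[R]_n) : P *m P^T = 1%:M ->
  mpres (fun x : E => x *m P).
Proof.
move=> PP; have PTP : P^T *m P = 1%:M by exact: mulmx1C.
have PTT : P^T *m P^T^T = 1%:M by rewrite trmxK.
split; first exact: measurable_mulmx.
move=> A mA; set B := eball 1.
have mB : measurable B by exact: measurable_eball.
pose F (p : E * E) : \bar R := ((\1_A (p.1 *m P + p.2))%:E * (\1_B p.2)%:E)%E.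
have mF : measurable_fun setT F.
  apply: emeasurable_funM; apply/measurable_EFinP.
    apply: (@measurableT_comp _ _ _ _ _ _ (\1_A : E -> R)) => //.
    have := measurable_lincomb2 P 1%:M.
    by under eq_fun do rewrite mulmx1.
  by apply: (@measurableT_comp _ _ _ _ _ _ (\1_B : E -> R)).
have F0 p : (0 <= F p)%E by rewrite mule_ge0.
have /= := @fubini_tonelli _ _ _ _ _ mu mu _ mF F0.
have -> : (\int[mu]_x \int[mu]_y F (x, y) = mu B * mu A)%E.
  transitivity (\int[mu]_x \int[mu]_y ((\1_A y)%:E * (\1_B (y - x *m P))%:E))%E.
    apply: eq_integral => x _.
    have := @integral_mpres (fun y => y + x *m P) setT
      (fun y => (\1_A y)%:E * (\1_B (y - x *m P))%:E)%E (mpres_addv _) measurableT.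
    rewrite preimage_setT => <-.
      by apply: eq_integral => y _; rewrite /F /= addrK addrC.
    apply: emeasurable_funM; apply/measurable_EFinP => //.
    apply: (@measurableT_comp _ _ _ _ _ _ (\1_B : E -> R)) => //.
    exact: measurable_addv.
  pose G (p : E * E) : \bar R := ((\1_A p.2)%:E * (\1_B (p.2 - p.1 *m P))%:E)%E.
  have mG : measurable_fun setT G.
    apply: emeasurable_funM; apply/measurable_EFinP.
      by apply: (@measurableT_comp _ _ _ _ _ _ (\1_A : E -> R)).
    apply: (@measurableT_comp _ _ _ _ _ _ (\1_B : E -> R)) => //.
    have := measurable_lincomb2 (- P) 1%:M.
    by under eq_fun do rewrite mulmx1 mulmxN addrC.
  have G0 p : (0 <= G p)%E by rewrite mule_ge0.
  rewrite (@fubini_tonelli _ _ _ _ _ mu mu _ mG G0) /G /=.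
  rewrite -indic_prod_int//; apply: eq_integral => y _.
  transitivity ((\1_A y)%:E * mu [set x | B (y *m P^T - x)%R])%E; last first.
    have Bsym x : B (- x) -> B x by rewrite /B /eball /= enormN.
    by rewrite (symmetric_ball_translate (y *m P^T) mB Bsym) [LHS]muleC.
  have mC : measurable [set x | B (y *m P^T - x)].
    have mf : measurable_fun setT (fun x : E => y *m P^T - x).
      have mh : measurable_fun setT (fun x : E => (y *m P^T, x)).
        exact: measurable_pair1.
      exact: (measurableT_comp measurable_subp mh).
    exact: (measurable_preimageT mf).
  have c0 : (0 <= (\1_A y)%:E :> \bar R)%E by rewrite lee_fin.
  rewrite -(indic_prod_int mC c0).
  apply: eq_integral => x _; congr (_ * _)%E; congr EFin.
  (* Invariance of the ball removes [P] from the variable of integration, so that a translate of the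
     ball remains. *)
  have key : enorm (y - x *m P) = enorm (y *m P^T - x).
    by rewrite -(enorm_orthogonal (y - _) PTT) mulmxBl -mulmxA PP mulmx1.
  rewrite !indicE; congr (nat_of_bool _)%:R.
  by apply/idP/idP; rewrite !inE /B /eball /= key.
have -> : (\int[mu]_y \int[mu]_x F (x, y) = mu ((fun x => x *m P) @^-1` A) * mu B)%E.
  rewrite -indic_prod_int//; apply: eq_integral => y _.
  rewrite /F /= -[in RHS](mpres_addv (y *m P^T)).2; last first.
    exact: measurable_preimageT (measurable_mulmx P) mA.
  rewrite [RHS]muleC -indic_prod_int//; last first.
    apply: measurable_preimageT (measurable_addv _) _.
    exact: measurable_preimageT (measurable_mulmx P) mA.
  apply: eq_integral => x _; rewrite muleC; congr (_ * _)%E; congr EFin.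
  rewrite !indicE; congr (nat_of_bool _)%:R.
  by apply/idP/idP; rewrite !inE /= mulmxDl -mulmxA PTP mulmx1.
have Bfin : mu B \is a fin_num by rewrite ge0_fin_numE// eball_fin.
have B0 : mu B != 0%E by rewrite gt_eqF// eball_gt0.
rewrite [RHS]muleC => /(congr1 (fun z => (fine (mu B))^-1%:E * z)%E).
have B1 : fine (mu B) != 0 by rewrite fine_eq0.
by rewrite -(fineK Bfin) !muleA -EFinM mulVf// !mul1e => ->.
Qed.

Lemma mpresN : mpres (fun x : E => - x).
Proof.
have -> : (fun x : E => - x) = (fun x : E => x *m (- 1%:M)).
  by apply/funext => x; rewrite mulmxN mulmx1.
by apply: mpres_orthogonal; rewrite linearN/= trmx1 mulNmx mulmxN opprK mulmx1.
Qed.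

End invariance.

(** * Lipschitz functions on the line *)

Section lipschitz_real.
Context {R : realType}.
Local Notation la := (@lebesgue_measure R).

Definition lip1 (K : R) (f : R -> R) :=
  forall x y, `|f x - f y| <= K * `|x - y|.

Lemma lip1_continuous (K : R) (f : R -> R) : lip1 K f -> continuous f.
Proof.
move=> fK x; apply/cvgrPdist_lt => e e0; near=> y.
have K1 : 0 < `|K| + 1 by rewrite ltr_wpDl.
rewrite (le_lt_trans (fK _ _))//.
have : `|x - y| < e / (`|K| + 1).
  by near: y; apply: cvgr_dist_lt => //; rewrite divr_gt0.
rewrite ltr_pdivlMr//; apply: le_lt_trans; rewrite mulrC ler_wpM2l//.
by rewrite (le_trans (ler_norm _))// lerDl.
Unshelve. all: by end_near. Qed.

Lemma lebesgue_stieltjes_itv (F : cumulative R R) (a b : R) : a <= b ->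
  lebesgue_stieltjes_measure F `]a, b]%classic = (F b - F a)%:E.
Proof.
move=> ab; rewrite /lebesgue_stieltjes_measure /measure_extension/=.
by rewrite measurable_mu_extE/= ?wlength_itv_bnd//; exact: is_ocitv.
Qed.

(** Slopes of [f] are at most 1 in absolute value, so adding the identity makes it nondecreasing.
    The values 1 and -1 of [s] give two halves of the identity. *)
Let half_cumulative (f : R -> R) (s : R) : lip1 1 f -> `|s| <= 1 ->
  exists F : cumulative R R, forall x, F x = 2^-1 * (x + s * f x).
Proof.
move=> f1 s1; pose F (x : R) := 2^-1 * (x + s * f x).
have nd : nondecreasing F.
  move=> x y xy; rewrite /F ler_pM2l ?invr_gt0//.
  have : s * (f x - f y) <= y - x.
    rewrite (le_trans (ler_norm _))// normrM (le_trans (ler_wpM2r _ s1))//.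
    by rewrite mul1r (le_trans (f1 x y))// mul1r distrC ger0_norm// subr_ge0.
  by lra.
have rc : right_continuous F.
  apply: right_continuousW; apply: (@lip1_continuous 1) => x y.
  rewrite mul1r /F -mulrBr normrM [`|2^-1|]ger0_norm// ler_pdivrMl//.
  rewrite opprD addrACA -mulrBr (le_trans (ler_normD _ _))//.
  rewrite mulr_natl mulr2n lerD// normrM.
  by rewrite (le_trans (ler_wpM2r _ s1))// mul1r (le_trans (f1 x y))// mul1r.
pose FC : cumulative R R :=
  HB.pack_for (cumulative R R) F (isCumulative.Build R _ R F nd rc).
by exists FC.
Qed.

(* With [F = (id + f) / 2] and [G = (id - f) / 2], both nondecreasing, the
   Stieltjes measures of [F] and [G] add up to Lebesgue measure, so that the
   former has a Radon-Nikodym density. *)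
Let lip1_density1 (f : R -> R) (a b : R) : lip1 1 f -> a < b ->
  exists2 g : R -> R, la.-integrable setT (EFin \o g) &
    forall x, a <= x <= b -> f x - f a = \int[la]_(t in `]a, x]) g t.
Proof.
move=> f1 ab.
have [F FE] : exists F : cumulative R R, forall x, F x = 2^-1 * (x + 1 * f x).
  by apply: half_cumulative => //; rewrite normr1.
have [G GE] : exists F : cumulative R R, forall x, F x = 2^-1 * (x + -1 * f x).
  by apply: half_cumulative => //; rewrite normrN1.
(* Restriction to []a, b]] makes the Stieltjes measure finite before the Radon-Nikodym theorem is
   applied. *)
pose nu := mrestr (lebesgue_stieltjes_measure F) (measurable_itv `]a, b]).
have nufin : fin_num_fun nu.
  move=> A mA; rewrite ge0_fin_numE//.
  apply: (@le_lt_trans _ _ (lebesgue_stieltjes_measure F `]a, b]%classic)).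
    apply: le_measure; rewrite ?inE; [|exact: measurable_itv|exact: subIsetr].
    by apply: measurableI => //; exact: measurable_itv.
  by rewrite lebesgue_stieltjes_itv ?ltry// ltW.
pose nuF : {finite_measure set (measurableTypeR R) -> \bar R} :=
  HB.pack_for {finite_measure set (measurableTypeR R) -> \bar R} nu
    (Measure_isFinite.Build _ _ _ nu nufin).
have lFG A : measurable A ->
    la A = (lebesgue_stieltjes_measure F A + lebesgue_stieltjes_measure G A)%E.
  move=> mA; rewrite -measure_addE; apply: lebesgue_measure_unique => // X oX.
  transitivity (lebesgue_stieltjes_measure F X + lebesgue_stieltjes_measure G X)%E;
    last by rewrite -measure_addE.
  move: oX => /ocitvP[->|]; first by rewrite !measure0 adde0.
  move=> [[x y] /= xy ->]; rewrite !lebesgue_stieltjes_itv ?ltW//.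
  rewrite lebesgue_measure_itv/= lte_fin xy -!EFinD !FE !GE.
  by congr (_%:E); field.
have nula : nuF `<< la.
  apply/null_content_dominatesP => A mA.
  move=> lA0; have := lFG A mA.
  rewrite lA0 => /esym/eqP.
  rewrite padde_eq0// => /andP[/eqP h _].
  apply/eqP; rewrite eq_le measure_ge0 andbT -h.
  by apply: le_measure; rewrite ?inE//; exact: measurableI.
have [h [h0 hfin hint hE]] := radon_nikodym_sigma_finite nula.
(* Indeed [f = 2 F - id], and [h] is the density of [F] on []a, b]]. *)
pose g x := 2 * fine (h x) - \1_(`]a, b]%classic) x.
have inth : la.-integrable setT (EFin \o (fun x => 2 * fine (h x))).
  rewrite (_ : _ \o _ = (fun x => 2%:E * h x)%E).
    exact: integrableZl.
  by apply/funext => x /=; rewrite EFinM fineK.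
have int1 : la.-integrable setT (EFin \o (\1_(`]a, b]%classic) : R -> R)).
  apply/integrableP; split; first exact/measurable_EFinP/measurable_indic.
  under eq_integral do rewrite /= ger0_norm//.
  rewrite integral_indic// setIT.
  have : (la `]a, b]%classic < +oo)%E.
    by rewrite lebesgue_measure_itv/= lte_fin ab -EFinD ltry.
  by [].
exists g; first by apply: (integrableB measurableT inth int1).
move=> x /andP[ax xb].
have sub : `]a, x]%classic `<=` `]a, b]%classic.
  by move=> t /=; rewrite !in_itv/= => /andP[-> /le_trans]; apply.
rewrite RintegralB//; [|exact: integrableS inth|exact: integrableS int1].
rewrite RintegralZl//; last first.
  have : la.-integrable setT (EFin \o (fine \o h)).
    by rewrite (_ : _ \o _ = h)//; apply/funext => t /=; rewrite fineK.
  by apply: integrableS.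
have -> : \int[la]_(t in `]a, x]) fine (h t) = F x - F a.
  rewrite /Rintegral; under eq_integral do rewrite fineK//.
  rewrite -hE//= /nuF/= /nu /mrestr setIidl// lebesgue_stieltjes_itv//.
have -> : \int[la]_(t in `]a, x]) \1_(`]a, b]%classic) t = x - a.
  rewrite /Rintegral integral_indic// setIidr//.
  have h' : la `]a, x]%classic = (x - a)%:E.
    rewrite lebesgue_measure_itv/= lte_fin; case: ltP => // xa.
    by congr (_%:E); apply/esym/eqP; rewrite subr_eq0 eq_le xa.
  exact: (congr1 fine h').
by rewrite !FE; field.
Qed.

Lemma lip1_density (K : R) (f : R -> R) (a b : R) : lip1 K f -> a < b ->
  exists2 g : R -> R, la.-integrable setT (EFin \o g) &
    forall x, a <= x <= b -> f x - f a = \int[la]_(t in `]a, x]) g t.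
Proof.
(* Adding 1 keeps [c] invertible when [K] is 0. *)
move=> fK ab; pose c := `|K| + 1.
have c0 : 0 < c by rewrite ltr_wpDl.
have [|g ig gE] := @lip1_density1 (fun x => c^-1 * f x) _ _ _ ab.
  move=> x y; rewrite mul1r -mulrBr normrM gtr0_norm ?invr_gt0// ler_pdivrMl//.
  rewrite (le_trans (fK x y))// ler_wpM2r// (le_trans (ler_norm _))// lerDl//.
exists (fun x => c * g x).
  by have := integrableZl measurableT c ig.
move=> x ax; rewrite RintegralZl//; last exact: integrableS ig.
by rewrite -gE// -mulrBr mulrA mulfV ?mul1r// gt_eqF.
Qed.

Let near_addr_derive (G f : R -> R) (c x : R) :
  {near x, (fun y => G y + c) =1 f} -> derivable G x 1 ->
  derivable f x 1 /\ derive1 f x = derive1 G x.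
Proof.
move=> fG dG; have dG' : derivable (G \+ cst c) x 1 by exact: derivableD.
split; first exact: near_eq_derivable dG'.
rewrite !derive1E -(near_eq_derive _ fG).
by rewrite -[LHS]/('D_1 (G \+ cst c) x) deriveD// derive_cst addr0.
Qed.

Lemma lip1_ae_derive (K : R) (f : R -> R) (a b : R) : lip1 K f -> a < b ->
  exists2 g : R -> R, la.-integrable setT (EFin \o g) &
    (forall x, a <= x <= b -> f x - f a = \int[la]_(t in `]a, x]) g t) /\
    {ae la, forall x, a < x < b -> derivable f x 1 /\ derive1 f x = g x}.
Proof.
move=> fK ab; have [g ig gE] := lip1_density fK ab; exists g => //; split=> //.
have lg : locally_integrable setT g.
  by apply: open_integrable_locally => //; exact: openT.
have igy y : la.-integrable `]a, y] (EFin \o g) by exact: integrableS ig.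
have := @FTC1 _ g (BRight a) igy lg.
apply: filterS; first exact: (ae_filter_ringOfSetsType la).
move=> x /= h /andP[ax xb].
have {h}[dG GE] := h ax.
set G := fun x => \int[la]_(t in `]a, x]) g t in dG GE.
have fG : {near x, (fun y => G y + f a) =1 f}.
  near=> y; rewrite /G -gE ?subrK//.
  have : y \in `]a, b[ by near: y; apply: near_in_itvoo; rewrite in_itv/= ax xb.
  by rewrite in_itv/= => /andP[/ltW-> /ltW->].
have [df ->] := near_addr_derive fG dG; split => //.
Unshelve. all: by end_near. Qed.

Lemma lip1_ae_derivable (K : R) (f : R -> R) : lip1 K f ->
  {ae la, forall x, derivable f x 1}.
Proof.
move=> fK.
have h (n : nat) : {ae la, forall x, - n%:R < x < n.+1%:R -> derivable f x 1}.
  have [|g _ [_]] := @lip1_ae_derive K f (- n%:R) n.+1%:R fK.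
    by rewrite (@le_lt_trans _ _ 0)// ?ltr0n// oppr_le0 ler0n.
  apply: filterS; first exact: (ae_filter_ringOfSetsType la).
  by move=> x hx /hx[].
move: (ae_foralln h); apply: filterS => x /(_ (Num.truncn `|x|).+1); apply.
have := truncnS_gt `|x|; rewrite ltr_norml => /andP[-> h1] /=.
by rewrite (lt_trans h1)// ltr_nat.
Qed.

End lipschitz_real.

(** * Directional derivatives of Lipschitz functions *)

Section directional.
Context {R : realType} {n : nat}.
Local Notation E := 'rV[R]_n.
Local Notation mu := (@lebesgue_rV R n).
Local Notation la := (@lebesgue_measure R).

(** At [t = 0] the value is 0, since the inverse of 0 is 0; bounds such as [dquo_le] thus hold for
    every [t]. *)
Definition dquo (f : E -> R) (v : E) (t : R) (x : E) : R :=
  t^-1 * (f (x + t *: v) - f x).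

Let quoE (f : E -> R) v x :
  (fun h : R => h^-1 *: ((f \o shift x) (h *: v) - f x)) = dquo f v ^~ x.
Proof. by apply/funext => h /=; rewrite /dquo /shift /= [x + _]addrC. Qed.

Lemma derivableE (f : E -> R) v x :
  derivable f x v <-> cvg (dquo f v t x @[t --> 0^']).
Proof. by rewrite /derivable quoE. Qed.

Lemma deriveE' (f : E -> R) v x : 'D_v f x = lim (dquo f v t x @[t --> 0^']).
Proof. by rewrite /derive quoE. Qed.

Lemma derive_cvg (f : E -> R) v x : derivable f x v ->
  dquo f v t x @[t --> 0^'] --> 'D_v f x.
Proof. by move=> /derivableE; rewrite deriveE'. Qed.

Let lineE (f : E -> R) v x (t : R) :
  (fun h : R => h^-1 *: ((f \o shift (x + t *: v)) (h *: v) - f (x + t *: v)))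
  = (fun h : R => h^-1 *: (((fun s : R => f (x + s *: v)) \o shift t)
                             (h *: (1 : R)) - f (x + t *: v))).
Proof.
apply/funext => h /=; congr (_ *: (f _ - _)).
by rewrite /shift /= [_ *: 1]mulr1 scalerDl addrCA.
Qed.

Lemma derivable_line (f : E -> R) v x (t : R) :
  derivable f (x + t *: v) v <-> derivable (fun s : R => f (x + s *: v)) t 1.
Proof. by rewrite /derivable lineE. Qed.

Lemma derive_line (f : E -> R) v x (t : R) :
  'D_v f (x + t *: v) = 'D_1 (fun s : R => f (x + s *: v)) t.
Proof. by rewrite /derive lineE. Qed.

(** This default value lets bounds such as [derive_le] hold at every point. *)
Lemma derive_dflt (f : E -> R) v x : ~ derivable f x v -> 'D_v f x = 0.
Proof. by move=> nd; rewrite /derive; exact: dvgP. Qed.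

Lemma dquo_continuous_x (f : E -> R) v t : continuous f -> continuous (dquo f v t).
Proof.
move=> cf x; have FF := @nbhs_filter E x.
apply: cvgM; first exact: cvg_cst.
apply: cvgB; last exact: cf.
apply: (@cvg_comp _ _ _ (fun x => x + t *: v) f); last exact: cf.
by apply: cvgD; [exact: cvg_id|exact: cvg_cst].
Qed.

Lemma dquo_continuous_t (f : E -> R) v t x : continuous f -> t != 0 ->
  {for t, continuous (fun t => dquo f v t x)}.
Proof.
move=> cf t0; apply: cvgM; first exact: cvgV.
apply: cvgB; last exact: cvg_cst.
apply: (@cvg_comp _ _ _ (fun t : R => x + t *: v) f); last exact: cf.
by apply: cvgD; [exact: cvg_cst|apply: cvgZr_tmp; exact: cvg_id].
Qed.

Lemma lip_line (K : R) (f : E -> R) x v : lip K f ->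
  lip1 (K * enorm v) (fun s => f (x + s *: v)).
Proof.
move=> fK s t; rewrite (le_trans (fK _ _))// opprD addrACA subrr add0r -scalerBl.
by rewrite enormZ -mulrA [enorm v * _]mulrC.
Qed.

Lemma dquo_le (K : R) (f : E -> R) v t x : lip K f -> `|dquo f v t x| <= `|K| * enorm v.
Proof.
move=> fK; rewrite /dquo normrM; have [->|t0] := eqVneq t 0.
  by rewrite invr0 normr0 mul0r mulr_ge0// enorm_ge0.
rewrite normfV ler_pdivrMl ?normr_gt0// (le_trans (fK _ _))// addrC addKr enormZ.
by rewrite mulrCA ler_wpM2l// ler_wpM2r ?enorm_ge0// ler_norm.
Qed.

Lemma derive_le (K : R) (f : E -> R) v x : lip K f -> `|'D_v f x| <= `|K| * enorm v.
Proof.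
move=> fK; have [d|nd] := pselect (derivable f x v); last first.
  by rewrite derive_dflt// normr0 mulr_ge0// enorm_ge0.
have h := derive_cvg d.
rewrite -(cvg_lim _ (cvg_norm h))//.
apply: limr_le; first by apply/cvg_ex; exists `|'D_v f x|; exact: cvg_norm h.
by apply: nearW => t; exact: dquo_le.
Qed.

(* Cauchy criterion along rational steps. *)
Let dq_osc (f : E -> R) v (k m : nat) (s t : rat) : set E :=
  [set x | 0 < `|ratr s : R| < m.+1%:R^-1 -> 0 < `|ratr t : R| < m.+1%:R^-1 ->
    `|dquo f v (ratr s) x - dquo f v (ratr t) x| <= k.+1%:R^-1].

(** The quotient is continuous in the step away from 0, so testing rational steps is enough.
    Differentiability is thereby expressed with countably many conditions, each closed in [x]. *)
Lemma derivable_rat (f : E -> R) v x : continuous f ->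
  derivable f x v <-> forall k, exists m, forall s t, dq_osc f v k m s t x.
Proof.
move=> cf; rewrite derivableE; split=> [/cvg_ex[l] /cvgrPdist_le h k|h].
  have k0 : 0 < k.+1%:R^-1 / 2 :> R by rewrite divr_gt0.
  have [e /= e0 he] := h _ k0.
  exists (Num.truncn e^-1) => s t /andP[s0 se] /andP[t0 te].
  have small (r : R) : 0 < `|r| -> `|r| < (Num.truncn e^-1).+1%:R^-1 ->
      `|l - dquo f v r x| <= k.+1%:R^-1 / 2.
    move=> r0 re; apply: he; last by rewrite -normr_gt0.
    rewrite /= sub0r normrN (lt_trans re)// -[ltRHS]invrK.
    by rewrite ltf_pV2 ?posrE ?invr_gt0 ?ltr0n// truncnS_gt.
  rewrite (le_trans (ler_distD l _ _))// [leRHS]splitr lerD//; last exact: small.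
  by rewrite distrC small.
apply: cauchy_cvg; apply: cauchy_exP => e e0.
have [k ke] : exists k, k.+1%:R^-1 < e.
  exists (Num.truncn e^-1); rewrite -[ltRHS]invrK.
  by rewrite ltf_pV2 ?posrE ?invr_gt0 ?ltr0n// truncnS_gt.
have [m hm] := h k.
pose V := [set r : R | 0 < `|r| < m.+1%:R^-1].
have VD : nbhs (0:R)^' V.
  exists m.+1%:R^-1 => /=; first by rewrite -div1r divr_gt0// ltr0n.
  by move=> r /=; rewrite sub0r normrN /V /= normr_gt0 => -> ->.
have oV : open V.
  rewrite (_ : V = (Num.norm : R -> R) @^-1` `]0, m.+1%:R^-1[%classic).
    by apply: open_comp; [move=> r _; exact: norm_continuous|exact: interval_open].
  by apply/seteqP; split=> r; rewrite /V /= in_itv.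
have key (s t : R) : V s -> V t -> `|dquo f v s x - dquo f v t x| <= k.+1%:R^-1.
  have approx (r : R) (d : R) : V r -> 0 < d ->
      exists q : rat, V (ratr q) /\ `|dquo f v r x - dquo f v (ratr q) x| < d.
    move=> Vr d0; have r0 : r != 0 by case/andP: Vr; rewrite normr_gt0.
    have /cvgrPdist_lt /(_ d d0) := @dquo_continuous_t f v r x cf r0.
    have nV : nbhs r V by exact: open_nbhs_nbhs.
    move=> hd; have [d' /= d'0 hd'] := filterI nV hd.
    have hr : r - d' < r + d' by rewrite ltrBlDr -addrA ltrDl addr_gt0.
    have [q] := rat_in_itvoo hr; rewrite in_itv/= => hq.
    by exists q; apply: hd'; rewrite /= ltr_distlC.
  move=> Vs Vt; apply/ler_addgt0Pr => d d0.
  have d2 : 0 < d / 2 by rewrite divr_gt0.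
  have [p [Vp hp]] := approx s (d / 2) Vs d2.
  have [q [Vq hq]] := approx t (d / 2) Vt d2.
  have := hm p q Vp Vq; move: (k.+1%:R^-1 : R) => c.
  move: hp hq; rewrite !ltr_norml !ler_norml => /andP[? ?] /andP[? ?] /andP[? ?].
  by apply/andP; split; lra.
have V0 : V (m.+1%:R^-1 / 2).
  rewrite /V /= normr_gt0 gtr0_norm ?divr_gt0 ?invr_gt0 ?ltr0n//.
  by rewrite gt_eqF ?divr_gt0 ?invr_gt0 ?ltr0n//= ltr_pdivrMr// ltr_pMr ?invr_gt0 ?ltr0n// ltr1n.
exists (dquo f v (m.+1%:R^-1 / 2) x).
apply: (filterS _ VD) => t Vt; rewrite -ball_normE /=.
exact: le_lt_trans (key _ _ V0 Vt) ke.
Qed.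

Lemma measurable_derivable (f : E -> R) v : continuous f ->
  measurable [set x | derivable f x v].
Proof.
move=> cf.
have -> : [set x | derivable f x v] =
    \bigcap_k \bigcup_m ~` (\bigcup_(st : rat * rat) ~` dq_osc f v k m st.1 st.2).
  apply/seteqP; split=> x.
    move=> /(derivable_rat v x cf) h k _; have [m hm] := h k.
    by exists m => // -[[s t] _]; apply; exact: hm.
  move=> h; apply/(derivable_rat v x cf) => k; have [m _ hm] := h k I.
  exists m => s t; apply: contrapT => hn; apply: hm.
  by exists (s, t).
apply: bigcapT_measurable => k; apply: bigcupT_measurable => m.
apply: measurableC; apply: countable_bigcupT_measurable => // -[s t] /=.
apply: measurableC; rewrite /dq_osc.
have [hs|hs] := pselect (0 < `|ratr s : R| < m.+1%:R^-1); last first.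
  rewrite [X in measurable X](_ : _ = setT)//; apply/seteqP; split => // x _.
  by move=> /hs.
have [ht|ht] := pselect (0 < `|ratr t : R| < m.+1%:R^-1); last first.
  rewrite [X in measurable X](_ : _ = setT)//; apply/seteqP; split => // x _.
  by move=> _ /ht.
rewrite (_ : mkset _ =
  (fun x => `|dquo f v (ratr s) x - dquo f v (ratr t) x|) @^-1` `]-oo, k.+1%:R^-1]%classic).
  apply: measurable_preimageT => //.
  apply: measurableT_comp => //; apply: measurable_funB.
    by apply: continuous_measurable_rV; exact: dquo_continuous_x.
  by apply: continuous_measurable_rV; exact: dquo_continuous_x.
apply/seteqP; split=> x /=; rewrite in_itv/=; first by apply.
by move=> ? _ _.
Qed.

Lemma dquo_cvg_seq (f : E -> R) v x : derivable f x v ->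
  dquo f v k.+1%:R^-1 x @[k --> \oo] --> 'D_v f x.
Proof.
move=> /derive_cvg d.
have /cvgr_dnbhsP h := d.
apply: h; split; first by move=> k; rewrite invr_eq0 pnatr_eq0.
exact: cvg_harmonic.
Qed.

(** The derivative is a pointwise limit of measurable functions: the quotients along the steps
    [k.+1%:R^-1], cut off outside the measurable set of differentiability, where the derivative is 0
    by default. *)
Lemma measurable_derive (f : E -> R) v : continuous f ->
  measurable_fun setT (fun x => 'D_v f x).
Proof.
move=> cf; pose A := [set x | derivable f x v].
have mA : measurable A by exact: measurable_derivable.
pose h k x : R := \1_A x * dquo f v k.+1%:R^-1 x.
apply: (@measurable_fun_cvg _ _ _ _ h) => [k|x _].
  apply: measurable_funM; first exact: measurable_indic.
  by apply: continuous_measurable_rV; exact: dquo_continuous_x.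
rewrite /h indicE; case: (boolP (x \in A)) => [|xA].
  rewrite inE => d; under eq_fun do rewrite mul1r; exact: dquo_cvg_seq.
rewrite derive_dflt; last by move: xA; rewrite notin_setE.
under eq_fun do rewrite mul0r; exact: cvg_cst.
Qed.

Lemma measurable_line (v : E) :
  measurable_fun setT (fun p : measurableTypeR R * E => p.2 + p.1 *: v).
Proof.
apply: measurable_rVP => i; under eq_fun do rewrite !mxE.
apply: measurable_funD.
  exact: (measurableT_comp (measurable_rV_coord i) measurable_snd).
by apply: measurable_funM => //; exact: measurable_fst.
Qed.

(* The exceptional set [A] is null on every line directed by [v], so that
   Tonelli applied to [1_[0,1](t) 1_A(x + t v)] and translation invariance give
   [mu A = 0]. *)
Lemma lip_ae_derivable (K : R) (f : E -> R) v : lip K f ->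
  {ae mu, forall x, derivable f x v}.
Proof.
move=> fK; have cf := lip_continuous fK.
pose A := ~` [set x | derivable f x v].
have mA : measurable A by apply: measurableC; exact: measurable_derivable.
exists A; split => //.
pose F (p : measurableTypeR R * E) : \bar R :=
  ((\1_(`[0, 1]%classic : set R) p.1)%:E * (\1_A (p.2 + p.1 *: v))%:E)%E.
have mF : measurable_fun setT F.
  apply: emeasurable_funM; apply/measurable_EFinP.
    by apply: (@measurableT_comp _ _ _ _ _ _ (\1_(`[0, 1]%classic : set R) : R -> R)).
  apply: (@measurableT_comp _ _ _ _ _ _ (\1_A : E -> R)) => //.
  exact: measurable_line.
have F0 p : (0 <= F p)%E by rewrite mule_ge0.
have /= h := @fubini_tonelli _ _ _ _ _ la mu _ mF F0.
have h1 : (\int[la]_t \int[mu]_x F (t, x) = mu A)%E.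
  transitivity (\int[la]_t (mu A * (\1_(`[0, 1]%classic : set R) t)%:E))%E.
    apply: eq_integral => t _; rewrite /F /=.
    rewrite -[in RHS](mpres_addv (t *: v)).2// muleC.
    have c0 : (0 <= (\1_(`[0, 1]%classic : set R) t)%:E :> \bar R)%E by rewrite lee_fin.
    have mAt : measurable ((fun x => x + t *: v) @^-1` A).
      exact: measurable_preimageT (measurable_addv _) mA.
    by rewrite -(indic_prod_int mAt c0).
  rewrite ge0_integralZl//; last exact/measurable_EFinP/measurable_indic.
  rewrite integral_indic// setIT.
  have l1 : (la `[0%R, 1%R]%classic = 1)%E.
    by rewrite lebesgue_measure_itv/= lte_fin ltr01 oppr0 adde0.
  by rewrite -[RHS]mule1 -l1.
rewrite -h1 h; apply: integral0_eq => x _.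
have [N [mN N0 sN]] := lip1_ae_derivable (lip_line x v fK).
apply/eqP; rewrite eq_le; apply/andP; split; last exact: integral_ge0.
have -> : (0 = \int[la]_t (\1_N t)%:E)%E by rewrite integral_indic// setIT; exact/esym.
apply: (@ge0_le_integral _ _ _ la _ measurableT).
- by move=> t _; exact: F0.
- by apply: (measurableT_comp mF); exact: measurable_pair2.
- exact/measurable_EFinP/measurable_indic.
move=> t _; rewrite /F /= -EFinM lee_fin !indicE.
have [xA|_] := boolP (x + t *: v \in A); last by rewrite mulr0.
have -> : t \in N.
  rewrite inE; apply: sN => /= d; move: xA; rewrite inE; apply.
  exact/derivable_line.
by rewrite mulr1 lern1 leq_b1.
Qed.

End directional.

Section bounded_integrals.
Context {R : realType} d (T : measurableType d) (m : {measure set T -> \bar R}).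

Lemma integrable_bounded (D : set T) (f : T -> R) (M : R) : measurable D ->
  (m D < +oo)%E -> measurable_fun D f -> (forall x, D x -> `|f x| <= M) ->
  m.-integrable D (EFin \o f).
Proof.
move=> mD Doo mf fM; apply: measurable_bounded_integrable => //.
exists M; split; rewrite ?num_real// => x Mx y Dy.
by rewrite /= (le_trans (fM y Dy))// ltW.
Qed.

Lemma Rintegral_bounded_cvg (D : set T) (f_ : nat -> T -> R) (f : T -> R) (M : R) :
  measurable D -> (m D < +oo)%E -> (forall k, measurable_fun D (f_ k)) ->
  measurable_fun D f -> (forall k x, D x -> `|f_ k x| <= M) ->
  {ae m, forall x, D x -> f_ k x @[k --> \oo] --> f x} ->
  \int[m]_(x in D) f_ k x @[k --> \oo] --> \int[m]_(x in D) f x.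
Proof.
move=> mD Doo mf_ mf fM cvgf.
have [|||||] := @dominated_convergence _ _ _ m D mD
  (fun k x => (f_ k x)%:E) (EFin \o f) (fun=> M%:E).
- by move=> k; exact/measurable_EFinP.
- exact/measurable_EFinP.
- by apply: filterS cvgf => x h Dx; apply: cvg_EFin; [exact: nearW|exact: h].
- apply: (@integrable_bounded _ (fun=> M) `|M|) => //.
- by apply: aeW => x k Dx; rewrite lee_fin; exact: fM.
move=> fint _ h; apply: fine_cvg; rewrite fineK//; exact: integrable_fin_num.
Qed.

(** Turns a density into a measure, so that in [box_integral_ae_eq] equal integrals over boxes
    become an equality of measures. *)
Lemma fin_num_density (f : T -> \bar R) : measurable_fun setT f ->
  (forall x, 0 <= f x)%E -> exists nu : {measure set T -> \bar R},
    forall A, nu A = (\int[m]_(x in A) f x)%E.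
Proof.
move=> mf f0; pose nu (A : set T) : \bar R := (\int[m]_(x in A) f x)%E.
have nu0 : nu set0 = 0%E by rewrite /nu integral_set0.
have nuge0 A : (0 <= nu A)%E by exact: integral_ge0.
have nusa : semi_sigma_additive nu.
  move=> F mF tF mUF; rewrite /nu ge0_integral_bigcup//.
    apply: is_cvg_ereal_nneg_natsum_cond => k _ _; exact: integral_ge0.
  exact: measurable_funS mf.
pose nuM : {measure set T -> \bar R} :=
  HB.pack_for {measure set T -> \bar R} nu (isMeasure.Build _ _ _ nu nu0 nuge0 nusa).
by exists nuM.
Qed.

End bounded_integrals.

(** * Linearity of directional derivatives and the size of the gradient *)

Section gradient_bound.
Context {R : realType} {n : nat}.
Local Notation E := 'rV[R]_n.
Local Notation mu := (@lebesgue_rV R n).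

(** Adding [M] makes both functions nonnegative densities. Their measures agree on boxes, hence on
    Borel sets, and so the densities agree almost everywhere on each box []-k, k[^n]. *)
Lemma box_integral_ae_eq (g1 g2 : E -> R) (M : R) :
  measurable_fun setT g1 -> measurable_fun setT g2 ->
  (forall x, `|g1 x| <= M) -> (forall x, `|g2 x| <= M) ->
  (forall a b, \int[mu]_(x in obox a b) g1 x = \int[mu]_(x in obox a b) g2 x) ->
  {ae mu, forall x, g1 x = g2 x}.
Proof.
move=> mg1 mg2 b1 b2 g12.
have dens (g : E -> R) : measurable_fun setT g -> (forall x, `|g x| <= M) ->
    exists nu : {measure set E -> \bar R}, forall A,
      nu A = (\int[mu]_(x in A) (M + g x)%:E)%E.
  move=> mg bg; apply: fin_num_density.
    exact/measurable_EFinP/measurable_funD.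
  by move=> x; rewrite lee_fin; have := bg x; rewrite ler_norml => /andP[? _]; lra.
have [nu1 nu1E] := dens g1 mg1 b1; have [nu2 nu2E] := dens g2 mg2 b2.
have ibox (g : E -> R) a b : measurable_fun setT g -> (forall x, `|g x| <= M) ->
    mu.-integrable (obox a b) (EFin \o g).
  move=> mg bg; apply: (@integrable_bounded _ _ _ _ _ _ M) => //.
  - exact: measurable_obox.
  - exact: lebesgue_rV_obox_fin.
  - exact: measurable_funS mg.
have M0 : 0 <= M by exact: le_trans (b1 0).
have iM a b : mu.-integrable (obox a b) (EFin \o (fun=> M)).
  by apply: ibox => // x; rewrite ger0_norm.
have iMg (g : E -> R) a b : measurable_fun setT g -> (forall x, `|g x| <= M) ->
    mu.-integrable (obox a b) (EFin \o (fun x => M + g x)).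
  move=> mg bg; apply: (@integrable_bounded _ _ _ _ _ _ (M + M)) => //.
  - exact: measurable_obox.
  - exact: lebesgue_rV_obox_fin.
  - by apply: measurable_funD => //; exact: measurable_funS mg.
  - by move=> x _; rewrite (le_trans (ler_normD _ _))// lerD// ger0_norm.
have nubox (g : E -> R) a b : measurable_fun setT g -> (forall x, `|g x| <= M) ->
    (\int[mu]_(x in obox a b) (M + g x)%:E =
     (\int[mu]_(x in obox a b) M + \int[mu]_(x in obox a b) g x)%:E)%E.
  move=> mg bg; rewrite -RintegralD//; [|exact: measurable_obox|exact: ibox].
  rewrite /Rintegral fineK//; apply: integrable_fin_num; first exact: measurable_obox.
  exact: iMg.
have nu12 A : measurable A -> nu1 A = nu2 A.
  apply: rV_measure_unique => a b.
    by rewrite nu1E nu2E !nubox// g12.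
  by rewrite nu1E nubox// ltry.
have cover (k : nat) : {ae mu, forall x, obox (\row__ - k%:R) (\row__ k%:R) x -> g1 x = g2 x}.
  set B := obox _ _; have mB : measurable B by exact: measurable_obox.
  have := @integral_ae_eq _ _ _ mu B mB _ _ (iMg _ _ _ mg1 b1) (measurable_int _ (iMg _ _ _ mg2 b2)).
  have h : forall A, A `<=` B -> measurable A ->
     (\int[mu]_(x in A) (EFin \o (fun x => M + g1 x)%R) x =
      \int[mu]_(x in A) (EFin \o (fun x => M + g2 x)%R) x)%E.
    by move=> A _ mA; rewrite -nu1E -nu2E nu12.
  move=> /(_ h); apply: filterS => x /= hx Bx.
  by have [/addrI] := hx Bx.
have := ae_foralln cover; apply: filterS => x /(_ (Num.truncn `|x|).+1); apply.
move=> i; rewrite /= !mxE in_itv/= -ltr_norml.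
by rewrite (le_lt_trans (coord_le_norm _ _))// truncnS_gt.
Qed.

Lemma ae_coord_neq (c : R) i : {ae mu, forall x : E, x ord0 i != c}.
Proof.
have mH : measurable [set x : E | x ord0 i = c].
  rewrite (_ : [set x : E | _] = (fun x : E => x ord0 i) @^-1` [set c])//.
  by apply: measurable_preimageT => //; exact: measurable_rV_coord.
exists [set x : E | x ord0 i = c]; split => //; last first.
  by move=> x /= /negP; rewrite negbK => /eqP.
have h := @lebesgue_rV_box R n (fun j => if j == i then [set c] else setT)
  (fun j => if j == i as b return measurable (if b then [set c] else setT)
            then measurable_set1 c else measurableT).
rewrite (_ : [set x : E | _] = [set x : E | forall j, (if j == i then [set c] else setT) (x ord0 j)]).
  rewrite h (bigD1 i)//= eqxx lebesgue_measure_set1 mul0e//.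
apply/seteqP; split=> x /=; last by move=> /(_ i); rewrite eqxx.
by move=> xc j; case: eqP => // ->.
Qed.

(** Away from the hyperplanes carrying the faces of a box, a small translation does not change
    membership. By [ae_coord_neq] this covers almost every point, so the indicators of the
    translated boxes converge almost everywhere. *)
Lemma obox_shift_cvg (a b v x : E) : (forall i, x ord0 i != a ord0 i) ->
  (forall i, x ord0 i != b ord0 i) ->
  \forall k \near \oo, obox a b (x - k.+1%:R^-1 *: v) <-> obox a b x.
Proof.
move=> xa xb.
have cv i : x ord0 i - k.+1%:R^-1 * v ord0 i @[k --> \oo] --> x ord0 i.
  rewrite -[X in _ --> X]subr0 -[X in _ - X](mul0r (v ord0 i)).
  apply: cvgB; first exact: cvg_cst.
  by apply: cvgMr_tmp; exact: cvg_harmonic.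
have : \forall k \near \oo, forall i,
    (x ord0 i - k.+1%:R^-1 * v ord0 i \in `]a ord0 i, b ord0 i[) =
    (x ord0 i \in `]a ord0 i, b ord0 i[).
  apply: filter_forall => i.
  have nearE (c : R) : x ord0 i != c -> \forall k \near \oo,
      ((c < x ord0 i - k.+1%:R^-1 * v ord0 i) = (c < x ord0 i)) /\
      ((x ord0 i - k.+1%:R^-1 * v ord0 i < c) = (x ord0 i < c)).
    have [cx _|cx _|//] := ltgtP c (x ord0 i).
      apply: filterS (cvgr_gt _ (cv i) _ cx) => k h.
      by rewrite h; split=> //; apply/negbTE; rewrite -leNgt ltW.
    apply: filterS (cvgr_lt _ (cv i) _ cx) => k h.
    by rewrite h; split=> //; apply/negbTE; rewrite -leNgt ltW.
  move: (nearE _ (xa i)) (nearE _ (xb i)); apply: filterS2 => k [ha _] [_ hb].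
  by rewrite !in_itv/= ha hb.
apply: filterS => k h; split=> hx i; have := hx i; rewrite /= !mxE ?h//.
Qed.


(** The quotient of [f] along [v + w] at [x] is the quotient along [v] at [x] plus the quotient
    along [w] at [x + t v]. Integrated over a box, the shift passes to the box and disappears in the
    limit; equality of all box integrals then gives equality almost everywhere. *)
Lemma derive_add_ae (K : R) (f : E -> R) v w : lip K f ->
  {ae mu, forall x, 'D_(v + w) f x = 'D_v f x + 'D_w f x}.
Proof.
move=> fK; have cf := lip_continuous fK.
have bD u x : `|'D_u f x| <= `|K| * enorm u by exact: derive_le.
have mD u : measurable_fun setT (fun x => 'D_u f x) by exact: measurable_derive.
have mq u t : measurable_fun setT (dquo f u t).
  by apply: continuous_measurable_rV; exact: dquo_continuous_x.
have Kv u : 0 <= `|K| * enorm u by rewrite mulr_ge0// enorm_ge0.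
apply: (@box_integral_ae_eq _ _ (`|K| * enorm (v + w) + (`|K| * enorm v + `|K| * enorm w))).
- exact: mD.
- by apply: measurable_funD; exact: mD.
- by move=> x; rewrite (le_trans (bD _ _))// lerDl addr_ge0.
- move=> x; rewrite (le_trans (ler_normD _ _))// (le_trans (lerD (bD _ _) (bD _ _)))//.
  by rewrite lerDr.
move=> a b; set B := obox a b; have mB : measurable B by exact: measurable_obox.
have Boo : (mu B < +oo)%E by exact: lebesgue_rV_obox_fin.
pose t k : R := k.+1%:R^-1.
have iB u (g : E -> R) : measurable_fun setT g -> (forall x, `|g x| <= `|K| * enorm u) ->
    mu.-integrable B (EFin \o g).
  by move=> mg bg; apply: (@integrable_bounded _ _ _ _ _ _ (`|K| * enorm u)) => //;
    exact: measurable_funS mg.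
have cvq u : \int[mu]_(x in B) dquo f u (t k) x @[k --> \oo] --> \int[mu]_(x in B) 'D_u f x.
  apply: (@Rintegral_bounded_cvg _ _ _ _ _ _ _ (`|K| * enorm u)) => //.
  - by move=> k; exact: measurable_funS (mq _ _).
  - exact: measurable_funS (mD _).
  - by move=> k x _; exact: dquo_le.
  - by apply: filterS (lip_ae_derivable u fK) => x d _; exact: dquo_cvg_seq.
(* [I_ k] is the same quotient integrated over the translate of [B]. *)
have cvw : \int[mu]_(x in B) dquo f w (t k) (x + t k *: v) @[k --> \oo] -->
    \int[mu]_(x in B) 'D_w f x.
  pose D k : set E := (fun x => x + - (t k *: v)) @^-1` B.
  have mDk k : measurable (D k) by exact: measurable_preimageT (measurable_addv _) mB.
  (* One box containing all translates, since the steps are at most 1; it is the fixed domain for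
     dominated convergence. *)
  pose B' := obox (a - \row__ `|v|) (b + \row__ `|v|).
  have mB' : measurable B' by exact: measurable_obox.
  have B'oo : (mu B' < +oo)%E by exact: lebesgue_rV_obox_fin.
  have t01 k : 0 <= t k <= 1.
    by rewrite invr_ge0 ler0n/= invf_le1// ler1n.
  have tv k i : `|t k * v ord0 i| <= `|v|.
    have /andP[t0 t1] := t01 k; rewrite normrM (ger0_norm t0).
    by rewrite (le_trans (ler_wpM2r _ t1))// mul1r coord_le_norm.
  have sub1 k : D k `<=` B'.
    move=> x xD i; have := xD i; have := tv k i; rewrite /= !mxE !in_itv/= ler_norml.
    by move=> /andP[? ?] /andP[? ?]; apply/andP; split; lra.
  have sub0 : B `<=` B'.
    move=> x xD i; have := xD i; rewrite /= !mxE !in_itv/=.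
    by have := normr_ge0 v => ? /andP[? ?]; apply/andP; split; lra.
  have -> : (fun k => \int[mu]_(x in B) dquo f w (t k) (x + t k *: v)) =
            (fun k => \int[mu]_(x in B') (dquo f w (t k) \_ (D k)) x).
    apply/funext => k; rewrite -Rintegral_mkcondr setIidr//.
    rewrite -(Rintegral_mpres (mpres_addv (t k *: v)) (mDk k)); last first.
      exact: measurable_funS (mq _ _).
    congr (Rintegral _ _ _); rewrite /D; apply/seteqP.
    by split=> x /=; rewrite addrK.
  have -> : \int[mu]_(x in B) 'D_w f x = \int[mu]_(x in B') ((fun x => 'D_w f x) \_ B) x.
    by rewrite -Rintegral_mkcondr setIidr.
  apply: (@Rintegral_bounded_cvg _ _ _ _ _ _ _ (`|K| * enorm w)) => //.
  - move=> k; apply: measurable_funS (subsetT _) _ => //.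
    by apply/(measurable_restrictT _ _).1 => //; exact: measurable_funS (mq _ _).
  - apply: measurable_funS (subsetT _) _ => //.
    by apply/(measurable_restrictT _ _).1 => //; exact: measurable_funS (mD _).
  - move=> k x _; rewrite patchE; case: ifP => _; first exact: dquo_le.
    by rewrite normr0.
  have aea : {ae mu, forall x : E, forall i, x ord0 i != a ord0 i}.
    by apply: filter_forall => i; exact: ae_coord_neq.
  have aeb : {ae mu, forall x : E, forall i, x ord0 i != b ord0 i}.
    by apply: filter_forall => i; exact: ae_coord_neq.
  move: (lip_ae_derivable w fK); apply: filterS3 aea aeb => x xa xb d _.
  have hB := obox_shift_cvg v xa xb.
  rewrite patchE; case: ifPn => xB.
    apply: cvg_trans (dquo_cvg_seq d); apply: near_eq_cvg.
    apply: filterS hB => k hk; rewrite patchE ifT// inE /D /=.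
    by apply/hk; rewrite inE in xB.
  apply: cvg_near_cst; apply: filterS hB => k hk; rewrite patchE ifF//; apply/negbTE.
  by apply: contra xB; rewrite !inE => /hk.
rewrite RintegralD//; [|exact: iB (mD _) (bD _)|exact: iB (mD _) (bD _)].
apply: (cvg_unique _ (cvq (v + w))) => //.
have hs := cvgD (cvq v) cvw.
apply: cvg_trans (hs _); apply: near_eq_cvg; apply: nearW => k.
change (\int[mu]_(x in B) dquo f v (t k) x +
  \int[mu]_(x in B) dquo f w (t k) (x + t k *: v) =
  \int[mu]_(x in B) dquo f (v + w) (t k) x).
rewrite -RintegralD//.
- apply: eq_Rintegral => x _; rewrite /dquo -mulrDr; congr (_ * _).
  by rewrite scalerDr [in RHS]addrA [LHS]addrC [LHS]addrA subrK.
- by apply: (@iB n v) => // x; exact: dquo_le.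
- apply: (@iB n w) => [|x]; last exact: dquo_le.
  exact: (measurableT_comp (mq w (t k)) (measurable_addv _)).
Qed.

Lemma derive_scale (f : E -> R) (c : R) v x : derivable f x v ->
  derivable f x (c *: v) /\ 'D_(c *: v) f x = c * 'D_v f x.
Proof.
move=> d; have d' := derive_cvg d.
suff h : dquo f (c *: v) t x @[t --> 0^'] --> c * 'D_v f x.
  split; first by apply/derivableE/cvg_ex; eexists; exact: h.
  by rewrite deriveE'; apply/cvg_lim.
have [->|c0] := eqVneq c 0.
  rewrite mul0r scale0r.
  have -> : (dquo f (0 : E))^~ x = cst 0.
    by apply/funext => t; rewrite /dquo scaler0 addr0 subrr mulr0.
  exact: cvg_cst.
have -> : (dquo f (c *: v))^~ x = (fun t => c * dquo f v (c * t) x).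
  apply/funext => t; rewrite /dquo scalerA mulrA invfM mulrA mulfV// mul1r.
  by rewrite [t * c]mulrC.
apply: cvgM; first exact: cvg_cst.
apply: (@cvg_comp _ _ _ (fun t : R => c * t) (fun t => dquo f v t x) _ (0^')); last exact: d'.
move=> A [e /= e0 hA]; exists (e / `|c|) => /=; first by rewrite divr_gt0 ?normr_gt0.
move=> r /=; rewrite sub0r normrN ltr_pdivlMr ?normr_gt0// => rc r0.
by apply: hA; rewrite /= ?mulf_neq0// sub0r normrN normrM mulrC.
Qed.

(** The null set depends on [v], so only countably many directions can be treated at once. *)
Lemma derive_linear_ae (K : R) (f : E -> R) (v : E) : lip K f ->
  {ae mu, forall x, 'D_v f x = dotv v (grad f x)}.
Proof.
move=> fK.
have h (s : seq 'I_n) : {ae mu, forall x,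
    'D_(\sum_(i <- s) v ord0 i *: basis_vec i) f x =
    \sum_(i <- s) v ord0 i * 'D_(basis_vec i) f x}.
  elim: s => [|i s IHs].
    apply: aeW => x; rewrite !big_nil.
    have := @derive_scale f 0 0 x; rewrite scale0r mul0r => h; apply: (h _).2.
    apply/derivableE; rewrite (_ : (dquo f (0 : E))^~ x = cst 0).
      exact: is_cvg_cst.
    by apply/funext => t; rewrite /dquo scaler0 addr0 subrr mulr0.
  move: IHs (lip_ae_derivable (basis_vec i) fK)
    (derive_add_ae (v ord0 i *: basis_vec i) (\sum_(j <- s) v ord0 j *: basis_vec j) fK).
  apply: filterS3 => x IHx d ax.
  by rewrite !big_cons ax IHx (derive_scale (v ord0 i) d).2.
have := h (index_enum 'I_n); apply: filterS => x.
rewrite -row_sum_delta => ->; rewrite /dotv; apply: eq_bigr => i _.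
by rewrite /grad mxE.
Qed.

Lemma rat_dense_rV (v : E) (e : R) : 0 < e ->
  exists q : 'rV[rat]_n, enorm (v - map_mx ratr q) < e.
Proof.
move=> e0; pose d := e / (Num.sqrt n%:R + 1).
have n1 : 0 < Num.sqrt n%:R + 1 :> R by rewrite ltr_wpDl// sqrtr_ge0.
have d0 : 0 < d by rewrite divr_gt0.
have hq i : exists q : rat, `|v ord0 i - ratr q| < d.
  have h : v ord0 i - d < v ord0 i + d by rewrite ltrBlDr -addrA ltrDl addr_gt0.
  by have [q] := rat_in_itvoo h; rewrite in_itv/= -ltr_distlC; exists q.
have [g hg] := choice hq; exists (\row_i g i).
rewrite (le_lt_trans (enorm_le_norm _))//.
have : `|v - map_mx ratr (\row_i g i)| < d.
  by apply: rV_norm_lt => // i; rewrite !mxE.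
rewrite /d ltr_pdivlMr//; apply: le_lt_trans.
by rewrite mulrC ler_wpM2l// lerDl.
Qed.

(* Rademacher's theorem is not needed: it suffices that for almost every [x] the
   linear form given by the partial derivatives is bounded by [K] along all
   rational directions. *)
Lemma grad_le_ae (K : R) (f : E -> R) : lip K f ->
  {ae mu, forall x, enorm (grad f x) <= `|K|}.
Proof.
move=> fK.
(* Rational vectors are enumerated by [unpickle], so that a countable union of null sets is
   discarded. *)
pose P (k : nat) (x : E) := forall q : 'rV[rat]_n, unpickle k = Some q ->
  `|dotv (map_mx ratr q) (grad f x)| <= `|K| * enorm (map_mx ratr q : E).
have aeP k : {ae mu, forall x, P k x}.
  rewrite /P; case: unpickle => [q|]; last by apply: aeW => x q.
  apply: filterS (derive_linear_ae (map_mx ratr q) fK) => x hx _ [<-].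
  by rewrite -hx; exact: derive_le.
apply: filterS (ae_foralln aeP) => x hx.
have hq (q : 'rV[rat]_n) :
    `|dotv (map_mx ratr q) (grad f x)| <= `|K| * enorm (map_mx ratr q : E).
  by apply: (hx (pickle q)); rewrite pickleK.
set g := grad f x in hq *.
(* A rational direction [p] close to [g] itself tests the linear form where it is largest. *)
have hg : enorm g ^+ 2 <= `|K| * enorm g.
  apply/ler_addgt0Pr => e e0.
  have c0 : 0 < enorm g + `|K| + 1 by rewrite ltr_wpDl// addr_ge0// enorm_ge0.
  have [q hqe] := rat_dense_rV g (divr_gt0 e0 c0).
  move: hqe; set p := map_mx ratr q => hqe.
  have h1 : enorm g ^+ 2 = dotv p g + dotv (g - p) g.
    by rewrite enorm_sqr dotvBl addrC subrK.
  have h2 : enorm p <= enorm g + enorm (g - p).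
    by rewrite -{1}[p](subrK g) addrC (enorm_distC g) enormD.
  have h3 : dotv (g - p) g <= enorm (g - p) * enorm g.
    by rewrite (le_trans (ler_norm _))// cauchy_schwarz.
  have h4 : dotv p g <= `|K| * enorm p by exact: le_trans (ler_norm _) (hq q).
  move: hqe; rewrite ltr_pdivlMr// => hqe.
  have := ler_wpM2l (normr_ge0 K) h2.
  have := enorm_ge0 (g - p); rewrite h1; nra.
have [->|g0] := eqVneq (enorm g) 0; first by [].
have gp : 0 < enorm g by rewrite lt_neqAle eq_sym g0 enorm_ge0.
by move: hg; rewrite expr2 ler_pM2r.
Qed.

End gradient_bound.

(** * Convolution and mollifiers *)

Section convolution.
Context {R : realType} {n : nat}.
Local Notation E := 'rV[R]_n.
Local Notation mu := (@lebesgue_rV R n).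
Implicit Types (k f : E -> R).

Definition vanish_outside (r : R) k := forall x, r < enorm x -> k x = 0.

Definition conv k f (x : E) : R := \int[mu]_(y in setT) (k (x - y) * f y).

Lemma open_enorm_gt (x : E) r : open [set y : E | r < enorm (y - x)].
Proof.
have c : continuous (fun y : E => enorm (y - x)).
  apply: (@lip_continuous _ _ 1) => y z.
  by rewrite (le_trans (enorm_lip _ _))// opprB addrA subrK.
rewrite (_ : [set _ | _] = (fun y : E => enorm (y - x)) @^-1` `]r, +oo[%classic).
  by apply: open_comp; [move=> ? _; exact: c|exact: interval_open].
by apply/seteqP; split=> y; rewrite /= in_itv/= andbT.
Qed.

Lemma vanish_partial r k i : vanish_outside r k -> vanish_outside r (partial i k).
Proof.
move=> k0 x rx; rewrite /partial.
have nx : \near x, k x = cst 0 x.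
  have := @open_enorm_gt 0 r; rewrite openE => /(_ x); rewrite /= subr0 => /(_ rx).
  by apply: filterS => y; rewrite /= subr0 => /k0.
by rewrite (near_eq_derive _ nx) derive_cst.
Qed.

Lemma vanish_partials r k s : vanish_outside r k -> vanish_outside r (partials s k).
Proof. by move=> k0; elim: s => //= i s IHs; exact: vanish_partial. Qed.

Lemma vanish_bounded r k : continuous k -> vanish_outside r k ->
  exists2 M, 0 <= M & forall x, `|k x| <= M.
Proof.
move=> ck k0; pose S := [set x : E | enorm x <= r].
have cS : compact S.
  apply: bounded_closed_compact.
    exists r; split; rewrite ?num_real// => x rx y /= yr.
    by rewrite (le_trans (norm_le_enorm _))// (le_trans yr)// ltW.
  rewrite (_ : S = ~` [set y : E | r < enorm (y - 0)]).
    by apply: open_closedC; exact: open_enorm_gt.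
  apply/seteqP; split=> y; rewrite /S /= subr0; first by rewrite leNgt => /negP.
  by move/negP; rewrite -leNgt.
have := @continuous_compact _ _ k S (continuous_subspaceT ck) cS.
move=> /compact_bounded [M [_ hM]].
exists (Num.max 0 (M + 1)) => [|x]; first by rewrite le_max lexx.
have [xr|xr] := leP (enorm x) r; last by rewrite k0// normr0 le_max lexx.
rewrite le_max; apply/orP; right; apply: (hM (M + 1)); first by rewrite ltrDl.
by exists x.
Qed.

Lemma line_le (M : R) k v x (t : R) :
  (forall y, derivable k y v) -> (forall y, `|'D_v k y| <= M) ->
  `|k (x + t *: v) - k x| <= M * `|t|.
Proof.
move=> dk kM; pose g (s : R) := k (x + s *: v).
have dg s : derivable g s 1 by exact/derivable_line.
have cg : continuous g.
  by move=> s; apply: differentiable_continuous; exact/derivable1_diffP.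
have gg (a b : R) : a < b -> `|g b - g a| <= M * (b - a).
  move=> ab; have [||c _ ->] := @MVT R g (fun s => 'D_1 g s) a b ab.
  - by move=> s _; apply: DeriveDef.
  - exact: continuous_subspaceT.
  rewrite normrM (gtr0_norm (_ : 0 < b - a)) ?subr_gt0//.
  by apply: ler_wpM2r; rewrite ?subr_ge0 ?(ltW ab)// -derive_line.
have -> : k x = g 0 by rewrite /g scale0r addr0.
rewrite -/(g t); have [t0|t0|t0] := ltgtP 0 t.
- by rewrite (le_trans (gg _ _ t0))// subr0 gtr0_norm.
- by rewrite distrC (le_trans (gg _ _ t0))// sub0r ltr0_norm.
- by rewrite -t0 subrr !normr0 mulr0.
Qed.

(** The path from [y] to [x] changes one coordinate at a time; each of the [n] steps costs at most
    [M * enorm (x - y)]. *)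
Lemma partials_bound_lip (M : R) f : 0 <= M ->
  (forall i x, derivable f x (basis_vec i)) ->
  (forall i x, `|partial i f x| <= M) -> lip (n%:R * M) f.
Proof.
move=> M0 df fM x y.
have h (s : seq 'I_n) (z : E) :
    `|f (z + \sum_(i <- s) (x - y) ord0 i *: basis_vec i) - f z| <=
    (size s)%:R * (M * enorm (x - y)).
  elim: s z => [|i s IHs] z; first by rewrite big_nil addr0 subrr normr0 mul0r.
  rewrite big_cons addrA.
  rewrite (le_trans (ler_distD (f (z + (x - y) ord0 i *: basis_vec i)) _ _))//.
  rewrite /= -natr1 mulrDl mul1r lerD//.
  rewrite (le_trans (line_le _ _ (df i) (fM i)))// ler_wpM2l//.
  exact: coord_le_enorm.
have := h (enum 'I_n) y.
rewrite (_ : \sum_(i <- enum 'I_n) _ = x - y); last first.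
  by rewrite big_enum [RHS]row_sum_delta; exact: eq_bigl.
rewrite (_ : y + (x - y) = x) ?(addrC y) ?subrK// => /le_trans; apply.
by rewrite size_enum_ord mulrA.
Qed.

Lemma Rintegral_support (D : set E) (h : E -> R) :
  (forall x, ~ D x -> h x = 0) -> \int[mu]_(x in setT) h x = \int[mu]_(x in D) h x.
Proof.
move=> h0; rewrite [RHS]Rintegral_mkcond; apply: eq_Rintegral => x _.
by rewrite patchE; case: ifPn => //; rewrite notin_setE => /h0.
Qed.

Lemma Rintegral_le_bound (D : set E) (h : E -> R) (C : R) : measurable D ->
  (mu D < +oo)%E -> measurable_fun D h -> (forall x, D x -> `|h x| <= C) ->
  `|\int[mu]_(x in D) h x| <= C * fine (mu D).
Proof.
move=> mD Doo mh hC.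
have ih : mu.-integrable D (EFin \o h) by exact: integrable_bounded hC.
rewrite (le_trans (le_normr_Rintegral mD ih))// -Rintegral_cst//.
apply: le_Rintegral => //.
- by apply: (@integrable_bounded _ _ _ _ _ _ C) => //;
    [exact: measurableT_comp|move=> x Dx; rewrite normr_id hC].
- by apply: (@integrable_bounded _ _ _ _ _ (fun=> C) `|C|).
Qed.

Definition around (x : E) (r : R) : set E := [set y | enorm (x - y) < r].

Lemma measurable_around x r : measurable (around x r).
Proof.
have h : measurable_fun setT (fun y : E => x - y).
  have mh : measurable_fun setT (fun y : E => (x, y)) by exact: measurable_pair1.
  exact: (measurableT_comp measurable_subp mh).
exact: (measurable_preimageT h (measurable_eball r)).
Qed.

Lemma lebesgue_around x r : mu (around x r) = mu (@eball R n r).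
Proof.
by apply: symmetric_ball_translate; [exact: measurable_eball|move=> y; rewrite /eball /= enormN].
Qed.

Lemma around_fin x r : (mu (around x r) < +oo)%E.
Proof. by rewrite lebesgue_around eball_fin. Qed.

Lemma measurable_shiftN k x : continuous k -> measurable_fun setT (fun y : E => k (x - y)).
Proof.
move=> ck; have mh : measurable_fun setT (fun y : E => (x, y)) by exact: measurable_pair1.
apply: (measurableT_comp (continuous_measurable_rV ck)).
exact: (measurableT_comp measurable_subp mh).
Qed.

(** The inequality is strict because [k] may be nonzero at norm [r], whereas [around] is an open
    ball. *)
Lemma conv_support r k f x r' : vanish_outside r k -> r < r' ->
  conv k f x = \int[mu]_(y in around x r') (k (x - y) * f y).
Proof.
move=> k0 rr; apply: Rintegral_support => y /negP; rewrite -leNgt => h.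
by rewrite k0 ?mul0r// (lt_le_trans rr).
Qed.

(** Both values are integrals over the union of the balls around [x] and [x'], whose measure is at
    most [c + c] wherever the two points are. *)
Lemma conv_lip (K r M : R) k f : 0 <= K -> lip K k -> vanish_outside r k ->
  0 <= M -> measurable_fun setT f -> (forall x, `|f x| <= M) ->
  exists2 L, 0 <= L & lip L (conv k f).
Proof.
move=> K0 kK k0 M0 mf fM.
pose c := fine (mu (@eball R n (r + 1))).
have c0 : 0 <= c by rewrite fine_ge0.
exists (K * M * (c + c)) => [|x x']; first by rewrite !mulr_ge0// addr_ge0.
have ck := lip_continuous kK.
pose D := around x (r + 1) `|` around x' (r + 1).
have mD : measurable D by apply: measurableU; exact: measurable_around.
have Doo : (mu D < +oo)%E.
  rewrite (le_lt_trans (measureU2 _ _ _))//; [exact: measurable_around..|].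
  by rewrite lte_add_pinfty// around_fin.
have Dc : fine (mu D) <= c + c.
  rewrite -lee_fin fineK ?ge0_fin_numE// EFinD /c fineK ?ge0_fin_numE ?eball_fin//.
  rewrite -[X in (_ <= X + _)%E](lebesgue_around x) -[X in (_ <= _ + X)%E](lebesgue_around x').
  by apply: measureU2; exact: measurable_around.
have rD z : conv k f z = \int[mu]_(y in setT) (k (z - y) * f y) by [].
have sup z : around z (r + 1) `<=` D -> conv k f z = \int[mu]_(y in D) (k (z - y) * f y).
  move=> zD; apply: Rintegral_support => y yD; rewrite k0 ?mul0r//.
  have : ~ around z (r + 1) y by move=> /zD.
  by move/negP; rewrite -leNgt; apply: lt_le_trans; rewrite ltrDl.
have [Mk Mk0 kM] := vanish_bounded ck k0.
have iD z : mu.-integrable D (EFin \o (fun y => k (z - y) * f y)).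
  apply: (@integrable_bounded _ _ _ _ _ _ (Mk * M)) => //.
    apply: measurable_funM; apply: measurable_funS (subsetT _) _ => //.
    exact: measurable_shiftN.
  by move=> y _; rewrite normrM ler_pM.
rewrite (sup x) ?(sup x')//; [|exact: subsetUr|exact: subsetUl].
rewrite -RintegralB//; have -> : K * M * (c + c) * enorm (x - x') =
  (K * M * enorm (x - x')) * (c + c) by rewrite mulrAC.
apply: le_trans (_ : K * M * enorm (x - x') * fine (mu D) <= _); last first.
  by rewrite ler_wpM2l// !mulr_ge0// enorm_ge0.
apply: Rintegral_le_bound => //.
  apply: measurable_funB; apply: measurable_funM; apply: measurable_funS (subsetT _) _ => //;
    exact: measurable_shiftN.
move=> y _; rewrite -mulrBl normrM mulrAC ler_pM// (le_trans (kK _ _))//.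
by rewrite opprB addrA subrK.
Qed.

Lemma conv_partial (r M Mk : R) k f i : continuous k -> vanish_outside r k ->
  continuous (partial i k) -> (forall x, derivable k x (basis_vec i)) ->
  measurable_fun setT f -> (forall x, `|f x| <= M) ->
  forall x, derivable (conv k f) x (basis_vec i) /\
    partial i (conv k f) x = conv (partial i k) f x.
Proof.
move=> ck k0 cpk dk mf fM x.
have M0 : 0 <= M by exact: le_trans (fM 0).
have pk0 : vanish_outside r (partial i k) by exact: vanish_partial.
have [Mp Mp0 pkM] := vanish_bounded cpk pk0.
have [Mk' Mk0 kM] := vanish_bounded ck k0.
set e := basis_vec i in dk *.
have e1 : enorm (e : E) = 1.
  rewrite /enorm (_ : dotv e e = 1) ?sqrtr1//.
  rewrite /dotv (bigD1 i)//= big1 ?addr0; last first.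
    by move=> j ji; rewrite /e /basis_vec mxE eqxx (negbTE ji) mulr0.
  by rewrite /e /basis_vec mxE !eqxx mulr1.
(* The kernels shifted by less than 1 all vanish outside this ball, so that differentiation takes
   place under an integral over a fixed domain. *)
pose B := around x (r + 2).
have mB : measurable B by exact: measurable_around.
have Boo : (mu B < +oo)%E by exact: around_fin.
pose h (s : R) (y : E) := f y * k (x + s *: e - y).
have hE s y : h s y = (f y *: (fun s : R => k ((x - y) + s *: e))) s.
  by rewrite /h addrAC.
have dline y s : derivable (fun s : R => k ((x - y) + s *: e)) s 1.
  exact/derivable_line.
have dh s y : derivable (h ^~ y) s 1.
  rewrite (_ : h ^~ y = f y \*: (fun s : R => k ((x - y) + s *: e))); last first.
    by apply/funext => t; rewrite hE.
  exact: derivableZ.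
have Dh s y : 'D_1 (h ^~ y) s = f y * partial i k (x + s *: e - y).
  rewrite (_ : h ^~ y = f y \*: (fun s : R => k ((x - y) + s *: e))); last first.
    by apply/funext => t; rewrite hE.
  by rewrite deriveZ// -derive_line [x - y + _]addrAC.
have ih s : mu.-integrable B (EFin \o h s).
  apply: (@integrable_bounded _ _ _ _ _ _ (M * Mk')) => //.
    apply: measurable_funM; apply: measurable_funS (subsetT _) _ => //.
    exact: measurable_shiftN.
  by move=> y _; rewrite normrM ler_pM.
have iG : mu.-integrable B (EFin \o (fun=> M * Mp)).
  by apply: (@integrable_bounded _ _ _ _ _ _ `|M * Mp|).
have G0 (y : E) : 0 <= M * Mp by rewrite mulr_ge0.
have hG s y : `]-1, 1[%classic s -> B y -> `|partial1of2 h s y| <= M * Mp.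
  by move=> _ _; rewrite partial1of2E Dh normrM ler_pM.
have I0 : (`]-1, 1[%classic : set R) 0 by rewrite /= in_itv/= ltrN10 ltr01.
have dF := @derivable_under_integral R _ _ mu h B mB 0 (-1) 1 I0
  (fun s _ => ih s) (fun s y _ _ => dh s y) (fun=> M * Mp) G0 iG hG.
have DF := @differentiation_under_integral R _ _ mu h B mB 0 (-1) 1 I0
  (fun s _ => ih s) (fun s y _ _ => dh s y) (fun=> M * Mp) G0 iG hG.
set F := fun s => \int[mu]_(y in B) h s y in dF DF.
have FE : {near 0, F =1 (fun s : R => conv k f (x + s *: e))}.
  near=> s; rewrite /F /conv; apply/esym.
  rewrite (@Rintegral_support B) => [|y yB].
    by apply: eq_Rintegral => y _; rewrite /h mulrC.
  rewrite k0 ?mul0r//; move: yB => /negP; rewrite -leNgt => yB.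
  have s1 : `|s| < 1.
    by near: s; have := @nbhs0_lt R R 1 ltr01.
  have : enorm (x - y) <= enorm (x + s *: e - y) + enorm (s *: e).
    by rewrite -{1}[x](addrK (s *: e)) addrAC (le_trans (enormD _ _))// enormN.
  rewrite enormZ e1 mulr1; move: (enorm (x - y)) (enorm (x + _ - y)) `|s| yB s1.
  by clear => a b c *; lra.
have dC : derivable (fun s : R => conv k f (x + s *: e)) 0 1.
  exact: near_eq_derivable FE dF.
have xE : x = x + (0 : R) *: e by rewrite scale0r addr0.
split; first by rewrite xE; exact/derivable_line.
rewrite /partial {1}xE derive_line -(near_eq_derive _ FE) -derive1E DF.
rewrite (conv_support _ _ pk0 (_ : r < r + 2)) ?ltrDl//.
apply: eq_Rintegral => y _; rewrite partial1of2E Dh scale0r addr0 mulrC.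
by [].
Unshelve. all: by end_near. Qed.

Lemma conv_partials (r M : R) k f s : smooth k -> vanish_outside r k ->
  measurable_fun setT f -> (forall x, `|f x| <= M) ->
  partials s (conv k f) = conv (partials s k) f.
Proof.
move=> sk k0 mf fM; elim: s => //= i s ->; apply/funext => x.
have [c d] := sk s; have [ci _] := sk (i :: s).
by have [] := conv_partial 0 c (vanish_partials s k0) ci (d i) mf fM x.
Qed.

Lemma smooth_kernel_lip (r : R) k s : smooth k -> vanish_outside r k ->
  exists2 K, 0 <= K & lip K (partials s k).
Proof.
move=> sk k0.
have h i : exists2 M, 0 <= M & forall x, `|partial i (partials s k) x| <= M.
  have [ci _] := sk (i :: s).
  exact: vanish_bounded ci (vanish_partials (i :: s) k0).
have [M hM] := choice (fun i => let: ex_intro2 M a b := h i in ex_intro _ M (conj a b)).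
exists (n%:R * \sum_i M i).
  by rewrite mulr_ge0// sumr_ge0// => i _; case: (hM i).
apply: partials_bound_lip => [||i x].
- by rewrite sumr_ge0// => i _; case: (hM i).
- by move=> i x; case: (sk s).
- rewrite (le_trans ((hM i).2 x))// (bigD1 i)//= lerDl sumr_ge0// => j _.
  by case: (hM j).
Qed.

Lemma conv_smooth (r M : R) k f : smooth k -> vanish_outside r k ->
  measurable_fun setT f -> (forall x, `|f x| <= M) -> smooth (conv k f).
Proof.
move=> sk k0 mf fM s; rewrite (conv_partials s sk k0 mf fM).
have M0 : 0 <= M by exact: le_trans (fM 0).
have [K K0 kK] := smooth_kernel_lip s sk k0.
have [L _ cL] := conv_lip K0 kK (vanish_partials s k0) M0 mf fM.
split; first exact: lip_continuous cL.
move=> i x; have [c d] := sk s; have [ci _] := sk (i :: s).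
by have [] := conv_partial 0 c (vanish_partials s k0) ci (d i) mf fM x.
Qed.

End convolution.

Section mollifiers.
Context {R : realType} {n : nat}.
Local Notation E := 'rV[R]_n.
Local Notation mu := (@lebesgue_rV R n).
Implicit Types (k f g : E -> R).

Definition mollifier (r : R) k := [/\ smooth k, vanish_outside r k,
  forall x, 0 <= k x & \int[mu]_(y in setT) k y = 1].

Lemma smooth_continuous k : smooth k -> continuous k.
Proof. by move=> sk; have [] := sk [::]. Qed.

Lemma Rintegral_reflect k x : continuous k ->
  \int[mu]_(y in setT) k (x - y) = \int[mu]_(y in setT) k y.
Proof.
move=> ck; transitivity (\int[mu]_(y in setT) k (x + y)).
  rewrite -(Rintegral_mpres (mpresN (R:=R) (n:=n)) measurableT (f := fun y => k (x - y))).
    by rewrite preimage_setT; apply: eq_Rintegral => y _; rewrite opprK.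
  exact: measurable_shiftN.
rewrite -[RHS](Rintegral_mpres (mpres_addv x) measurableT (continuous_measurable_rV ck)) preimage_setT.
by apply: eq_Rintegral => y _; rewrite addrC.
Qed.

Lemma integrable_support (D : set E) (h : E -> R) (C : R) : measurable D ->
  (mu D < +oo)%E -> measurable_fun setT h -> (forall x, `|h x| <= C) ->
  (forall x, ~ D x -> h x = 0) -> mu.-integrable setT (EFin \o h).
Proof.
move=> mD Doo mh hC h0.
have : mu.-integrable D (EFin \o h).
  by apply: (integrable_bounded mD Doo (measurable_funS measurableT (subsetT _) mh)) => x _; exact: hC.
rewrite integrable_mkcond//; congr (_ : Prop); congr (is_true (_.-integrable _ _)).
apply/funext => x; rewrite patchE; case: ifPn => //; rewrite notin_setE => /h0 /= ->.
by [].
Qed.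

Lemma integrable_conv r k f x (M : R) : continuous k -> vanish_outside r k ->
  measurable_fun setT f -> (forall x, `|f x| <= M) ->
  mu.-integrable setT (EFin \o (fun y => k (x - y) * f y)).
Proof.
move=> ck k0 mf fM; have [Mk Mk0 kM] := vanish_bounded ck k0.
apply: (@integrable_support (around x (r + 1)) _ (Mk * M)).
- exact: measurable_around.
- exact: around_fin.
- by apply: measurable_funM => //; exact: measurable_shiftN.
- by move=> y; rewrite normrM ler_pM.
- move=> y /negP; rewrite -leNgt => h; rewrite k0 ?mul0r//.
  by apply: lt_le_trans h; rewrite ltrDl.
Qed.

Lemma integrable_kernel r k x : continuous k -> vanish_outside r k ->
  mu.-integrable setT (EFin \o (fun y => k (x - y))).
Proof.
move=> ck k0; have := @integrable_conv r k (cst 1) x 1 ck k0.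
rewrite (_ : (fun y => k (x - y) * cst 1 y) = (fun y => k (x - y))); last first.
  by apply/funext => y; rewrite mulr1.
by apply => // y; rewrite normr1.
Qed.

Section fixed_mollifier.
Variables (r : R) (k : E -> R) (kr : mollifier r k).

Let ck : continuous k. Proof. by case: kr => /smooth_continuous. Qed.
Let k0 : vanish_outside r k. Proof. by case: kr. Qed.
Let kge0 x : 0 <= k x. Proof. by case: kr. Qed.
Let k1 x : \int[mu]_(y in setT) k (x - y) = 1.
Proof. by rewrite Rintegral_reflect//; case: kr. Qed.

Lemma conv_cst (c : R) x : conv k (cst c) x = c.
Proof.
rewrite /conv RintegralZr//; last exact: integrable_kernel k0.
by rewrite k1 mul1r.
Qed.

Lemma convD f g (M : R) x : measurable_fun setT f -> (forall x, `|f x| <= M) ->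
  measurable_fun setT g -> (forall x, `|g x| <= M) ->
  conv k (fun y => f y + g y) x = conv k f x + conv k g x.
Proof.
move=> mf fM mg gM; rewrite /conv -RintegralD//.
- by apply: eq_Rintegral => y _; rewrite mulrDr.
- exact: (integrable_conv x ck k0 mf fM).
- exact: (integrable_conv x ck k0 mg gM).
Qed.

Lemma conv_le f g (M : R) x : measurable_fun setT f -> (forall x, `|f x| <= M) ->
  measurable_fun setT g -> (forall x, `|g x| <= M) ->
  (forall y, enorm (x - y) <= r -> f y <= g y) -> conv k f x <= conv k g x.
Proof.
move=> mf fM mg gM fg; apply: le_Rintegral => //.
- exact: (integrable_conv x ck k0 mf fM).
- exact: (integrable_conv x ck k0 mg gM).
- move=> y _; have [xy|xy] := leP (enorm (x - y)) r; last by rewrite k0 ?mul0r.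
  by rewrite ler_wpM2l// fg.
Qed.

Lemma conv_bound f (M : R) x : measurable_fun setT f -> (forall x, `|f x| <= M) ->
  `|conv k f x| <= M.
Proof.
move=> mf fM; have M0 : 0 <= M by exact: le_trans (fM 0).
rewrite ler_norml -[X in - X](conv_cst M x) -[X in _ && (_ <= X)](conv_cst M x).
have mM : forall x : E, `|cst M x : R| <= M by move=> y; rewrite /= ger0_norm.
rewrite (@conv_le f (cst M) M)// ?andbT; last first.
  by move=> y _; rewrite (le_trans (ler_norm _)).
rewrite conv_cst -[- M](conv_cst (- M) x).
apply: (@conv_le _ _ M) => // y; first by rewrite /= normrN ger0_norm.
by move=> _; have := fM y; rewrite ler_norml => /andP[].
Qed.

(** Where the kernel lives, [f] stays between the constants [f x - K * |r|] and [f x + K * |r|], and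
    convolution is monotone and fixes constants. *)
Lemma conv_close (K M : R) f x : 0 <= K -> lip K f -> (forall x, `|f x| <= M) ->
  `|conv k f x - f x| <= K * `|r|.
Proof.
move=> K0 fK fM; have mf := continuous_measurable_rV (lip_continuous fK).
have M0 : 0 <= M by exact: le_trans (fM 0).
pose N := M + K * `|r|.
have KN (s : R) : `|s| <= K * `|r| -> forall y : E, `|f x + s| <= N.
  by move=> sK y; rewrite (le_trans (ler_normD _ _))// lerD.
have h (s : R) : `|s| <= K * `|r| -> conv k (cst (f x + s)) x = f x + s.
  by move=> _; rewrite conv_cst.
have fN y : `|f y| <= N by rewrite (le_trans (fM y))// lerDl mulr_ge0.
have close y : enorm (x - y) <= r -> `|f x - f y| <= K * `|r|.
  by move=> xy; rewrite (le_trans (fK _ _))// ler_wpM2l// (le_trans xy)// ler_norm.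
have Kr0 : 0 <= K * `|r| by rewrite mulr_ge0.
have s1 : `|- (K * `|r|)| <= K * `|r| by rewrite normrN ger0_norm.
have s2 : `|K * `|r| | <= K * `|r| by rewrite ger0_norm.
rewrite ler_distl; apply/andP; split.
  rewrite -(h _ s1); apply: (@conv_le _ _ N) => //; first exact: KN.
  by move=> y /close; rewrite ler_norml /= => /andP[? ?]; lra.
rewrite -(h _ s2); apply: (@conv_le _ _ N) => //; first exact: KN.
by move=> y /close; rewrite ler_norml /= => /andP[? ?]; lra.
Qed.

(* Jensen's inequality: [conv k (f - p)^2 >= 0] for [p = conv k f x]. *)
Lemma conv_sqr_le f (M : R) x : measurable_fun setT f -> (forall x, `|f x| <= M) ->
  conv k f x ^+ 2 <= conv k (fun y => f y ^+ 2) x.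
Proof.
move=> mf fM; set p := conv k f x; have M0 : 0 <= M by exact: le_trans (fM 0).
have mf2 : measurable_fun setT (fun y => f y ^+ 2) by exact: measurable_funX.
have f2M y : `|f y ^+ 2| <= M ^+ 2 by rewrite normrX ler_pXn2r// nnegrE.
have if1 := integrable_conv x ck k0 mf fM.
have if2 := integrable_conv x ck k0 mf2 f2M.
have ik := integrable_kernel x ck k0.
have : 0 <= \int[mu]_(y in setT) (k (x - y) * (f y - p) ^+ 2).
  by apply: Rintegral_ge0 => y _; rewrite mulr_ge0// sqr_ge0.
rewrite (_ : (fun y => _) = (fun y => (k (x - y) * f y ^+ 2 - (p *+ 2) * (k (x - y) * f y))
   + p ^+ 2 * k (x - y))); last by apply/funext => y; ring.
have i1 : mu.-integrable setT (EFin \o (fun y => (p *+ 2) * (k (x - y) * f y))).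
  exact: (integrableZl measurableT (p *+ 2) if1).
have i2 : mu.-integrable setT (EFin \o (fun y => p ^+ 2 * k (x - y))).
  exact: (integrableZl measurableT (p ^+ 2) ik).
rewrite RintegralD//; last exact: (integrableB measurableT if2 i1).
rewrite RintegralB// RintegralZl// RintegralZl// k1 mulr1.
by rewrite -/(conv k f x) -/p -/(conv k (fun y => f y ^+ 2) x); lra.
Qed.

(** Puts the derivative on [f] instead of the kernel: difference quotients commute with convolution,
    are bounded because [f] is Lipschitz, and converge almost everywhere. *)
Lemma conv_partial_lip (K M : R) f (G : E -> R) i : lip K f ->
  (forall x, `|f x| <= M) -> measurable_fun setT G -> (forall x, `|G x| <= M) ->
  {ae mu, forall y, dquo f (basis_vec i) t.+1%:R^-1 y @[t --> \oo] --> G y} ->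
  forall x, partial i (conv k f) x = conv k G x.
Proof.
move=> fK fM mG GM aeG x; have cf := lip_continuous fK.
have mf := continuous_measurable_rV cf.
have sk : smooth k by case: kr.
have [_ dk] := sk [::]; have [cki _] := sk [:: i].
have [dC _] := conv_partial 0 ck k0 cki (dk i) mf fM x.
have h1 := dquo_cvg_seq dC.
apply: (cvg_unique _ h1) => //.
(* Translation invariance moves the increment from the kernel to [f]. *)
have q t : dquo (conv k f) (basis_vec i) t x =
    \int[mu]_(y in setT) (k (x - y) * dquo f (basis_vec i) t y).
  rewrite /dquo /conv; set e := basis_vec i.
  have -> : \int[mu]_(y in setT) (k (x + t *: e - y) * f y) =
            \int[mu]_(y in setT) (k (x - y) * f (y + t *: e)).
    rewrite -(Rintegral_mpres (mpres_addv (t *: e)) measurableT (f := fun y => k (x + t *: e - y) * f y)).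
      rewrite preimage_setT; apply: eq_Rintegral => y _.
      by rewrite opprD addrA addrAC addrK.
    by apply: measurable_funM => //; exact: measurable_shiftN.
  rewrite -RintegralB//; first last.
  - exact: (integrable_conv x ck k0 mf fM).
  - apply: (integrable_conv x ck k0 _ (M := M)) => //.
    exact: (measurableT_comp mf (measurable_addv _)).
  rewrite -RintegralZl//.
    by apply: eq_Rintegral => y _; rewrite -mulrBr mulrCA.
  have := integrableB measurableT (integrable_conv x ck k0 (measurableT_comp mf (measurable_addv (t *: e))) (fun y => fM (y + t *: e))) (integrable_conv x ck k0 mf fM).
  by [].
pose D := around x (r + 1).
have restr (h : E -> R) : \int[mu]_(y in setT) (k (x - y) * h y) = \int[mu]_(y in D) (k (x - y) * h y).
  by apply: conv_support k0 _; rewrite ltrDl.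
have [Mk Mk0 kM] := vanish_bounded ck k0.
rewrite -[conv k G x]/(\int[mu]_(y in setT) (k (x - y) * G y)) restr /=.
under eq_fun do rewrite q restr.
apply: (@Rintegral_bounded_cvg _ _ _ _ _ _ _ (Mk * (`|K| * enorm (basis_vec i : E)))).
- exact: measurable_around.
- exact: around_fin.
- move=> t; apply: measurable_funS (subsetT _) _ => //.
  apply: measurable_funM; first exact: measurable_shiftN.
  by apply: continuous_measurable_rV; exact: dquo_continuous_x.
- apply: measurable_funS (subsetT _) _ => //.
  by apply: measurable_funM => //; exact: measurable_shiftN.
- by move=> t y _; rewrite normrM ler_pM//; exact: dquo_le.
- apply: filterS aeG => y hy _; apply: cvgM => //; exact: cvg_cst.
Qed.

(** Only values of [g] within [r] of [D] contribute, and each is spread with total weight at most 1,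
    the integral of [k]. *)
Lemma conv_Tonelli (D D' : set E) g (M : R) : measurable D -> measurable D' ->
  measurable_fun setT g -> (forall x, 0 <= g x <= M) ->
  (forall x y, D x -> enorm (x - y) <= r -> D' y) ->
  (\int[mu]_(x in D) (conv k g x)%:E <= \int[mu]_(y in D') (g y)%:E)%E.
Proof.
move=> mD mD' mg gM DD'.
have gN x : `|g x| <= M by have /andP[g0 ?] := gM x; rewrite ger0_norm.
have g0 x : 0 <= g x by have /andP[] := gM x.
pose F (p : E * E) : \bar R := ((\1_D p.1 * (k (p.1 - p.2) * (g p.2 * \1_D' p.2)))%:E)%E.
have mF : measurable_fun setT F.
  apply/measurable_EFinP; apply: measurable_funM.
    by apply: (@measurableT_comp _ _ _ _ _ _ (\1_D : E -> R)).
  apply: measurable_funM.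
    exact: (measurableT_comp (continuous_measurable_rV ck) measurable_subp).
  apply: measurable_funM; first exact: (measurableT_comp mg measurable_snd).
  by apply: (@measurableT_comp _ _ _ _ _ _ (\1_D' : E -> R)).
have F0 p : (0 <= F p)%E by rewrite lee_fin !mulr_ge0.
have := @fubini_tonelli _ _ _ _ _ mu mu _ mF F0.
have -> : (\int[mu]_x \int[mu]_y F (x, y) = \int[mu]_(x in D) (conv k g x)%:E)%E.
  rewrite [RHS]integral_mkcond; apply: eq_integral => x _.
  rewrite patchE /F /=; case: ifPn => xD; last first.
    by apply: integral0_eq => y _; rewrite indicE (negbTE xD) mul0r.
  rewrite /conv /Rintegral fineK; last first.
    by apply: integrable_fin_num => //; exact: (integrable_conv x ck k0 mg gN).
  apply: eq_integral => y _; congr EFin; rewrite indicE xD mul1r.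
  have [xy|xy] := leP (enorm (x - y)) r; last by rewrite k0 ?mul0r.
  by rewrite indicE mem_set ?mulr1//; apply: DD' xy; rewrite inE in xD.
move=> ->; rewrite [leRHS]integral_mkcond; apply: (@ge0_le_integral _ _ _ mu _ measurableT).
- by move=> y _; apply: integral_ge0.
- exact: measurable_fun_fubini_tonelli_G.
- apply/(measurable_restrictT _ _).1 => //; apply/measurable_EFinP.
  exact: measurable_funS mg.
move=> y _; rewrite patchE /F /=; case: ifPn => yD; last first.
  by rewrite integral0_eq// => x _; rewrite [\1_D' y]indicE (negbTE yD) !mulr0.
have kk : (\int[mu]_x (g y * k (x + - y))%:E = (g y)%:E)%E.
  under eq_integral do rewrite EFinM.
  rewrite ge0_integralZl//; first last.
  - by rewrite lee_fin.
  - by move=> x _; rewrite lee_fin.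
  - apply/measurable_EFinP.
    exact: (measurableT_comp (continuous_measurable_rV ck) (measurable_addv _)).
  have := @integral_mpres _ _ (fun x => x + - y) setT (EFin \o k) (mpres_addv _) measurableT.
  rewrite preimage_setT => -> //; last first.
    by apply/measurable_EFinP; exact: continuous_measurable_rV.
  have : fine (\int[mu]_x (EFin \o k) x) = 1 by case: kr.
  case: (integral _ _ _) => //= [s ->|/esym/eqP|/esym/eqP]; rewrite ?mule1//;
    by rewrite oner_eq0.
rewrite -[leRHS]kk; apply: (@ge0_le_integral _ _ _ mu _ measurableT).
- by move=> x _; rewrite lee_fin !mulr_ge0.
- exact: (measurableT_comp mF (measurable_pair2 y)).
- apply/measurable_EFinP; apply: measurable_funM => //.
  exact: (measurableT_comp (continuous_measurable_rV ck) (measurable_addv _)).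
- move=> x _; rewrite lee_fin indicE [\1_D' y]indicE yD mulr1 [g y * _]mulrC.
  by case: (_ \in _); rewrite ?mul1r// mul0r mulr_ge0.
Qed.

End fixed_mollifier.
End mollifiers.

(** * Sobolev functions and smooth competitors *)

Section mollifier_existence.
Context {R : realType} {n : nat}.
Local Notation E := 'rV[R]_n.
Local Notation mu := (@lebesgue_rV R n).

Lemma derive_dilate (f : E -> R) (c a : R) v x : derivable f (a *: x) v ->
  derivable (fun x => c * f (a *: x)) x v /\
  'D_v (fun x => c * f (a *: x)) x = c * (a * 'D_v f (a *: x)).
Proof.
move=> /(derive_scale a) [d D].
have h : dquo (fun x => c * f (a *: x)) v ^~ x = (fun t => c * dquo f (a *: v) t (a *: x)).
  apply/funext => t; rewrite /dquo -mulrBr mulrCA; congr (_ * (_ * (f _ - _))).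
  by rewrite scalerDr !scalerA mulrC.
have hc : dquo (fun x => c * f (a *: x)) v t x @[t --> 0^'] --> c * (a * 'D_v f (a *: x)).
  by rewrite h; apply: cvgM; [exact: cvg_cst|rewrite -D; exact: derive_cvg].
split; first by apply/derivableE/cvg_ex; eexists; exact: hc.
by rewrite deriveE'; apply/cvg_lim.
Qed.

Lemma partials_dilate (f : E -> R) (c a : R) s : smooth f ->
  partials s (fun x => c * f (a *: x)) =
  (fun x => c * a ^+ size s * partials s f (a *: x)).
Proof.
move=> sf; elim: s => [|i s IHs] /=; first by rewrite expr0 mulr1.
rewrite IHs; apply/funext => x; rewrite /partial.
have [_ d] := sf s.
by rewrite (derive_dilate _ (d i (a *: x))).2 exprSr !mulrA.
Qed.

Lemma smooth_dilate (f : E -> R) (c a : R) : smooth f ->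
  smooth (fun x => c * f (a *: x)).
Proof.
move=> sf s; rewrite partials_dilate//; have [cs ds] := sf s; split.
  move=> x; have FF := @nbhs_filter E x.
  apply: cvgM; first exact: cvg_cst.
  apply: (@cvg_comp _ _ _ (fun x : E => a *: x) (partials s f)); last exact: cs.
  by apply: cvgZl_tmp; exact: cvg_id.
by move=> i x; have [] := derive_dilate (c * a ^+ size s) (ds i (a *: x)).
Qed.

(** Dividing by the integral [c] of the dilated function replaces the scaling law of Lebesgue
    measure. Positivity of [c] comes from a ball on which the function exceeds half of a positive
    value. *)
Lemma mollifier_dilate (rho : E -> R) (e : R) : 0 < e ->
  test_function [set x | enorm x < 1] rho -> (forall x, 0 <= rho x <= 1) ->
  (\int[mu]_(x in [set: E]) (rho x)%:E = 1)%E ->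
  exists k : E -> R, mollifier e k.
Proof.
move=> e0 [srho cpt sub] rho01 rho1.
pose f (x : E) := 1 * rho (e^-1 *: x).
have sf : smooth f by exact: smooth_dilate.
have cf := smooth_continuous sf.
have f0 x : 0 <= f x by rewrite /f mul1r; have /andP[] := rho01 (e^-1 *: x).
have fv : vanish_outside e f.
  move=> x ex; rewrite /f mul1r; apply/eqP; apply: contraPT ex => rx.
  have : supp rho (e^-1 *: x) by apply: subset_closure.
  move/sub; rewrite /= enormZ gtr0_norm ?invr_gt0// ltr_pdivrMl// mulr1 => h.
  by apply/negP; rewrite -leNgt ltW.
have [M M0 fM] := vanish_bounded cf fv.
have mf := continuous_measurable_rV cf.
have fi : mu.-integrable setT (EFin \o f).
  apply: (@integrable_support _ _ (eball (e + 1)) _ M) => //.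
  - exact: measurable_eball.
  - exact: eball_fin.
  - move=> x /negP; rewrite -leNgt => h; apply: fv; apply: lt_le_trans h.
    by rewrite ltrDl.
pose c := \int[mu]_(x in setT) f x.
have c0 : 0 < c.
  have [x0 rx0] : exists x0, 0 < rho x0.
    apply: contrapT => /forallNP h; move: rho1; rewrite integral0_eq.
      by move=> /esym/eqP; rewrite onee_eq0.
    move=> x _; congr (_%:E); apply/eqP; rewrite eq_le.
    have /andP[-> _] := rho01 x; rewrite andbT leNgt; exact/negP/h.
  pose z := e *: x0.
  have fz : 0 < f z by rewrite /f mul1r scalerA mulVf ?gt_eqF// scale1r.
  have : \forall y \near z, f z / 2 < f y.
    have FF := @nbhs_filter E z.
    by apply: (cvgr_gt _ (cf z)); rewrite ltr_pdivrMr// ltr_pMr// ltr1n.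
  move=> /nbhs_ballP [d /= d0 hd].
  have d0' : 0 < d by [].
  have B0 := @lebesgue_ball_gt0 R n z d d0'.
  have mB : measurable (ball z d).
    by rewrite -obox_ball//; exact: measurable_obox.
  have Boo : (mu (ball z d) < +oo)%E.
    by rewrite -obox_ball// lebesgue_rV_obox_fin.
  rewrite -lte_fin /c /Rintegral fineK; last exact: integrable_fin_num.
  apply: (@lt_le_trans _ _ ((f z / 2)%:E * mu (ball z d))%E).
    by rewrite mule_gt0// lte_fin divr_gt0.
  rewrite -integral_cst//; apply: (@le_trans _ _ (\int[mu]_(x in ball z d) (f x)%:E)%E).
    apply: ge0_le_integral => //.
    - by move=> x _; rewrite lee_fin ltW// divr_gt0.
    - by apply/measurable_EFinP; exact: measurable_funS mf.
    - by move=> x /hd /ltW; rewrite lee_fin.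
  apply: ge0_subset_integral => //; first exact/measurable_EFinP.
  by move=> x _; rewrite lee_fin.
pose k (x : E) := c^-1 * rho (e^-1 *: x).
have kE : k = (fun x => c^-1 * f x) by apply/funext => x; rewrite /k /f mul1r.
exists k; split.
- exact: smooth_dilate.
- by move=> x ex; rewrite kE fv ?mulr0.
- by move=> x; rewrite kE mulr_ge0// invr_ge0 ltW.
- by rewrite kE RintegralZl// mulVf// gt_eqF.
Qed.

End mollifier_existence.

Section sobolev_smooth.
Context {R : realType} {n : nat}.
Local Notation E := 'rV[R]_n.
Local Notation mu := (@lebesgue_rV R n).
Implicit Types (f g phi : E -> R).

Definition C1b (M : R) f := [/\ continuous f,
  forall i x, derivable f x (basis_vec i), forall i, continuous (partial i f),
  forall x, `|f x| <= M & forall i x, `|partial i f x| <= M].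

Lemma basis_vec_enorm (i : 'I_n) : enorm (basis_vec i : E) = 1.
Proof.
rewrite /enorm (_ : dotv _ _ = 1) ?sqrtr1//.
rewrite /dotv (bigD1 i)//= big1 ?addr0; last first.
  by move=> j ji; rewrite /basis_vec mxE eqxx (negbTE ji) mulr0.
by rewrite /basis_vec mxE !eqxx mulr1.
Qed.

Lemma derivable_quo_le (M : R) f v t x : (forall y, derivable f y v) ->
  (forall y, `|'D_v f y| <= M) -> `|dquo f v t x| <= M.
Proof.
move=> df fM; rewrite /dquo normrM; have [->|t0] := eqVneq t 0.
  by rewrite invr0 normr0 mul0r (le_trans _ (fM 0)).
by rewrite normfV ler_pdivrMl ?normr_gt0// mulrC line_le.
Qed.

(** By translation invariance every difference quotient has integral 0, and dominated convergence on
    a fixed ball passes to the derivative. *)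
Lemma integral_partial_eq0 (r M : R) f i : continuous f -> vanish_outside r f ->
  (forall x, derivable f x (basis_vec i)) -> continuous (partial i f) ->
  (forall x, `|f x| <= M) -> (forall x, `|partial i f x| <= M) ->
  \int[mu]_(x in setT) partial i f x = 0.
Proof.
move=> cf fv df cpf fM pfM; have pv := vanish_partial i fv.
pose e : E := basis_vec i; pose D := @eball R n (r + 2).
have mD : measurable D by exact: measurable_eball.
have Doo : (mu D < +oo)%E by exact: eball_fin.
have mf := continuous_measurable_rV cf.
have i_f (v : E) : mu.-integrable setT (EFin \o (fun x => f (x + v))).
  apply: (@integrable_support _ _ (eball (r + 1 + enorm v)) _ M) => //.
  - exact: measurable_eball.
  - exact: eball_fin.
  - exact: (measurableT_comp mf (measurable_addv _)).
  - move=> x /negP; rewrite -leNgt => h; apply: fv.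
    have : enorm x <= enorm (x + v) + enorm v.
      by rewrite -{1}[x](addrK v) (le_trans (enormD _ _))// enormN.
    by move: h; move: (enorm x) (enorm v) (enorm (x + v)) => a b c; lra.
have q0 (k : nat) : \int[mu]_(x in D) dquo f e k.+1%:R^-1 x = 0.
  set t : R := k.+1%:R^-1.
  rewrite -Rintegral_support.
    rewrite /dquo RintegralZl//; last first.
      have := integrableB measurableT (i_f (t *: e)) (i_f 0).
      by rewrite (_ : (fun x => f (x + 0)) = f)//; apply/funext => x; rewrite addr0.
    rewrite RintegralB//; last first.
      by have := i_f 0; rewrite (_ : (fun x => f (x + 0)) = f)//; apply/funext => x; rewrite addr0.
    have := Rintegral_mpres (mpres_addv (t *: e)) measurableT mf.
    by rewrite preimage_setT => ->; rewrite subrr mulr0.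
  move=> x /negP; rewrite -leNgt => h.
  have t1 : `|t| <= 1 by rewrite ger0_norm ?invr_ge0 ?ler0n// invf_le1// ler1n.
  have h2 : enorm x <= enorm (x + t *: e) + 1.
    rewrite -{1}[x](addrK (t *: e)) (le_trans (enormD _ _))// enormN lerD2l.
    by rewrite enormZ basis_vec_enorm mulr1.
  rewrite /dquo !fv ?subrr ?mulr0//.
    by move: h; move: (enorm x) => a; lra.
  by move: h h2; move: (enorm x) (enorm (x + _)) => a b; lra.
have := @Rintegral_bounded_cvg R _ _ mu D (fun k => dquo f e k.+1%:R^-1) (partial i f) M mD Doo.
rewrite -Rintegral_support; last first.
  by move=> x /negP; rewrite -leNgt => h; apply: pv; apply: lt_le_trans h; rewrite ltrDl.
move=> h.
have c0 : (fun k : nat => \int[mu]_(x in D) dquo f e k.+1%:R^-1 x) @ \oo --> (0 : R).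
  by under eq_fun do rewrite q0; exact: cvg_cst.
apply: (cvg_unique _ (h _ _ _ _) c0) => //.
- move=> k; apply: measurable_funS (subsetT _) _ => //.
  by apply: continuous_measurable_rV; exact: dquo_continuous_x.
- by apply: measurable_funS (subsetT _) _ => //; exact: continuous_measurable_rV.
- by move=> k x _; exact: derivable_quo_le.
- by apply: aeW => x _; exact: dquo_cvg_seq.
Qed.

Lemma partialM f g i x : derivable f x (basis_vec i) -> derivable g x (basis_vec i) ->
  derivable (fun x => f x * g x) x (basis_vec i) /\
  partial i (fun x => f x * g x) x = f x * partial i g x + partial i f x * g x.
Proof.
move=> df dg; split; first exact: derivableM.
by rewrite /partial deriveM// [g x *: _]mulrC.
Qed.

Lemma test_vanish (D : set E) phi : test_function D phi ->
  exists r, vanish_outside r phi.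
Proof.
move=> [_ /compact_bounded [M [_ hM]] _].
exists (Num.sqrt n%:R * (M + 1)) => x Mx; apply/eqP; apply: contraPT Mx => px.
apply/negP; rewrite -leNgt (le_trans (enorm_le_norm _))// ler_wpM2l ?sqrtr_ge0//.
by apply: (hM (M + 1)); [rewrite ltrDl|exact: subset_closure].
Qed.

(** Integration by parts: [f * phi] vanishes outside a ball, so its partial derivative has integral
    0. Since [phi] and its derivatives vanish off [D], the integrals over [D] extend to the whole
    space. *)
Lemma C1b_H1 (D : set E) (M : R) f : measurable D -> (mu D < +oo)%E ->
  C1b M f -> H1 D f (grad f).
Proof.
move=> mD Doo [cf df cpf fM pfM].
have M0 : 0 <= M by exact: le_trans (fM 0).
have sq g : continuous g -> (forall x, `|g x| <= M) -> square_integrable D g.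
  move=> cg gM; have mg := continuous_measurable_rV cg.
  split; first exact: measurable_funS mg.
  apply: (@le_lt_trans _ _ (\int[mu]_(x in D) (cst (M ^+ 2)%:E x))%E).
    apply: ge0_le_integral => //.
    - by move=> x _; rewrite lee_fin sqr_ge0.
    - by apply/measurable_EFinP; apply: measurable_funS (measurable_funX 2 mg).
    - by move=> x _; rewrite lee_fin -real_normK ?num_real// ler_sqr ?nnegrE.
  rewrite integral_cst//; apply: lte_mul_pinfty => //.
  by rewrite lee_fin sqr_ge0.
split; first exact: sq.
  move=> i; have -> : (fun x => grad f x ord0 i) = partial i f.
    by apply/funext => x; rewrite /grad mxE.
  exact: sq.
move=> phi tphi i; have [r rphi] := test_vanish tphi.
have [sphi _ subD] := tphi; have [cphi dphi] := sphi [::].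
have [cpphi _] := sphi [:: i].
have [Mp Mp0 phiM] := vanish_bounded cphi rphi.
have pvphi := vanish_partial i rphi.
have [Mp' Mp'0 pphiM] := vanish_bounded cpphi pvphi.
have phi0 x : ~ D x -> phi x = 0.
  by move=> nD; apply: contra_notP nD => /eqP px; apply/subD/subset_closure.
have pphi0 x : ~ D x -> partial i phi x = 0.
  move=> nD; apply: contra_notP nD => /eqP px; apply: subD.
  rewrite /supp; move=> B nB; apply: contrapT => hB.
  move/eqP: px; apply; rewrite /partial (_ : 'D_(basis_vec i) phi x = 'D_(basis_vec i) (cst 0) x).
    by rewrite derive_cst.
  apply: near_eq_derive; apply: filterS nB => y By; apply/eqP; apply: contrapT => py.
  by apply: hB; exists y; split => //=; apply/negP.
have restrE g : (forall x, ~ D x -> g x = 0) ->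
    (\int[mu]_(x in D) (g x)%:E = \int[mu]_(x in setT) (g x)%:E)%E.
  move=> g0; rewrite [LHS]integral_mkcond; apply: eq_integral => x _.
  by rewrite patchE; case: ifPn => //; rewrite notin_setE => /g0 ->.
have int g h Mg Mh : continuous g -> continuous h -> vanish_outside r h ->
    (forall x, `|g x| <= Mg) -> (forall x, `|h x| <= Mh) ->
    mu.-integrable setT (EFin \o (fun x => g x * h x)).
  move=> cg ch hv gM hM; apply: (@integrable_support _ _ (eball (r + 1)) _ (Mg * Mh)).
  - exact: measurable_eball.
  - exact: eball_fin.
  - by apply: measurable_funM; exact: continuous_measurable_rV.
  - by move=> x; rewrite normrM ler_pM.
  - move=> x /negP; rewrite -leNgt => h'; rewrite hv ?mulr0//.
    by apply: lt_le_trans h'; rewrite ltrDl.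
rewrite !restrE; [|by move=> x /phi0 ->; rewrite mulr0|by move=> x /pphi0 ->; rewrite mulr0].
have i1 := int _ _ _ _ cf cpphi pvphi fM pphiM.
have i2 := int _ _ _ _ (cpf i) cphi rphi (pfM i) phiM.
have e1 : (\int[mu]_x (f x * partial i phi x)%:E = (\int[mu]_x (f x * partial i phi x))%:E)%E.
  by rewrite /Rintegral fineK//; exact: integrable_fin_num i1.
have e2 : (\int[mu]_x (grad f x ord0 i * phi x)%:E = (\int[mu]_x (partial i f x * phi x))%:E)%E.
  under eq_integral do rewrite /grad mxE.
  by rewrite /Rintegral fineK//; exact: integrable_fin_num i2.
rewrite e1 e2 -EFinN; congr (_%:E); apply/eqP; rewrite -subr_eq0 opprK; apply/eqP.
rewrite -RintegralD//.
have pE x : partial i (fun x => f x * phi x) x = f x * partial i phi x + partial i f x * phi x.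
  by have [] := partialM (df i x) (dphi i x).
have := @integral_partial_eq0 r (M * Mp + (M * Mp' + M * Mp)) (fun x => f x * phi x) i.
rewrite (_ : partial i (fun x => f x * phi x) = (fun x => f x * partial i phi x + partial i f x * phi x)); last first.
  exact/funext.
apply.
- by move=> x; have FF := @nbhs_filter E x; apply: cvgM; [exact: cf|exact: cphi].
- by move=> x /rphi ->; rewrite mulr0.
- by move=> x; have [] := partialM (df i x) (dphi i x).
- move=> x; have FF := @nbhs_filter E x; apply: cvgD; apply: cvgM.
  + exact: cf.
  + exact: cpphi.
  + exact: cpf.
  + exact: cphi.
- move=> x; rewrite normrM (@le_trans _ _ (M * Mp))// ?ler_pM//.
  by rewrite lerDl addr_ge0 ?mulr_ge0.
- move=> x; rewrite (le_trans (ler_normD _ _))// !normrM.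
  apply: (@le_trans _ _ (M * Mp' + M * Mp)).
    apply: lerD; apply: ler_pM => //; exact: pphiM.
  by rewrite lerDr mulr_ge0.
Qed.

End sobolev_smooth.

Section rotated_cube.
Context {R : realType} {n : nat}.
Local Notation E := 'rV[R]_n.
Local Notation mu := (@lebesgue_rV R n).
Variables (B : 'M[R]_n) (BBT : B *m B^T = 1%:M).

(* The sup norm of the coordinates in the orthonormal frame formed by the rows
   of B; its balls are the cubes with faces orthogonal to that frame. *)
Definition cnorm (x : E) : R := `|x *m B^T|.

Definition cube (T : R) : set E := [set x | cnorm x < T / 2].

Lemma trmx_orthogonal : B^T *m B^T^T = 1%:M.
Proof. by rewrite trmxK mulmx1C. Qed.

Lemma dotv_row (x : E) i : dotv x (row i B) = (x *m B^T) ord0 i.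
Proof. by rewrite mxE /dotv; apply: eq_bigr => j _; rewrite !mxE. Qed.

Lemma cnorm_le_enorm x : cnorm x <= enorm x.
Proof.
by rewrite -(enorm_orthogonal x trmx_orthogonal); exact: norm_le_enorm.
Qed.

Lemma enorm_le_cnorm x : enorm x <= Num.sqrt n%:R * cnorm x.
Proof.
by rewrite -(enorm_orthogonal x trmx_orthogonal); exact: enorm_le_norm.
Qed.

Lemma cnorm_lip : lip 1 cnorm.
Proof.
move=> x y; rewrite mul1r; apply: le_trans (cnorm_le_enorm (x - y)).
by rewrite /cnorm mulmxBl; exact: ler_dist_dist.
Qed.

Lemma cnorm_continuous : continuous cnorm.
Proof. exact: lip_continuous cnorm_lip. Qed.

Lemma measurable_cube T : measurable (cube T).
Proof.
apply: open_measurable_rV.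
rewrite (_ : cube T = cnorm @^-1` `]-oo, (T / 2)[%classic).
  by apply: open_comp; [move=> ? _; exact: cnorm_continuous|exact: interval_open].
by apply/seteqP; split=> y; rewrite /= in_itv.
Qed.

Lemma cube_fin T : (mu (cube T) < +oo)%E.
Proof.
apply: (@bounded_lebesgue_fin _ _ _ (Num.sqrt n%:R * (`|T| + 1) + 1)); first exact: measurable_cube.
move=> x xT; apply: (le_lt_trans (norm_le_enorm x)); apply: (le_lt_trans (enorm_le_cnorm x)).
rewrite (@le_lt_trans _ _ (Num.sqrt n%:R * (`|T| + 1)))// ?ltrDl//.
rewrite ler_wpM2l ?sqrtr_ge0//; move: xT; rewrite /cube/=.
by have := ler_norm T; have := normr_ge0 T; move: `|T| (cnorm x) => c d; lra.
Qed.

Lemma compact_cnorm_le r : compact [set x | cnorm x <= r].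
Proof.
apply: bounded_closed_compact.
  exists (Num.sqrt n%:R * r); split; first exact: num_real.
  move=> M rM x /= xr; apply: (le_trans (norm_le_enorm x)); apply: (le_trans (enorm_le_cnorm x)).
  by rewrite (le_trans _ (ltW rM))// ler_wpM2l ?sqrtr_ge0.
rewrite (_ : [set _ | _] = cnorm @^-1` `]-oo, r]%classic).
  by apply: preimage_closed; [move=> ? _; exact: cnorm_continuous|exact: interval_closed].
by apply/seteqP; split=> y; rewrite /= in_itv.
Qed.

End rotated_cube.

Lemma unit_cube_dilate {R : realType} {n : nat} (nu : 'rV[R]_n) (Q : set 'rV[R]_n) :
  unit_cube nu Q -> exists B : 'M[R]_n, [/\ B *m B^T = 1%:M,
    exists i, row i B = nu & forall T, 0 < T -> dilate T Q = cube B T].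
Proof.
move=> [B [BB [i Bi] ->]]; exists B; split => //; first by exists i.
move=> T T0; apply/seteqP; split=> [_ [x xQ <-]|x xT].
  rewrite /cube/= /cnorm -scalemxAl normrZ gtr0_norm// ltr_pM2l//.
  by apply: rV_norm_lt; [rewrite invr_gt0|move=> j; rewrite -dotv_row].
exists (T^-1 *: x); last by rewrite scalerA mulfV ?gt_eqF// scale1r.
move=> j; rewrite dotv_row -scalemxAl mxE normrM gtr0_norm ?invr_gt0// ltr_pdivrMl//.
exact: le_lt_trans (coord_le_norm _ j) xT.
Qed.

Section phase_transition.
Context {R : realType} {n : nat}.
Local Notation E := 'rV[R]_n.
Local Notation mu := (@lebesgue_rV R n).
Variables (rho : E -> R) (rho_test : test_function [set x | enorm x < 1] rho).
Hypotheses (rho_bnd : forall x, 0 <= rho x <= 1)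
  (rho_int : (\int[mu]_(x in [set: E]) (rho x)%:E = 1)%E).

Lemma test_function_mollifier : mollifier 1 rho.
Proof.
have [srho _ sub] := rho_test; have cr := smooth_continuous srho.
have v : vanish_outside 1 rho.
  move=> x x1; apply/eqP; apply: contraPT x1 => rx; apply/negP; rewrite -leNgt ltW//.
  by apply: sub; apply: subset_closure.
have i1 : \int[mu]_(x in setT) rho x = 1 by rewrite /Rintegral rho_int.
by split => // x; have /andP[] := rho_bnd x.
Qed.

Lemma measurable_phase nu : measurable_fun setT (phase nu : E -> R).
Proof.
apply: measurable_fun_ifT => //.
apply: measurable_fun_ler => //.
by apply: continuous_measurable_rV; exact: lip_continuous (dotv_lip nu).
Qed.

Lemma phase_le1 nu (x : E) : `|phase nu x| <= 1.
Proof. by rewrite /phase; case: ifP; rewrite ?normrN normr1. Qed.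

Lemma mollified_phaseE nu : mollified_phase rho nu = conv rho (phase nu).
Proof. by []. Qed.

Lemma mollified_phase_le1 nu x : `|mollified_phase rho nu x| <= 1.
Proof.
exact: (conv_bound test_function_mollifier _ (measurable_phase nu) (@phase_le1 nu)).
Qed.

Lemma mollified_phase_smooth nu : smooth (mollified_phase rho nu).
Proof.
have [s v _ _] := test_function_mollifier.
exact: (conv_smooth s v (measurable_phase nu) (@phase_le1 nu)).
Qed.

Lemma mollified_phase_lip nu s :
  exists2 L, 0 <= L & lip L (partials s (mollified_phase rho nu)).
Proof.
have [sk v _ _] := test_function_mollifier.
rewrite mollified_phaseE (conv_partials _ sk v (measurable_phase nu) (@phase_le1 nu)).
have [K K0 lK] := smooth_kernel_lip s sk v.
exact: (conv_lip K0 lK (vanish_partials s v) ler01 (measurable_phase nu) (@phase_le1 nu)).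
Qed.

(** The unit ball around [x] lies on one side of the hyperplane, where the phase is constant. *)
Lemma mollified_phase_far nu x : enorm nu = 1 -> 1 < `|dotv x nu| ->
  mollified_phase rho nu x = Num.sg (dotv x nu).
Proof.
move=> nu1 x1; rewrite mollified_phaseE.
have near y : enorm (x - y) <= 1 -> phase nu y = Num.sg (dotv x nu).
  move=> xy; have : `|dotv (x - y) nu| <= 1.
    by apply: (le_trans (cauchy_schwarz _ _)); rewrite nu1 mulr1.
  rewrite dotvBl /phase; move: x1.
  case: (sgrP (dotv x nu)) => [_|x0|x0].
  - by rewrite ltr10.
  - rewrite ?(gtr0_norm x0) => x1 /ler_normlP[] h1 h2; case: ifPn => // h3; exfalso; lra.
  - rewrite ?(ltr0_norm x0) => x1 /ler_normlP[] h1 h2; case: ifPn => //; rewrite -ltNge => h3; exfalso; lra.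
rewrite -[RHS](conv_cst test_function_mollifier _ x).
have cb y : `|cst (Num.sg (dotv x nu)) y : R| <= 1.
  by rewrite /= normr_sg; case: (_ == _); rewrite ?ler01.
apply/eqP; rewrite eq_le; apply/andP; split;
  apply: (conv_le test_function_mollifier (M := 1)) => //;
  try exact: measurable_phase; try exact: phase_le1; try by move=> y /near ->.
Qed.

End phase_transition.

(** * Smooth competitors obtained by mollifying the correction *)

Section competitor.
Context {R : realType} {n : nat}.
Local Notation E := 'rV[R]_n.
Local Notation mu := (@lebesgue_rV R n).

(** The range 3 is that of the competitor [w + phi], where [w] is bounded by 1 and [phi] by 2. The
    factors [s + t] and [s ^+ 2 + t ^+ 2 - 2] are at most 6 and 16. *)
Lemma W_lip (s t : R) : `|s| <= 3 -> `|t| <= 3 -> `|W s - W t| <= 96 * `|s - t|.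
Proof.
move=> s3 t3; have -> : W s - W t = ((s + t) * (s ^+ 2 + t ^+ 2 - 2)) * (s - t).
  by rewrite /W; ring.
rewrite normrM ler_wpM2r// normrM (_ : 96 = 6 * 16 :> R); last by rewrite -natrM.
apply: ler_pM => //; first by apply: (le_trans (ler_normD _ _)); lra.
move: s3 t3; rewrite !ler_norml => /andP[s1 s2] /andP[t1 t2].
have := sqr_ge0 s; have := sqr_ge0 t.
have : s ^+ 2 <= 9 by nra.
have : t ^+ 2 <= 9 by nra.
by move: (s ^+ 2) (t ^+ 2) => a b; lra.
Qed.

Lemma W_ge0 (s : R) : 0 <= W s.
Proof. exact: sqr_ge0. Qed.

Lemma integralD_EFin (D : set E) (f g : E -> R) : measurable D ->
  measurable_fun setT f -> measurable_fun setT g -> (forall x, 0 <= f x) ->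
  (forall x, 0 <= g x) ->
  (\int[mu]_(x in D) (f x + g x)%:E =
   \int[mu]_(x in D) (f x)%:E + \int[mu]_(x in D) (g x)%:E)%E.
Proof.
move=> mD mf mg f0 g0; under eq_integral do rewrite EFinD.
apply: ge0_integralD => //.
- by move=> x _; rewrite lee_fin.
- by apply/measurable_EFinP; exact: measurable_funS mf.
- by move=> x _; rewrite lee_fin.
- by apply/measurable_EFinP; exact: measurable_funS mg.
Qed.

Lemma energy_density_ge0 (c s t : R) : 0 <= c -> 0 <= c * W s + 2^-1 * t ^+ 2.
Proof.
move=> c0; apply: addr_ge0; first by apply: mulr_ge0 => //; exact: W_ge0.
by rewrite mulr_ge0 ?invr_ge0 ?sqr_ge0.
Qed.

Lemma measurable_energy_density (a V : E -> R) : measurable_fun setT a -> continuous V ->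
  measurable_fun setT (fun y => a y * W (V y) + 2^-1 * enorm (grad V y) ^+ 2).
Proof.
move=> ma cV; have mV := continuous_measurable_rV cV.
apply: measurable_funD.
  apply: measurable_funM => //; apply: measurable_funX.
  by apply: measurable_funB => //; exact: measurable_funX.
apply: measurable_funM => //.
under eq_fun do rewrite enorm_sqrE.
apply: measurable_sum => i; apply: measurable_funX.
under eq_fun do rewrite mxE.
exact: measurable_derive.
Qed.

Lemma H10_ext (D : set E) (u u' : E -> R) (g g' : E -> E) :
  u = u' -> g = g' -> H10 D u g -> H10 D u' g'.
Proof. by move=> -> ->. Qed.

Lemma C1bD (f g : E -> R) M M' : C1b M f -> C1b M' g ->
  C1b (M + M') (fun x => f x + g x).
Proof.
move=> [cf df cpf fM pfM] [cg dg cpg gM pgM].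
have pE i : partial i (fun x => f x + g x) = (fun x => partial i f x + partial i g x).
  by apply/funext => x; rewrite /partial deriveD.
split.
- by move=> x; have FF := @nbhs_filter E x; apply: cvgD; [exact: cf|exact: cg].
- by move=> i x; exact: derivableD.
- by move=> i; rewrite pE => x; have FF := @nbhs_filter E x; apply: cvgD; [exact: cpf|exact: cpg].
- by move=> x; rewrite (le_trans (ler_normD _ _))// lerD.
- by move=> i x; rewrite pE (le_trans (ler_normD _ _))// lerD.
Qed.

Lemma smooth_C1b (f : E -> R) (M L : R) : smooth f -> (forall x, `|f x| <= M) ->
  lip L f -> C1b (M + `|L|) f.
Proof.
move=> sf fM lf; have [cf df] := sf [::]; have M0 := le_trans (normr_ge0 _) (fM 0).
split => //.
- by move=> i; have [] := sf [:: i].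
- by move=> x; rewrite (le_trans (fM x))// lerDl.
- move=> i x; apply: (le_trans (derive_le _ _ lf)).
  by rewrite basis_vec_enorm mulr1 lerDr.
Qed.

Lemma lipB (K L : R) (f g : E -> R) : lip K f -> lip L g -> lip (K + L) (fun x => f x - g x).
Proof.
move=> lf lg x y; rewrite mulrDl.
rewrite [X in `|X|](_ : _ = (f x - f y) + (g y - g x)); last by ring.
by rewrite (le_trans (ler_normD _ _))// lerD// enorm_distC.
Qed.

Variables (rho : E -> R) (rho_test : test_function [set x | enorm x < 1] rho).
Hypotheses (rho_bnd : forall x, 0 <= rho x <= 1)
  (rho_int : (\int[mu]_(x in [set: E]) (rho x)%:E = 1)%E).
Variables (a : E -> R) (theta Theta : R) (ma : measurable_fun setT a).
Hypotheses (theta0 : 0 <= theta) (a_bnd : forall x, theta <= a x <= Theta).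
Variables (nu : E) (B : 'M[R]_n) (BBT : B *m B^T = 1%:M).
Let w := mollified_phase rho nu.

Let sw : smooth w. Proof. exact: mollified_phase_smooth. Qed.
Let w1 x : `|w x| <= 1. Proof. exact: mollified_phase_le1. Qed.

Section fixed_scale.
Variables (K L L2 : R) (V : E -> R) (T e : R).
Hypotheses (K0 : 0 <= K) (L0 : 0 <= L) (L20 : 0 <= L2) (lV : lip K V) (V1 : forall x, `|V x| <= 1)
  (lw : lip L w) (lpw : forall i, lip L2 (partial i w)).
Hypotheses (e0 : 0 < e) (e1 : e < 1) (Vw : forall x, T / 2 - 1 <= cnorm B x -> V x = w x).
Variables (k : E -> R) (ke : mollifier e k).

Let psi x := V x - w x.
Let phi := conv k psi.

Let lpsi : lip (K + L) psi. Proof. exact: lipB. Qed.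
Let psi2 x : `|psi x| <= 2.
Proof. by rewrite (le_trans (ler_normB _ _))// (_ : 2 = 1 + 1)// lerD. Qed.
Let mpsi : measurable_fun setT psi.
Proof. by apply: continuous_measurable_rV; exact: lip_continuous lpsi. Qed.

Lemma correction_smooth : smooth phi.
Proof. by have [sk v _ _] := ke; exact: (conv_smooth sk v mpsi psi2). Qed.

Lemma correction_le x : `|phi x| <= 2.
Proof. exact: (conv_bound ke _ mpsi psi2). Qed.

Lemma correction_lip : exists2 L', 0 <= L' & lip L' phi.
Proof.
have [sk v _ _] := ke; have [K' K'0 lK] := smooth_kernel_lip [::] sk v.
exact: (conv_lip K'0 lK v (ler0n R 2) mpsi psi2).
Qed.

Lemma correction_eq0 x : T / 2 - 1 + e < cnorm B x -> phi x = 0.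
Proof.
move=> xT; rewrite -[RHS](conv_cst ke 0 x).
have c2 (y : E) : `|cst 0 y : R| <= 2 by rewrite /= normr0.
have h y : enorm (x - y) <= e -> psi y = 0.
  move=> xy; rewrite /psi Vw ?subrr//.
  have := cnorm_lip BBT x y; rewrite mul1r => /ler_normlP[_ h]; lra.
apply/eqP; rewrite eq_le; apply/andP; split;
  by apply: (conv_le ke (M := 2)) => // y /h ->.
Qed.

(** The correction vanishes beyond cube norm [T / 2 - 1 + e], which is less than [T / 2] because
    [e < 1]; its support is thus compact inside the open cube. *)
Lemma correction_test : test_function (cube B T) phi.
Proof.
have sub : supp phi `<=` [set x | cnorm B x <= T / 2 - 1 + e].
  rewrite /supp closureE; apply: smallest_sub.
    rewrite (_ : [set _ | _] = cnorm B @^-1` `]-oo, (T / 2 - 1 + e)]%classic).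
      by apply: preimage_closed; [move=> ? _; exact: cnorm_continuous|exact: interval_closed].
    by apply/seteqP; split=> y; rewrite /= in_itv.
  move=> x /= px; rewrite leNgt; apply/negP => /correction_eq0 h.
  by rewrite h eqxx in px.
split; first exact: correction_smooth.
  apply: (@subclosed_compact E _ _ _ _ sub); first exact: closed_closure.
  exact: compact_cnorm_le.
move=> x /sub h; rewrite /cube/=; apply: (le_lt_trans h).
by rewrite -addrA gtrDl addrC subr_lt0.
Qed.

Let v x := w x + phi x.

(** Both [w] and [phi] are C^1 with bounded derivatives, so their classical gradients are weak ones,
    and [phi], being a test function, approximates itself in H^1_0. *)
Lemma competitor_admissible : admissible rho nu (cube B T) v (grad v).
Proof.
have mD := measurable_cube BBT T; have Doo := cube_fin BBT T.
have cw := smooth_C1b sw w1 lw.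
have [L' L'0 lphi] := correction_lip.
have cphi := smooth_C1b correction_smooth correction_le lphi.
have gE x : grad v x = grad w x + grad phi x.
  apply/rowP => i; rewrite !mxE /partial deriveD//.
    by case: cw.
  by case: cphi.
split; first exact: C1b_H1 (C1bD cw cphi).
have vw : phi = (fun x => v x - w x).
  by apply/funext => x; rewrite /v addrC addKr.
have gvw : grad phi = (fun x => grad v x - grad w x).
  by apply/funext => x; rewrite gE addrC addKr.
apply: (H10_ext vw gvw); split; first exact: C1b_H1 cphi.
exists (fun=> phi); split.
- by move=> _; exact: correction_test.
- under eq_fun do under eq_integral do rewrite subrr expr0n/=.
  by rewrite integral0; exact: cvg_cst.
- under eq_fun do under eq_integral do rewrite subrr enorm0 expr0n/=.
  by rewrite integral0; exact: cvg_cst.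
Qed.

Let cpw i x : `|partial i w x| <= L.
Proof. by apply: (le_trans (derive_le _ _ lw)); rewrite basis_vec_enorm mulr1 ger0_norm. Qed.

Let cpV i x : `|partial i V x| <= K.
Proof. by apply: (le_trans (derive_le _ _ lV)); rewrite basis_vec_enorm mulr1 ger0_norm. Qed.

Let mpV i : measurable_fun setT (partial i V).
Proof. by apply: measurable_derive; exact: lip_continuous lV. Qed.

(** The derivative of [v] is [p + d], where [p] is the convolution of the derivative of [V] and [d]
    the difference between the derivative of [w] and its convolution. Here [|p| <= K] and
    [|d| <= L2 * e]; Jensen's inequality treats the square of [p], and [e < 1] makes the remaining
    terms linear in [e]. *)
Lemma competitor_partial_sqr i x :
  partial i v x ^+ 2 <= conv k (fun y => partial i V y ^+ 2) x + (2 * K * L2 + L2 ^+ 2) * e.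
Proof.
have [cw dw] := sw [::]; have [cpw' _] := sw [:: i].
have mpw : measurable_fun setT (partial i w) by exact: continuous_measurable_rV.
have mNpw : measurable_fun setT (fun y => - partial i w y) by exact: measurableT_comp.
have [_ dphi] := correction_smooth [::].
have -> : partial i v x = partial i w x + partial i phi x by rewrite /partial deriveD.
have -> : partial i phi x = conv k (fun y => partial i V y + - partial i w y) x.
  apply: (conv_partial_lip ke lpsi (M := K + L + 2)).
  - by move=> y; rewrite (le_trans (psi2 y))// lerDr addr_ge0.
  - exact: measurable_funD.
  - move=> y; rewrite (le_trans (ler_normD _ _))// normrN.
    by rewrite (le_trans (lerD (cpV i y) (cpw i y)))// lerDl.
  - apply: filterS (lip_ae_derivable (basis_vec i) lV) => y dV.
    have -> : (fun t : nat => dquo psi (basis_vec i) t.+1%:R^-1 y) =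
        (fun t : nat => dquo V (basis_vec i) t.+1%:R^-1 y - dquo w (basis_vec i) t.+1%:R^-1 y).
      by apply/funext => t; rewrite /dquo /psi; ring.
    by apply: cvgB; exact: dquo_cvg_seq.
rewrite (convD ke (M := K + L))//; [|by move=> y; rewrite (le_trans (cpV i y))// lerDl|by move=> y; rewrite normrN (le_trans (cpw i y))// lerDr].
have lNpw : lip L2 (fun y => - partial i w y).
  by move=> y z; rewrite opprK addrC distrC; exact: lpw.
have := conv_close ke x L20 lNpw (M := L).
rewrite (gtr0_norm e0) => /(_ (fun y => _)) h.
have {h} := h (fun y => ltac:(by rewrite normrN; exact: cpw)).
rewrite opprK addrA.
have := conv_bound ke x (mpV i) (cpV i).
rewrite [partial i w x + _]addrC -addrA [partial i w x + _]addrC.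
have := conv_sqr_le ke x (mpV i) (cpV i).
move: (conv k (partial i V) x) (_ + partial i w x) (conv k (fun y => partial i V y ^+ 2) x).
move=> p d c pc pK dL.
have -> : (p + d) ^+ 2 = p ^+ 2 + (2 * (p * d) + d ^+ 2) by ring.
apply: lerD => //; rewrite [leRHS]mulrDl; apply: lerD.
  rewrite -!mulrA ler_pM2l// (le_trans (ler_norm _))// normrM.
  exact: ler_pM.
rewrite -real_normK ?num_real// (@le_trans _ _ ((L2 * e) ^+ 2))//.
  by rewrite ler_sqr ?nnegrE ?mulr_ge0// ltW.
rewrite exprMn ler_wpM2l ?sqr_ge0// expr2 ger_pMl// ltW//.
Qed.

(** For the potential term, [v - V] is the error of convolving [psi], at most [(K + L) * e], and
    [W_lip] applies. *)
Lemma competitor_density x :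
  a x * W (v x) + 2^-1 * enorm (grad v x) ^+ 2 <=
  a x * W (V x) + 2^-1 * (\sum_(i < n) conv k (fun y => partial i V y ^+ 2) x) +
  (Theta * (96 * (K + L)) + 2^-1 * (n%:R * (2 * K * L2 + L2 ^+ 2))) * e.
Proof.
have KL0 : 0 <= K + L by exact: addr_ge0.
have /andP[ta aT] := a_bnd x.
have h1 : a x * W (v x) <= a x * W (V x) + Theta * (96 * (K + L)) * e.
  have vV : `|v x - V x| <= (K + L) * e.
    have := conv_close ke x KL0 lpsi psi2; rewrite (gtr0_norm e0).
    rewrite (_ : v x - V x = conv k psi x - psi x)//.
    by rewrite /v /phi /psi; ring.
  rewrite -lerBlDl -mulrBr (le_trans (ler_norm _))// normrM.
  rewrite -!mulrA; apply: ler_pM => //; first by rewrite ger0_norm// (le_trans theta0).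
  rewrite (le_trans (W_lip _ _)) ?ler_pM2l//.
    by rewrite (_ : 3 = 1 + 2)// (le_trans (ler_normD _ _))// lerD// correction_le.
  by rewrite (le_trans (V1 _))// ler1n.
rewrite [(_ + _) * e]mulrDl addrACA; apply: lerD => //.
rewrite enorm_sqrE -[_ * _ * e]mulrA -mulrDr ler_pM2l ?invr_gt0//.
rewrite -mulrA mulr_natl -[n in _ *+ n]card_ord -sumr_const -big_split/=.
by apply: ler_sum => i _; rewrite mxE; exact: competitor_partial_sqr.
Qed.

Let msq i : measurable_fun setT (fun y => partial i V y ^+ 2).
Proof. exact: measurable_funX. Qed.
Let sq_le i y : `|partial i V y ^+ 2| <= K ^+ 2.
Proof. by rewrite normrX ler_sqr ?nnegrE. Qed.

(** After the pointwise bound, [conv_Tonelli] removes the convolution from the squared derivatives.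
    Points within [e < 1] of the cube are reached, which enlarges its half-side by 1. *)
Lemma competitor_energy_le :
  (energy a (cube B T) v (grad v) <= energy a (cube B (T + 2)) V (grad V) +
   ((Theta * (96 * (K + L)) + 2^-1 * (n%:R * (2 * K * L2 + L2 ^+ 2))) * e)%:E * mu (cube B T))%E.
Proof.
have mD := measurable_cube BBT T; have mD' := measurable_cube BBT (T + 2).
have DD' : cube B T `<=` cube B (T + 2).
  by move=> x; rewrite /cube/=; move: (cnorm B x) => c; lra.
set C := (_ + _) * e.
have C0 : 0 <= C.
  have /andP[ta aT] := a_bnd 0.
  rewrite mulr_ge0 ?(ltW e0)// addr_ge0// !mulr_ge0 ?invr_ge0 ?addr_ge0 ?mulr_ge0 ?sqr_ge0//.
  exact: le_trans (le_trans theta0 ta) aT.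
have [sk kv k0 _] := ke.
pose g i := conv k (fun y => partial i V y ^+ 2).
have mg i : measurable_fun setT (g i).
  apply: continuous_measurable_rV; apply: smooth_continuous.
  exact: (conv_smooth sk kv (msq i) (sq_le i)).
have g0 i x : 0 <= g i x.
  apply: Rintegral_ge0 => y _; exact: mulr_ge0 (k0 _) (sqr_ge0 _).
have a0 x : 0 <= a x by have /andP[ta _] := a_bnd x; exact: le_trans ta.
have cV := lip_continuous lV.
have mF : measurable_fun setT (fun y => a y * W (V y)).
  apply: measurable_funM => //; apply: measurable_funX.
  by apply: measurable_funB => //; apply: measurable_funX; exact: continuous_measurable_rV.
have F0 y : 0 <= a y * W (V y) by rewrite mulr_ge0 ?W_ge0.
have ms : measurable_fun setT (fun x => 2^-1 * (\sum_(i < n) g i x)).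
  by apply: measurable_funM => //; exact: measurable_sum.
have s0 x : 0 <= 2^-1 * (\sum_(i < n) g i x).
  by rewrite mulr_ge0 ?invr_ge0// sumr_ge0.
have mdv : measurable_fun setT (fun y => a y * W (v y) + 2^-1 * enorm (grad v y) ^+ 2).
  apply: measurable_energy_density => // x; have FF := @nbhs_filter E x.
  by apply: cvgD; [exact: smooth_continuous sw _|exact: smooth_continuous correction_smooth _].
apply: (@le_trans _ _ (\int[mu]_(x in cube B T) (a x * W (V x) + 2^-1 * (\sum_(i < n) g i x) + C)%:E)%E).
  apply: ge0_le_integral => //.
  - by move=> x _; rewrite lee_fin; exact: energy_density_ge0.
  - by apply/measurable_EFinP; exact: measurable_funS mdv.
  - apply/measurable_EFinP; apply: measurable_funD => //; apply: measurable_funD.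
      exact: measurable_funS mF.
    exact: measurable_funS ms.
  - by move=> x _; rewrite lee_fin; exact: competitor_density.
have mC : measurable_fun [set: E] (cst C : E -> R) by [].
have mFs := measurable_funD mF ms.
have Fs0 x : 0 <= a x * W (V x) + 2^-1 * (\sum_(i < n) g i x) by exact: addr_ge0.
have mG : measurable_fun setT (fun y : E => 2^-1 * enorm (grad V y) ^+ 2).
  apply: measurable_funM => //; under eq_fun do rewrite enorm_sqrE.
  by apply: measurable_sum => i; under eq_fun do rewrite mxE; exact: msq.
have G0 y : 0 <= 2^-1 * enorm (grad V y) ^+ 2 by rewrite mulr_ge0 ?invr_ge0 ?sqr_ge0.
have cE : (\int[mu]_(x in cube B T) (cst C x)%:E = C%:E * mu (cube B T))%E.
  exact: (integral_cst mu mD C%:E).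
rewrite (integralD_EFin mD mFs mC Fs0 (fun=> C0)) cE leeD2r// /energy.
rewrite (integralD_EFin mD mF ms F0 s0) (integralD_EFin mD' mF mG F0 G0).
apply: leeD.
  apply: ge0_subset_integral => //; first by apply/measurable_EFinP; exact: measurable_funS mF.
  by move=> x _; rewrite lee_fin.
have eE (A : set E) (h : 'I_n -> E -> R) : measurable A -> (forall i, measurable_fun setT (h i)) ->
    (forall i x, 0 <= h i x) ->
    (\int[mu]_(x in A) (2^-1 * \sum_(i < n) h i x)%:E = 2^-1%:E * \sum_(i < n) \int[mu]_(x in A) (h i x)%:E)%E.
  move=> mA mh h0; under eq_integral do rewrite EFinM -sumEFin.
  rewrite ge0_integralZl//; last 2 first.
  - by apply: emeasurable_sum => i; apply/measurable_EFinP; exact: measurable_funS (mh i).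
  - by move=> x _; apply: sume_ge0 => i _; rewrite lee_fin.
  rewrite ge0_integral_sum// => i; last by move=> x _; rewrite lee_fin.
  by apply/measurable_EFinP; exact: measurable_funS (mh i).
have -> : (\int[mu]_(x in cube B (T + 2)) (2^-1 * enorm (grad V x) ^+ 2)%:E =
    \int[mu]_(x in cube B (T + 2)) (2^-1 * \sum_(i < n) partial i V x ^+ 2)%:E)%E.
  apply: eq_integral => x _; rewrite enorm_sqrE; congr (_ * _)%:E.
  by apply: eq_bigr => i _; rewrite mxE.
rewrite !eE//; last by move=> i x; rewrite sqr_ge0.
rewrite lee_wpmul2l ?lee_fin ?invr_ge0//; apply: lee_sum => i _.
apply: (conv_Tonelli ke (M := K ^+ 2)) => //.
  by move=> x; rewrite sqr_ge0 -[leLHS]ger0_norm ?sqr_ge0//=; exact: sq_le.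
move=> x y; rewrite /cube/= => xT xy.
have := cnorm_lip BBT y x; rewrite mul1r enorm_distC => /ler_normlP[_].
rewrite lerBlDl => h; rewrite mulrDl divff ?pnatr_eq0//; apply: (le_lt_trans h).
exact: ltr_leD xT (le_trans xy (ltW e1)).
Qed.

End fixed_scale.

(** The mollification radius tends to 0 with [T] fixed, so the error constant [C] may depend on [T],
    which it does through the measure of the cube. *)
Lemma cell_inf_le_competitor (K : R) (V : E -> R) (T : R) : 0 <= K -> lip K V ->
  (forall x, `|V x| <= 1) ->
  (forall x, T / 2 - 1 <= cnorm B x -> V x = mollified_phase rho nu x) ->
  (cell_inf a rho nu (cube B T) <= energy a (cube B (T + 2)) V (grad V))%E.
Proof.
move=> K0 lV V1 Vw.
have [L L0 lw] := mollified_phase_lip rho_test rho_bnd rho_int nu [::].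
have [L2 L20 lpw] : exists2 L2, 0 <= L2 & forall i, lip L2 (partial i w).
  have /choice[l hl] : forall i, exists L, 0 <= L /\ lip L (partial i w).
    move=> i; have [L' L'0 h] := mollified_phase_lip rho_test rho_bnd rho_int nu [:: i].
    by exists L'.
  exists (\sum_(i < n) l i); first by apply: sumr_ge0 => i _; case: (hl i).
  move=> i x y; have [_ /(_ x y) h] := hl i; apply: (le_trans h).
  rewrite ler_wpM2r ?enorm_ge0// (bigD1 i)//= lerDl.
  by apply: sumr_ge0 => j _; case: (hl j).
set M := fine (mu (cube B T)).
have M0 : 0 <= M by exact: fine_ge0.
have ME : mu (cube B T) = M%:E by rewrite fineK// ge0_fin_numE// cube_fin.
set C := (Theta * (96 * (K + L)) + 2^-1 * (n%:R * (2 * K * L2 + L2 ^+ 2))) * M.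
have key e : 0 < e -> e < 1 ->
    (cell_inf a rho nu (cube B T) <= energy a (cube B (T + 2)) V (grad V) + (C * e)%:E)%E.
  move=> e0 e1; have [k ke] := mollifier_dilate e0 rho_test rho_bnd rho_int.
  apply: (@le_trans _ _ (energy a (cube B T) (fun x => w x + conv k (fun y => V y - w y) x)
     (grad (fun x => w x + conv k (fun y => V y - w y) x)))).
    apply: ereal_inf_lbound; do 2 eexists; split; last by [].
    exact: (competitor_admissible lV V1 lw e1 Vw ke).
  apply: (le_trans (competitor_energy_le T K0 L0 L20 lV V1 lw lpw e0 e1 ke)).
  by rewrite ME -EFinM mulrAC.
apply/lee_addgt0Pr => e e0.
have C1 : 0 < `|C| + 1 by rewrite ltr_wpDl.
(* The first bound keeps the radius below 1, the second makes [C * d] at most [e]. *)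
pose d := Num.min (1 / 2) (e / (`|C| + 1)).
have d0 : 0 < d by rewrite lt_min !divr_gt0.
have d1 : d < 1 by rewrite gt_min; apply/orP; left; lra.
apply: (le_trans (key d d0 d1)); rewrite leeD2l// lee_fin.
rewrite (le_trans (ler_norm _))// normrM (gtr0_norm d0).
apply: (@le_trans _ _ ((`|C| + 1) * d)); first by rewrite ler_wpM2r ?(ltW d0)// lerDl.
by rewrite mulrC -ler_pdivlMr// ge_min lexx orbT.
Qed.

End competitor.

(** * The weighted distance to a hyperplane *)

Section lower_integral.
Import HBNNSimple.
Context {R : realType} d (T : measurableType d) (m : {measure set T -> \bar R}).
Local Open Scope ereal_scope.

(* The integral of a nonnegative function is a supremum over simple functions
   below it, so the next two facts need no measurability. *)
Lemma le_integral_ge0 (D : set T) (f g : T -> \bar R) :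
  (forall x, D x -> 0 <= f x) -> (forall x, D x -> f x <= g x) ->
  \int[m]_(x in D) f x <= \int[m]_(x in D) g x.
Proof.
move=> f0 fg; rewrite !ge0_integralE//; last first.
  by move=> x Dx; exact: le_trans (f0 _ Dx) (fg _ Dx).
apply: ge_ereal_sup => _ /= [h hf <-]; apply: ereal_sup_ubound; exists h => // x.
apply: (le_trans (hf x)); rewrite !patchE; case: ifPn => // /set_mem Dx.
exact: fg.
Qed.

Lemma integral_le_simple (D : set T) (f : T -> \bar R) c :
  (forall x, D x -> 0 <= f x) ->
  (forall h : T -> R, measurable_fun setT h -> (forall x, (0 <= h x)%R) ->
     (forall x, D x -> (h x)%:E <= f x) -> (forall x, ~ D x -> h x = 0%R) ->
     \int[m]_(x in setT) (h x)%:E <= c) ->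
  \int[m]_(x in D) f x <= c.
Proof.
move=> f0 hc; rewrite ge0_integralE//; apply: ge_ereal_sup => _ /= [h hf <-].
rewrite -(integralT_nnsfun m h). apply: (hc h).
- exact: measurable_funPT.
- by move=> x; exact: fun_ge0.

- by move=> x Dx; have := hf x; rewrite patchE mem_set.
- move=> x nDx; have := hf x; rewrite patchE memNset// lee_fin => h0.
  by apply/eqP; rewrite eq_le h0 fun_ge0.
Qed.

End lower_integral.

Section affine_change.
Context {R : realType}.
Local Notation la := (@lebesgue_measure R).

Lemma measurable_affine (c b : R) :
  measurable_fun [set: measurableTypeR R] ((fun s => c * s + b) : measurableTypeR R -> measurableTypeR R).
Proof. by apply: measurable_funD => //; exact: measurable_funM. Qed.

Lemma lebesgue_measure_affine (c b : R) (A : set R) : 0 < c -> measurable A ->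
  (la A = c%:E * la ((fun s => c * s + b)%R @^-1` A))%E.
Proof.
move=> c0 mA.
pose p := measure_function_pushforward__canonical__measure_function_Measure la (measurable_affine c b).
pose nn : {nonneg R} := NngNum (ltW c0).
apply: (@lebesgue_measure_unique R (mscale nn p) _ A mA).
move=> _ [[x y]] _ <-; change (la `]x, y]%classic = c%:E * la ((fun s => c * s + b)%R @^-1` `]x, y]%classic))%E.
have -> : (fun s => c * s + b) @^-1` `]x, y] = `](x - b) / c, (y - b) / c]%classic.
  apply/seteqP; split=> s; rewrite /= !in_itv/=.
    by move=> /andP[h1 h2]; rewrite ltr_pdivrMr// ler_pdivlMr// ltrBlDr lerBrDr [s * c]mulrC h1 h2.
  by rewrite ltr_pdivrMr// ler_pdivlMr// ltrBlDr lerBrDr [s * c]mulrC => /andP[-> ->].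
rewrite !lebesgue_measure_itv/= !lte_fin ltr_pM2r ?invr_gt0// ltrD2r.
case: ifPn => _; last by rewrite mule0.
by rewrite -!EFinB -EFinM; congr (_%:E); field; rewrite gt_eqF.
Qed.

Lemma integral_affine (c b : R) (h : R -> R) : 0 < c -> measurable_fun setT h ->
  (forall x, 0 <= h x) ->
  (\int[la]_(t in setT) (h t)%:E = c%:E * \int[la]_(s in setT) (h (c * s + b)%R)%:E)%E.
Proof.
move=> c0 mh h0.
pose p := measure_function_pushforward__canonical__measure_function_Measure la (measurable_affine c b).
pose nn : {nonneg R} := NngNum (ltW c0).
transitivity (\int[mscale nn p]_(t in setT) (h t)%:E)%E.
  apply: eq_measure_integral => A mA _; exact: lebesgue_measure_affine.
rewrite ge0_integral_mscale//; last 2 first.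
- by apply/measurable_EFinP.
- by move=> x _; rewrite lee_fin.
congr (_ * _)%E.
apply: (@ge0_integral_pushforward _ _ (measurableTypeR R) (measurableTypeR R) R _ (measurable_affine c b) la setT (EFin \o h) measurableT).
  by apply/measurable_EFinP.
by move=> x _; rewrite lee_fin.
Qed.

End affine_change.

Section curves.
Context {R : realType} {n : nat}.
Local Notation E := 'rV[R]_n.
Local Notation la := (@lebesgue_measure R).
Implicit Types (gamma : R -> E) (y z : E).

Lemma lipschitz01P gamma : [lipschitz gamma t | t in `[0, 1] : set R^o] <->
  exists2 K, 0 <= K & forall s t, 0 <= s <= 1 -> 0 <= t <= 1 ->
    `|gamma s - gamma t| <= K * `|s - t|.
Proof.
split=> [[M [_ hM]]|[K K0 hK]].
  exists (`|M| + 1); first by rewrite addr_ge0.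
  move=> s t s01 t01; apply: (hM (`|M| + 1) _ (s, t)).
    by rewrite (le_lt_trans (ler_norm M))// ltrDl.
  by split; rewrite /= in_itv.
exists K; split; first exact: num_real.
move=> M KM [s t] /= [s01 t01]; rewrite !in_itv/= in s01 t01.
by apply: (le_trans (hK _ _ s01 t01)); rewrite ler_wpM2r// ltW.
Qed.

Lemma derive1_nondiff gamma t : ~ derivable gamma t 1 -> derive1 gamma t = 0.
Proof.
rewrite derive1E => nd; rewrite /derive (dvgP nd).
by apply/rowP => i; rewrite /point/= !mxE.
Qed.

(** No differentiability is assumed: the change of time is invertible, so both derivatives fail to
    exist together and then equal the default 0. *)
Lemma derive1_affine gamma (c b t : R) : 0 < c ->
  derive1 (fun s => gamma (c * s + b)) t = c *: derive1 gamma (c * t + b).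
Proof.
move=> c0.
have key (f : R -> E) (e k u : R) : 0 < e -> derivable f (e * u + k) 1 ->
    derivable (fun s => f (e * s + k)) u 1 /\
    'D_1 (fun s => f (e * s + k)) u = e *: 'D_1 f (e * u + k).
  move=> e0 df.
  suff h : (fun h => h^-1 *: (f (e * (h *: 1 + u) + k) - f (e * u + k))) @ 0^' --> e *: 'D_1 f (e * u + k).
    split; first by apply/cvg_ex; eexists; exact: h.
    exact/cvg_lim.
  have -> : (fun h => h^-1 *: (f (e * (h *: 1 + u) + k) - f (e * u + k))) =
      (fun h => e *: ((e * h)^-1 *: (f ((e * h) *: 1 + (e * u + k)) - f (e * u + k)))).
    apply/funext => h; rewrite scalerA invfM mulrA mulfV ?gt_eqF// mul1r.
    congr (_ *: (f _ - _)); rewrite mulrDr -addrA; congr (_ + _).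
    by rewrite /GRing.scale/= !mulr1.
  apply: cvgZl_tmp.
  apply: (@cvg_comp _ _ _ (fun t : R => e * t) (fun h => h^-1 *: (f (h *: 1 + (e * u + k)) - f (e * u + k))) _ (0^')); last exact: df.
  move=> A [r /= r0 hA]; exists (r / e) => /=; first by rewrite divr_gt0.
  move=> x /=; rewrite sub0r normrN ltr_pdivlMr// => xr x0.
  by apply: hA; rewrite /= ?mulf_neq0// ?gt_eqF// sub0r normrN normrM (gtr0_norm e0) mulrC.
have [d|nd] := pselect (derivable gamma (c * t + b) 1).
  by rewrite !derive1E (key _ _ _ _ c0 d).2.
rewrite (derive1_nondiff nd) scaler0; apply: derive1_nondiff => d; apply: nd.
have := @key (fun s => gamma (c * s + b)) c^-1 (- b / c) (c * t + b).
have -> : c^-1 * (c * t + b) + - b / c = t.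
  by rewrite mulrDr mulKf ?gt_eqF// mulNr [b / c]mulrC addrK.
rewrite invr_gt0 => /(_ c0 d)[+ _].
rewrite (_ : (fun s => _) = gamma)//; apply/funext => s; congr (gamma _).
by field; rewrite gt_eqF.
Qed.

Lemma eq_derive1 gamma gamma' t : (\forall s \near t, gamma s = gamma' s) ->
  derive1 gamma t = derive1 gamma' t.
Proof. by move=> h; rewrite !derive1E; exact: near_eq_derive. Qed.

Lemma derive1_segment y z t : derive1 (fun s : R => y + s *: z) t = z.
Proof.
rewrite derive1E; apply/cvg_lim => //.
apply: (@cvg_near_cst _ _ z); near=> h.
rewrite /= opprD addrACA subrr add0r -scalerBl addrK.
rewrite (_ : h%:A = h); last by rewrite /GRing.scale/= mulr1.
rewrite scalerA.
by rewrite mulVf ?scale1r//; near: h; exact: nbhs_dnbhs_neq.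
Unshelve. all: by end_near. Qed.

End curves.

Section distance.
Context {R : realType} {n : nat}.
Local Notation E := 'rV[R]_n.
Local Notation la := (@lebesgue_measure R).
Variables (a : E -> R) (theta Theta : R).
Hypotheses (a_bnd : forall x, theta <= a x <= Theta).
Implicit Types (gamma : R -> E) (y z : E).

Lemma sqrt_a_bnd x : Num.sqrt theta <= Num.sqrt (a x) <= Num.sqrt Theta.
Proof.
have /andP[ta aT] := a_bnd x.
by rewrite !ler_wsqrtr.
Qed.

Lemma speed_ge0 gamma t : 0 <= Num.sqrt (a (gamma t)) * enorm (derive1 gamma t).
Proof. by rewrite mulr_ge0 ?sqrtr_ge0 ?enorm_ge0. Qed.

Lemma curve_length_ge0 gamma : (0 <= curve_length a gamma)%E.
Proof. by apply: integral_ge0 => t _; rewrite lee_fin speed_ge0. Qed.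

(** The segment from [y] to [y'] is run on the first half of the time interval and [gamma] on the
    second, both at doubled speed. *)
Lemma concat_lipschitz y y' z gamma : lipschitz_curve y' z gamma ->
  lipschitz_curve y z (fun t => if t <= 2^-1 then y + t *: (2 *: (y' - y))
                                else gamma (2 * t + -1)).
Proof.
move=> [/lipschitz01P[K K0 hK] g0 g1].
split; last 2 first.
- by rewrite invr_ge0 ler0n scale0r addr0.
- rewrite ifF; first by rewrite mulr1 (_ : 2 + -1 = 1)//; ring.
  by apply/negbTE; rewrite -ltNge invf_lt1// ltr1n.
set g := fun t : R => _.
apply/lipschitz01P; exists (`|2 *: (y' - y)| + K * 2).
  by rewrite addr_ge0 ?mulr_ge0.
have wl s t : 0 <= s -> s <= t -> t <= 1 ->
    `|g s - g t| <= (`|2 *: (y' - y)| + K * 2) * `|s - t|.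
  move=> s0 st t1; rewrite mulrDl /g; case: (leP s 2^-1) => hs; case: (leP t 2^-1) => ht.
  - rewrite opprD addrACA subrr add0r -scalerBl normrZ mulrC lerDl.
    by rewrite !mulr_ge0.
  - rewrite -[_ - gamma _](subrKA y') (le_trans (ler_normD _ _))//; apply: lerD.
      have -> : y + s *: (2 *: (y' - y)) - y' = (s - 2^-1) *: (2 *: (y' - y)).
        rewrite scalerBl [2^-1 *: _]scalerA mulVf ?pnatr_eq0// scale1r.
        by rewrite opprB addrA [y + _]addrC -addrA; congr (_ + _); rewrite addrC.
      rewrite normrZ mulrC ler_wpM2l// !ler0_norm ?subr_le0// ?opprB ?lerD2r//; lra.
    rewrite -g0 -mulrA (le_trans (hK _ _ _ _))//; [by rewrite lexx ler01|lra|].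
    by rewrite ler_wpM2l// sub0r normrN ger0_norm ?ler0_norm; lra.
  - by exfalso; lra.
  - rewrite (le_trans (hK _ _ _ _))//; [lra|lra|].
    rewrite opprD addrACA subrr addr0 -mulrBr normrM ger0_norm// mulrA lerDr.
    by rewrite mulr_ge0.
move=> s t /andP[s0 s1] /andP[t0 t1]; case: (leP s t) => st; first exact: wl.
by rewrite distrC [`|s - t|]distrC; apply: wl => //; exact: ltW.
Qed.

(** The speed is not assumed measurable, so the length is bounded through a measurable [h] below it.
    The doubled speed and the halved time cancel: directly on the segment, by an affine change of
    time on [gamma]. *)
Lemma concat_length y y' gamma :
  (curve_length a (fun t => (if t <= 2^-1 then y + t *: (2 *: (y' - y))
                                else gamma (2 * t + -1))%R)
   <= (Num.sqrt Theta * enorm (y - y'))%:E + curve_length a gamma)%E.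
Proof.
set g := fun t : R => _.
apply: integral_le_simple => [t _|h mh h0 hF hz]; first by rewrite lee_fin speed_ge0.
(* The strict inequalities drop the junction time [2^-1], where the derivative of [g] is not
   controlled; a single point is null. *)
pose h1 t := if t < 2^-1 then h t else 0.
pose h3 t := if 2^-1 < t then h t else 0.
have mh1 : measurable_fun setT h1.
  by apply: measurable_fun_ifT => //; exact: measurable_fun_ltr.
have mh3 : measurable_fun setT h3.
  by apply: measurable_fun_ifT => //; exact: measurable_fun_ltr.
have h10 t : 0 <= h1 t by rewrite /h1; case: ifP.
have h30 t : 0 <= h3 t by rewrite /h3; case: ifP.
have -> : (\int[la]_(t in setT) (h t)%:E = \int[la]_(t in setT) (h1 t + h3 t)%:E)%E.
  apply: ae_eq_integral => //.
  - exact/measurable_EFinP.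
  - by apply/measurable_EFinP; exact: measurable_funD.
  exists [set 2^-1]; split; [exact: measurable_set1|exact: lebesgue_measure_set1|].
  move=> t /= ht; apply: contrapT => t2; apply: ht => _.
  rewrite /h1 /h3; case: ltgtP => ht; rewrite ?addr0 ?add0r//.
under eq_integral do rewrite EFinD.
rewrite ge0_integralD//; last 4 first.
- by move=> t _; rewrite lee_fin.
- exact/measurable_EFinP.
- by move=> t _; rewrite lee_fin.
- exact/measurable_EFinP.
have ht01 t : h t != 0 -> 0 <= t <= 1.
  move=> ht; apply: contraNT ht => t01; apply/eqP/hz; rewrite /= in_itv/=.
  exact/negP.
apply: leeD.
  set c := Num.sqrt Theta * (2 * enorm (y - y')).
  have c0 : 0 <= c by rewrite !mulr_ge0 ?sqrtr_ge0 ?enorm_ge0.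
  apply: (@le_trans _ _ (\int[la]_(t in setT) (c * \1_(`[0, 2^-1] : set R) t)%:E)%E).
    apply: le_integral_ge0 => t _; first by rewrite lee_fin.
    rewrite lee_fin /h1; case: ifP => t2; last by rewrite mulr_ge0.
    have [->|ht] := eqVneq (h t) 0; first by rewrite mulr_ge0.
    have /andP[t0 t1] := ht01 _ ht.
    rewrite indicE mem_set ?mulr1 /= ?in_itv/= ?t0 ?(ltW t2)//.
    have := hF t; rewrite /= in_itv/= t0 t1 => /(_ isT); rewrite lee_fin => hFt.
    apply: (le_trans hFt); have -> : derive1 g t = 2 *: (y' - y).
      rewrite -[RHS](derive1_segment y _ t); apply: eq_derive1.
      have t2' : t \in `]-oo, 2^-1[%classic by rewrite inE /= in_itv.
      have := @open_nbhs_nbhs _ t `]-oo, 2^-1[%classic.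
      have : open_nbhs t `]-oo, 2^-1[%classic by split; [exact: interval_open|rewrite /= in_itv].
      move=> o /(_ o); apply: filterS => s; rewrite /= in_itv/= => s2.
      by rewrite /g (ltW s2).
    rewrite enormZ ger0_norm// enorm_distC; apply: ler_wpM2r.
      by rewrite mulr_ge0 ?enorm_ge0.
    by have /andP[] := sqrt_a_bnd (g t).
  under eq_integral do rewrite EFinM.
  rewrite ge0_integralZl//; last by apply/measurable_EFinP.
  have -> : (\int[la]_(t in setT) (\1_(`[0, 2^-1] : set R) t)%:E = (2^-1)%:E)%E.
    rewrite integral_indic// setIT; apply: (eq_trans (lebesgue_measure_itv _)).
    by rewrite /= lte_fin invr_gt0 ltr0n sube0.
  by rewrite -EFinM lee_fin (_ : c * 2^-1 = Num.sqrt Theta * enorm (y - y'))// /c; field.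
rewrite (@integral_affine R 2^-1 2^-1)//.
rewrite -ge0_integralZl//; last 2 first.
- apply/measurable_EFinP; apply: (measurableT_comp mh3); exact: measurable_affine.
- by move=> s _; rewrite lee_fin.
have k0 s : ~ (`[0, 1]%classic : set R) s -> 2^-1 * h3 (2^-1 * s + 2^-1) = 0.
  rewrite /= in_itv/= => s01; rewrite /h3; case: ifP => hs; last by rewrite mulr0.
  have [->|ht] := eqVneq (h (2^-1 * s + 2^-1)) 0; first by rewrite mulr0.
  have /andP[t0 t1] := ht01 _ ht; exfalso; apply: s01.
  by apply/andP; split; lra.
have -> : (\int[la]_(s in setT) (2^-1%:E * (h3 (2^-1 * s + 2^-1)%R)%:E) =
    \int[la]_(s in `[0%R, 1%R]) (2^-1 * h3 (2^-1 * s + 2^-1)%R)%:E)%E.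
  rewrite [RHS]integral_mkcond; apply: eq_integral => s _.
  rewrite patchE -EFinM; case: ifPn => //; rewrite notin_setE => /k0 ->//.
apply: le_integral_ge0 => s; first by rewrite lee_fin mulr_ge0.
rewrite /= in_itv/= => /andP[s0 s1]; rewrite lee_fin /h3; case: ifP => hs; last by rewrite mulr0 speed_ge0.
have := hF (2^-1 * s + 2^-1); rewrite /= in_itv/= => hFs.
have {}hFs := hFs ltac:(by apply/andP; split; lra).
have s2 : 2 * (2^-1 * s + 2^-1) + -1 = s by field.
have gE : g (2^-1 * s + 2^-1) = gamma s.
  by rewrite /g leNgt hs/= s2.
rewrite lee_fin gE in hFs.
have dE : derive1 g (2^-1 * s + 2^-1) = 2 *: derive1 gamma s.
  rewrite -{2}s2 -derive1_affine//; apply: eq_derive1.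
  have := @open_nbhs_nbhs _ (2^-1 * s + 2^-1) `]2^-1, +oo[%classic.
  have : open_nbhs (2^-1 * s + 2^-1) `]2^-1, +oo[%classic.
    by split; [exact: interval_open|rewrite /= in_itv/= hs].
  move=> o /(_ o); apply: filterS => t; rewrite /= in_itv/= andbT => t2.
  by rewrite /g leNgt t2.
rewrite dE enormZ ger0_norm// in hFs.
by rewrite ler_pdivrMl// [2 * _]mulrCA.
Qed.

(** Projection on the unit vector [nu] does not increase speed, and the projected curve, a Lipschitz
    real function, is the integral of its derivative. *)
Lemma length_ge y z gamma (nu : E) : enorm nu = 1 -> lipschitz_curve y z gamma ->
  ((Num.sqrt theta * `|dotv z nu - dotv y nu|)%:E <= curve_length a gamma)%E.
Proof.
move=> nu1 [/lipschitz01P[K K0 hK] g0 g1].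
(* Clamping the time extends the curve to the whole line with the same Lipschitz constant. *)
pose clamp (t : R) : R := if t <= 0 then 0 else if 1 <= t then 1 else t.
have clamp01 t : 0 <= clamp t <= 1.
  by rewrite /clamp; case: (leP t 0) => h1; [|case: (leP 1 t) => h2]; apply/andP; split; lra.
have clamp_id t : 0 <= t <= 1 -> clamp t = t.
  by move=> /andP[t0 t1]; rewrite /clamp; case: (leP t 0) => h1; [|case: (leP 1 t) => h2]; lra.
have clamp_lip s t : `|clamp s - clamp t| <= `|s - t|.
  have := ler_norm (s - t); have := ler_norm (t - s); rewrite distrC.
  rewrite ler_norml /clamp; move: `|s - t| => d h1 h2.
  by case: (leP s 0) => hs; [|case: (leP 1 s) => hs']; (case: (leP t 0) => ht; [|case: (leP 1 t) => ht']);
    apply/andP; split; lra.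
pose G t := gamma (clamp t).
have lG s t : `|G s - G t| <= K * `|s - t|.
  by apply: (le_trans (hK _ _ (clamp01 s) (clamp01 t))); rewrite ler_wpM2l.
pose f t := dotv (G t) nu.
have lf : lip1 (Num.sqrt n%:R * K) f.
  move=> s t; rewrite /f -dotvBl (le_trans (cauchy_schwarz _ _))// nu1 mulr1.
  by rewrite (le_trans (enorm_le_norm _))// -mulrA ler_wpM2l ?sqrtr_ge0.
have lGi i : lip1 K (fun t => G t ord0 i).
  move=> s t; apply: le_trans (lG s t); rewrite (le_trans _ (coord_le_norm _ i))//.
  by rewrite !mxE.
have [g ig [fg aeg]] := lip1_ae_derive lf ltr01.
(* At these times the derivative of the curve is a genuine one; the default 0 could not bound
   [g]. *)
have aeG : {ae la, forall t, forall i, derivable (fun t => G t ord0 i) t 1}.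
  by apply: filter_forall => i; exact: lip1_ae_derivable (lGi i).
have aeF : {ae la, forall t, 0 < t < 1 -> `|g t| <= enorm (derive1 gamma t)}.
  have FF := ae_filter_ringOfSetsType la.
  apply: filterS2 aeg aeG => t h1 h2 t01; have [df <-] := h1 t01.
  have dG : derivable G t 1.
    by apply/derivable_mxP => i j; rewrite (ord1 i); exact: h2.
  have -> : derive1 gamma t = derive1 G t.
    apply: eq_derive1; have := @open_nbhs_nbhs _ t `]0, 1[%classic.
    have : open_nbhs t `]0, 1[%classic by split; [exact: interval_open|rewrite /= in_itv].
    move=> o /(_ o); apply: filterS => s; rewrite /= in_itv/= => /andP[s0 s1].
    by rewrite /G clamp_id// !ltW.
  have -> : derive1 f t = dotv (derive1 G t) nu.
    rewrite !derive1E; apply/cvg_lim => //.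
    have -> : (fun h => h^-1 *: ((f \o shift t) (h *: 1) - f t)) =
        (fun h => dotv (h^-1 *: ((G \o shift t) (h *: 1) - G t)) nu).
      by apply/funext => h; rewrite dotvZl dotvBl.
    apply: (cvg_comp _ (fun x => dotv x nu)); first exact: dG.
    exact: (lip_continuous (dotv_lip nu)).
  by rewrite (le_trans (cauchy_schwarz _ _))// nu1 mulr1.
have [N [mN N0 hN]] := aeF.
have mg : measurable_fun setT g by have /measurable_int/measurable_EFinP := ig.
(* A measurable function below the speed at every time: it is 0 on the null set where the comparison
   may fail. *)
pose k (t : R) : R := if (t \in `]0, 1[%classic `\` N) then Num.sqrt theta * `|g t| else 0.
apply: (@le_trans _ _ (\int[la]_(t in `[0%R, 1%R]) (k t)%:E)%E); last first.
  apply: le_integral_ge0 => t _; rewrite lee_fin /k.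
    by case: ifP => // _; rewrite mulr_ge0 ?sqrtr_ge0.
  case: ifPn => [/set_mem [t01 tN]|_]; last exact: speed_ge0.
  have {}tN : 0 < t < 1 -> `|g t| <= enorm (derive1 gamma t).
    by apply: contrapT => h; apply: tN; exact: hN.
  apply: ler_pM; rewrite ?sqrtr_ge0//; last by apply: tN; move: t01; rewrite /= in_itv.
  by have /andP[] := sqrt_a_bnd (gamma t).
have mk : measurable_fun [set: measurableTypeR R] k.
  apply: measurable_fun_ifT => //; last by apply: measurable_funM => //; exact: measurableT_comp.
  apply: (measurable_fun_bool true); rewrite setTI.
  rewrite (_ : _ @^-1` _ = `]0, 1[%classic `\` N); first exact: measurableD.
  by apply/seteqP; split=> t /=; [exact: set_mem|exact: mem_set].
have -> : (\int[la]_(t in `[0%R, 1%R]) (k t)%:E = \int[la]_(t in `]0%R, 1%R]) (Num.sqrt theta * `|g t|)%:E)%E.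
  rewrite -integral_itv_obnd_cbnd; last by apply/measurable_EFinP; exact: measurable_funS mk.
  apply: ae_eq_integral => //.
  - by apply/measurable_EFinP; exact: measurable_funS mk.
  - by apply/measurable_EFinP; apply: measurable_funS (subsetT _) _ => //; apply: measurable_funM => //; exact: measurableT_comp.
  exists (N `|` [set 1]); split.
  - by apply: measurableU => //; exact: measurable_set1.
  - by rewrite measureU0//; exact: lebesgue_measure_set1.
  move=> t /= ht; apply: contrapT => /not_orP[tN t1]; apply: ht; rewrite in_itv/= => /andP[t0 t1'].
  rewrite /k mem_set//; split => //; rewrite /= in_itv/= t0 lt_neqAle t1' andbT.
  exact/eqP.
have <- : f 1 - f 0 = dotv z nu - dotv y nu.
  by rewrite /f /G !clamp_id ?lexx ?ler01// g0 g1.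
have mD : measurable (`]0, 1]%classic : set (measurableTypeR R)) by [].
have ig1 : la.-integrable `]0, 1]%classic (EFin \o g) by exact: integrableS ig.
have mg1 : measurable_fun (`]0, 1]%classic : set (measurableTypeR R)) (EFin \o g) by case/integrableP: ig1.
rewrite fg ?ler01 ?lexx// EFinM.
under [leRHS]eq_integral do rewrite EFinM.
rewrite ge0_integralZl//; last by apply/measurable_EFinP; apply: measurableT_comp => //; exact/measurable_EFinP.
apply: lee_wpmul2l; first by rewrite lee_fin sqrtr_ge0.
rewrite -abse_EFin; apply: le_trans (le_abse_integral la mD mg1).
by rewrite -[X in (_ <= `|X|)%E]fineK//; exact: integrable_fin_num ig1.
Qed.

Definition plane_dist (nu y : E) : \bar R :=
  ereal_inf [set dist_sqrt a y z | z in hyperplane nu].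

Lemma dist_ge0 y z : (0 <= dist_sqrt a y z)%E.
Proof. by apply: le_ereal_inf_tmp => _ [gamma _ <-]; exact: curve_length_ge0. Qed.

(** A segment from [y] to [y'] is prepended to an arbitrary curve from [y'] to the hyperplane. *)
Lemma plane_dist_triangle nu y y' :
  (plane_dist nu y <= (Num.sqrt Theta * enorm (y - y'))%:E + plane_dist nu y')%E.
Proof.
rewrite -leeBlDl//; apply: le_ereal_inf_tmp => _ [z hz <-].
apply: le_ereal_inf_tmp => _ [gamma hg <-]; rewrite leeBlDl//.
apply: le_trans (concat_length y y' gamma).
apply: ereal_inf_le; exists (dist_sqrt a y z); first by exists z.
apply: ereal_inf_lbound; eexists; last by [].
exact: concat_lipschitz hg.
Qed.

Lemma plane_dist_on nu y : dotv y nu = 0 -> plane_dist nu y = 0%E.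
Proof.
move=> y0; apply/eqP; rewrite eq_le; apply/andP; split; last first.
  by apply: le_ereal_inf_tmp => _ [z _ <-]; exact: dist_ge0.
apply: ereal_inf_le; exists (dist_sqrt a y y); first by exists y.
apply: ereal_inf_le; exists (curve_length a (cst y)).
  exists (cst y) => //; split => //; apply/lipschitz01P; exists 0 => // s t _ _.
  by rewrite subrr normr0 mul0r.
rewrite /curve_length; under eq_integral do rewrite derive1_cst enorm0 mulr0.
by rewrite integral0.
Qed.

Variables (nu : E) (nu1 : enorm nu = 1).

Lemma plane_dist_ge y : ((Num.sqrt theta * `|dotv y nu|)%:E <= plane_dist nu y)%E.
Proof.
apply: le_ereal_inf_tmp => _ [z hz <-]; apply: le_ereal_inf_tmp => _ [gamma hg <-].
by have := length_ge nu1 hg; rewrite (_ : dotv z nu = 0)// sub0r normrN.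
Qed.

(** The comparison point is the orthogonal projection of [y] on the hyperplane. *)
Lemma plane_dist_le y : (plane_dist nu y <= (Num.sqrt Theta * `|dotv y nu|)%:E)%E.
Proof.
have := plane_dist_triangle nu y (y - dotv y nu *: nu).
rewrite (@plane_dist_on nu (y - _)) ?adde0; last first.
  by rewrite dotvBl dotvZl -enorm_sqr nu1 expr1n mulr1 subrr.
by rewrite opprB addrC subrK enormZ nu1 mulr1.
Qed.

Lemma plane_dist_fin y : plane_dist nu y \is a fin_num.
Proof.
rewrite ge0_fin_numE; first exact: le_lt_trans (plane_dist_le y) (ltry _).
by apply: le_trans (plane_dist_ge y); rewrite lee_fin mulr_ge0 ?sqrtr_ge0.
Qed.

Let D y := fine (plane_dist nu y).
Let hD y : signed_dist a nu y = Num.sg (dotv y nu) * D y. Proof. by []. Qed.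
Let DE y : plane_dist nu y = (D y)%:E. Proof. by rewrite /D fineK// plane_dist_fin. Qed.
Let D_le y : D y <= Num.sqrt Theta * `|dotv y nu|.
Proof. by rewrite -lee_fin -DE plane_dist_le. Qed.
Let D_ge y : Num.sqrt theta * `|dotv y nu| <= D y.
Proof. by rewrite -lee_fin -DE plane_dist_ge. Qed.
Let D_tri y y' : D y <= Num.sqrt Theta * enorm (y - y') + D y'.
Proof. by rewrite -lee_fin EFinD -!DE plane_dist_triangle. Qed.
Let D0 y : 0 <= D y.
Proof. by apply: le_trans (D_ge y); rewrite mulr_ge0 ?sqrtr_ge0. Qed.

Lemma signed_dist_ge y : Num.sqrt theta * `|dotv y nu| <= `|signed_dist a nu y|.
Proof.
rewrite hD normrM normr_sg; have [->|y0] := eqVneq (dotv y nu) 0.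
  by rewrite normr0 mulr0 mul0r.
by rewrite mul1r (ger0_norm (D0 y)).
Qed.

Lemma signed_dist_sg y : signed_dist a nu y = Num.sg (dotv y nu) * `|signed_dist a nu y|.
Proof.
rewrite hD normrM normr_sg mulrA (ger0_norm (D0 y)).
by have [->|_] := eqVneq (dotv y nu) 0; rewrite ?sgr0 ?mulr1 ?mul0r.
Qed.

(** On one side of the hyperplane this is the triangle inequality. For points on opposite sides the
    two distances add up, but so do the heights [|dotv y nu|] and [|dotv y' nu|], whose sum is
    [|dotv (y - y') nu|]; the constant is therefore not doubled. *)
Lemma signed_dist_lip : lip (Num.sqrt Theta) (signed_dist a nu).
Proof.
have same y y' : `|D y - D y'| <= Num.sqrt Theta * enorm (y - y').
  rewrite ler_norml; apply/andP; split.
    by have := D_tri y' y; rewrite enorm_distC; lra.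
  by have := D_tri y y'; lra.
have opp y y' : dotv y nu < 0 -> 0 < dotv y' nu ->
    D y + D y' <= Num.sqrt Theta * enorm (y - y').
  move=> y0 y'0; apply: (le_trans (lerD (D_le y) (D_le y'))).
  rewrite -mulrDr ler_wpM2l ?sqrtr_ge0// (ltr0_norm y0) (gtr0_norm y'0).
  apply: (@le_trans _ _ `|dotv (y - y') nu|).
    by rewrite dotvBl distrC addrC ler_norm.
  by rewrite (le_trans (cauchy_schwarz _ _))// nu1 mulr1.
have zero y : dotv y nu = 0 -> D y = 0.
  by move=> y0; apply/eqP; rewrite eq_le D0 andbT (le_trans (D_le y))// y0 normr0 mulr0.
move=> y y'; rewrite !hD; have := same y y'.
case: (sgrP (dotv y nu)) => [y0|y0|y0]; case: (sgrP (dotv y' nu)) => [y'0|y'0|y'0];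
  rewrite ?mul0r ?mul1r ?mulN1r ?subr0 ?sub0r ?normrN ?(zero _ y0) ?(zero _ y'0) ?sub0r ?subr0 ?normrN ?normr0//.
- by move=> _; rewrite opprK ger0_norm ?addr_ge0// addrC enorm_distC opp.
- by move=> _; rewrite -opprD normrN ger0_norm ?addr_ge0// opp.
- by rewrite -opprD normrN.
Qed.

End distance.

(** * The planar profile *)

Section profile.
Context {R : realType}.
Implicit Types x z : R.

Lemma expR_sum_gt0 x : 0 < expR x + expR (- x).
Proof. by rewrite addr_gt0// expR_gt0. Qed.

Lemma onem_tanh_sqr x : 1 - tanh x ^+ 2 = 4 / (expR x + expR (- x)) ^+ 2.
Proof.
have e0 : expR x + expR (- x) != 0 by rewrite gt_eqF// expR_sum_gt0.
have e1 : expR x * expR (- x) = 1 by rewrite -expRD subrr expR0.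
rewrite /tanh; apply: (@mulIf _ ((expR x + expR (- x)) ^+ 2)); first by rewrite expf_neq0.
rewrite divfK ?expf_neq0// mulrBl mul1r expr_div_n divfK ?expf_neq0//.
transitivity (4 * (expR x * expR (- x))); first by ring.
by rewrite e1 mulr1.
Qed.

Lemma onem_tanh_sqr_gt0 x : 0 < 1 - tanh x ^+ 2.
Proof. by rewrite onem_tanh_sqr divr_gt0// exprn_gt0// expR_sum_gt0. Qed.

(** The sum of the exponentials is at least [expR |x|], hence at least [1 + |x|]; quadratic decay is
    all that summation over slabs requires. *)
Lemma onem_tanh_sqr_le x : 1 - tanh x ^+ 2 <= 4 / (1 + `|x|) ^+ 2.
Proof.
have x0 : 0 < 1 + `|x| by rewrite ltr_pwDl.
rewrite onem_tanh_sqr ler_pM2l// lef_pV2 ?posrE ?exprn_gt0 ?expR_sum_gt0//.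
rewrite lerXn2r ?nnegrE ?(ltW x0) ?(ltW (expR_sum_gt0 _))//.
apply: (le_trans (expR_ge1Dx `|x|)).
by case: (ger0P x) => _; rewrite ?lerDl ?lerDr expR_ge0.
Qed.

Lemma tanh_is_derive x : is_derive x 1 (tanh : R -> R) (1 - tanh x ^+ 2).
Proof.
have e0 : expR x + expR (- x) != 0 by rewrite gt_eqF// expR_sum_gt0.
have dE := is_derive_expR x.
have dN : is_derive x 1 (fun z : R => expR (- z)) (- expR (- x)).
  have d1 : is_derive x (1 : R) (-%R) (-1 : R) by exact: is_deriveN.
  have := is_derive1_comp (is_derive_expR (- x)) d1; rewrite mulrN1; exact.
have dn := is_deriveB dE dN.
have ds := is_deriveD dE dN.
have dV := @is_deriveV R (fun z : R => expR z + expR (- z)) x _ 1 e0 ds.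
have := is_deriveM dn dV; rewrite [X in is_derive _ _ X _](_ : _ = tanh)// => D.
apply: is_derive_eq D _.
rewrite /GRing.scale/= opprK /tanh.
rewrite [(expR - _) x](_ : _ = expR x - expR (- x))//.
by clear -e0; move: (expR x) (expR (- x)) e0 => A B e0; field.
Qed.

(** This is equipartition of energy: half the square of the derivative is [W (q z)]. *)
Lemma q_is_derive z : is_derive z 1 (q : R -> R) (Num.sqrt 2 * (1 - q z ^+ 2)).
Proof.
have d1 : is_derive z 1 (fun z : R => Num.sqrt 2 * z) (Num.sqrt 2).
  by apply: is_derive_eq; rewrite ?[_ *: _]mulr1.
have -> : (q : R -> R) = tanh \o (fun z : R => Num.sqrt 2 * z) by apply/funext.
have D := is_derive1_comp (tanh_is_derive (Num.sqrt 2 * z)) d1.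
by rewrite [Num.sqrt 2 * (_ - _)]mulrC; exact: D.
Qed.

Lemma onem_q_sqr_gt0 z : 0 < 1 - q z ^+ 2.
Proof. exact: onem_tanh_sqr_gt0. Qed.

Lemma onem_q_sqr_le1 z : 1 - q z ^+ 2 <= 1.
Proof. by rewrite gerBl sqr_ge0. Qed.

Lemma onem_q_sqr_le z : 1 - q z ^+ 2 <= 4 / (1 + Num.sqrt 2 * `|z|) ^+ 2.
Proof.
by apply: (le_trans (onem_tanh_sqr_le _)); rewrite normrM (ger0_norm (sqrtr_ge0 _)).
Qed.

Lemma q_lt1 z : `|q z| < 1.
Proof.
by rewrite -(ltr_pXn2r (n := 2))// ?nnegrE// real_normK ?num_real// expr1n -subr_gt0 onem_q_sqr_gt0.
Qed.

Lemma q_lip s t : `|q s - q t| <= Num.sqrt 2 * `|s - t| :> R.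
Proof.
wlog st : s t / t <= s.
  move=> H; case: (leP t s) => ts; first exact: H.
  by rewrite distrC [`|s - t|]distrC H// ltW.
have dq (x : R) : x \in `]t, s[ -> is_derive x 1 (q : R -> R) (Num.sqrt 2 * (1 - q x ^+ 2)).
  by move=> _; exact: q_is_derive.
have cq : {within `[t, s], continuous (q : R -> R)}.
  apply: continuous_subspaceT => x; apply: differentiable_continuous.
  by apply/derivable1_diffP; have [] := q_is_derive x.
have [c _ ->] := MVT_segment st dq cq.
rewrite normrM ler_wpM2r// ger0_norm; first by rewrite ger_pMr ?sqrtr_gt0// onem_q_sqr_le1.
by rewrite mulr_ge0 ?sqrtr_ge0// ltW// onem_q_sqr_gt0.
Qed.

Lemma q_ge0 z : 0 <= z -> 0 <= q z.
Proof.
move=> z0; rewrite /q /tanh divr_ge0 ?(ltW (expR_sum_gt0 _))// subr_ge0 ler_expR.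
by rewrite ge0_cp// mulr_ge0 ?sqrtr_ge0.
Qed.

Lemma qN z : q (- z) = - q z.
Proof.
rewrite /q mulrN /tanh opprK [expR (- _) + _]addrC; set A := expR _; set B := expR _.
by rewrite -[in RHS]mulNr opprB [B + A]addrC [- A + B]addrC.
Qed.

(** By oddness take [s = 1], so that [q z] lies in [0, 1]; the right side is then [1 - q z] times
    [1 + q z], a factor at least 1. *)
Lemma q_sg_le z (s : R) : `|s| = 1 -> z = s * `|z| -> `|q z - s| <= 1 - q z ^+ 2.
Proof.
have key (y : R) : 0 <= y -> `|q y - 1| <= 1 - q y ^+ 2.
  move=> y0; have := q_ge0 y0; have := q_lt1 y => /ltr_normlP[_ q1] q0.
  rewrite distrC ger0_norm ?subr_ge0 ?(ltW q1)//.
  by move: (q y) q1 q0 => t t1 t0; nra.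
move=> /eqP; rewrite eqr_norml ler01 andbT => /orP[] /eqP ->.
  by rewrite mul1r => ->; exact: key.
rewrite mulN1r => ->; rewrite qN sqrrN opprK addrC distrC.
by have := key _ (normr_ge0 z); rewrite distrC.
Qed.

End profile.

Section planar.
Context {R : realType} {n : nat}.
Local Notation E := 'rV[R]_n.
Local Notation mu := (@lebesgue_rV R n).

Lemma partial_comp (p : R -> R) (dp : R) (f : E -> R) i x :
  is_derive (f x) 1 p dp -> derivable f x (basis_vec i) ->
  derivable (fun y => p (f y)) x (basis_vec i) /\
  partial i (fun y => p (f y)) x = dp * partial i f x.
Proof.
set e := basis_vec i => hp df.
have x0 : x + 0 *: e = x by rewrite scale0r addr0.
pose L s := f (x + s *: e).
have dL : derivable L 0 1 by apply/derivable_line; rewrite x0.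
have hL : is_derive (0 : R) 1 L (partial i f x).
  by split => //; rewrite -derive_line x0.
have hp' : is_derive (L 0) 1 p dp by rewrite /L x0.
have [dpL hpL] := is_derive1_comp hp' hL.
split; first by rewrite -[x in derivable _ x _]x0; apply/derivable_line.
by rewrite /partial -[X in 'D_e _ X = _]x0 derive_line.
Qed.

Variables (a : E -> R) (theta Theta : R) (theta0 : 0 < theta)
  (a_bnd : forall x, theta <= a x <= Theta) (nu : E) (nu1 : enorm nu = 1).
Let u := planar_profile a nu.
Let h := signed_dist a nu.
Let hlip : lip (Num.sqrt Theta) h. Proof. exact: (signed_dist_lip a_bnd nu1). Qed.

(* Dominates 1 - u^2, with k = sqrt (2 theta), and is summable over the slabs
   k <= |y.nu| < k + 1. *)
Definition decay (k t : R) : R := (1 + k * `|t|)^-1 ^+ 2.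

Lemma planar_lt1 x : `|u x| < 1. Proof. exact: q_lt1. Qed.

Lemma planar_lip : lip (Num.sqrt 2 * Num.sqrt Theta) u.
Proof.
move=> x y; apply: (le_trans (q_lip _ _)); rewrite -mulrA ler_wpM2l ?sqrtr_ge0//.
Qed.

Lemma onem_planar_sqr_gt0 x : 0 < 1 - u x ^+ 2.
Proof. exact: onem_q_sqr_gt0. Qed.

Lemma onem_planar_sqr_le x : 1 - u x ^+ 2 <= 4 * decay (Num.sqrt (2 * theta)) (dotv x nu).
Proof.
apply: (le_trans (onem_q_sqr_le _)); rewrite ler_pM2l// /decay exprVn.
have p0 (c : R) : 0 <= c -> 0 < 1 + c by move=> c0; rewrite ltr_pwDl.
rewrite lef_pV2 ?posrE ?exprn_gt0 ?p0 ?mulr_ge0 ?sqrtr_ge0//.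
rewrite lerXn2r ?nnegrE ?(ltW (p0 _ _)) ?mulr_ge0 ?sqrtr_ge0// lerD2l sqrtrM//.
by rewrite -mulrA ler_wpM2l ?sqrtr_ge0//; exact: (signed_dist_ge a_bnd nu1).
Qed.

Lemma planar_sg_le x : dotv x nu != 0 -> `|u x - Num.sg (dotv x nu)| <= 1 - u x ^+ 2.
Proof.
move=> x0; apply: q_sg_le; first by rewrite normr_sg x0.
exact: (signed_dist_sg a_bnd nu1).
Qed.

Lemma planar_grad_ae : {ae mu, forall x,
  enorm (grad u x) <= Num.sqrt 2 * Num.sqrt Theta * (1 - u x ^+ 2)}.
Proof.
have FF := ae_filter_ringOfSetsType mu.
have aed : {ae mu, forall x, forall i, derivable h x (basis_vec i)}.
  by apply: filter_forall => i; exact: lip_ae_derivable hlip.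
apply: filterS2 aed (grad_le_ae hlip) => x dh gh.
have -> : grad u x = (Num.sqrt 2 * (1 - u x ^+ 2)) *: grad h x.
  apply/rowP => i; rewrite !mxE.
  exact: (partial_comp (q_is_derive (h x)) (dh i)).2.
rewrite enormZ ger0_norm; last by rewrite mulr_ge0 ?sqrtr_ge0// ltW// onem_planar_sqr_gt0.
rewrite mulrAC ler_wpM2r ?(ltW (onem_planar_sqr_gt0 x))// ler_wpM2l ?sqrtr_ge0//.
by rewrite (le_trans gh)// ger0_norm ?sqrtr_ge0.
Qed.

(** Both terms are at most [Theta] times the square of [1 - u^2], which is at most [1 - u^2], itself
    at most 4 times the decay; this is the origin of 8. *)
Lemma planar_density_ae : {ae mu, forall x,
  a x * W (u x) + 2^-1 * enorm (grad u x) ^+ 2 <=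
  8 * Theta * decay (Num.sqrt (2 * theta)) (dotv x nu)}.
Proof.
have FF := ae_filter_ringOfSetsType mu.
apply: filterS planar_grad_ae => x gx; have /andP[ta aT] := a_bnd x.
have T0 : 0 <= Theta by exact: le_trans (le_trans (ltW theta0) ta) aT.
have u0 := onem_planar_sqr_gt0 x.
have u1 : (1 - u x ^+ 2) ^+ 2 <= 1 - u x ^+ 2.
  by rewrite expr2 ger_pMr// onem_q_sqr_le1.
have h1 : a x * W (u x) <= Theta * (1 - u x ^+ 2) by apply: ler_pM => //; [exact: le_trans (ltW theta0) ta|exact: sqr_ge0].
have h2 : 2^-1 * enorm (grad u x) ^+ 2 <= Theta * (1 - u x ^+ 2).
  rewrite ler_pdivrMl//.
  apply: (@le_trans _ _ ((Num.sqrt 2 * Num.sqrt Theta * (1 - u x ^+ 2)) ^+ 2)).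
    by rewrite lerXn2r ?nnegrE ?enorm_ge0// !mulr_ge0 ?sqrtr_ge0// ltW.
  move: (1 - u x ^+ 2) u1 => v v1.
  rewrite !exprMn (sqr_sqrtr T0) sqr_sqrtr ?ler0n// -mulrA ler_wpM2l ?ler0n//.
  by rewrite ler_wpM2l.
apply: (le_trans (lerD h1 h2)); rewrite -mulrDr.
have := onem_planar_sqr_le x; move: (decay _ _) (1 - _) => d v vd.
rewrite [8 * _]mulrC -mulrA ler_wpM2l//; lra.
Qed.

End planar.

(** * Integrals over slabs and collars *)

Section decay_integral.
Context {R : realType} d (T : measurableType d) (m : {measure set T -> \bar R}).
Variables (k : R) (k0 : 0 < k).

Lemma decay_ge0 t : 0 <= decay k t.
Proof. exact: sqr_ge0. Qed.

Lemma decay_gt0 (t : R) : 0 < 1 + k * `|t|.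
Proof. by rewrite ltr_pwDl// mulr_ge0// ltW. Qed.

Lemma decay_anti (s t : R) : `|s| <= `|t| -> decay k t <= decay k s.
Proof.
move=> st; rewrite /decay lerXn2r ?nnegrE ?invr_ge0 ?(ltW (decay_gt0 _))//.
by rewrite lef_pV2 ?posrE ?decay_gt0// lerD2l ler_pM2l.
Qed.

(** One power is given up; the other supplies the factor [T^-1] on the faces of the collar parallel
    to the hyperplane. *)
Lemma decay_le (t : R) : 0 < t -> decay k t <= (k * t)^-1.
Proof.
move=> t0; have p := decay_gt0 t; rewrite /decay (gtr0_norm t0) in p *.
apply: (@le_trans _ _ (1 + k * t)^-1).
  rewrite expr2 ger_pMr ?invr_gt0// invf_le1// lerDl mulr_ge0// ltW//.
by rewrite lef_pV2 ?posrE ?mulr_gt0// lerDr.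
Qed.

Lemma measurable_decay (z : T -> R) : measurable_fun setT z ->
  measurable_fun setT (fun y => decay k (z y)).
Proof.
move=> mz; apply: measurable_funX.
apply: (@measurableT_comp _ _ _ _ _ _ (fun t : R => (1 + k * `|t|)^-1)) => //.
have c : continuous (fun t : R => (1 + k * `|t|)^-1).
  move=> t; apply: cvgV; first by rewrite gt_eqF// decay_gt0.
  apply: cvgD; first exact: cvg_cst.
  by apply: cvgM; [exact: cvg_cst|exact: norm_continuous].
exact: continuous_measurable_fun.
Qed.

(** The sum telescopes: with [p = 1 + k * j], the next term is at most the inverse of [p * (p + k)],
    which equals [k^-1 / p - k^-1 / (p + k)]. *)
Lemma sum_decay M : \sum_(j < M) decay k j%:R <= 1 + k^-1.
Proof.
have h j : \sum_(i < j.+1) decay k i%:R <= 1 + k^-1 - k^-1 * (1 + k * j%:R)^-1.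
  elim: j => [|j IH].
    rewrite big_ord1 /decay normr0 mulr0 addr0 invr1 expr1n mulr1 -addrA subrr addr0//.
  rewrite big_ord_recr/=; apply: (le_trans (lerD IH (lexx _))).
  have pj : 0 < 1 + k * j%:R by have := decay_gt0 j%:R; rewrite normr_nat.
  rewrite /decay normr_nat -addn1 natrD mulrDr mulr1 addrA.
  move: (1 + _) pj => p p0; have p1 : 0 < p + k by rewrite addr_gt0.
  have : (p + k)^-1 ^+ 2 <= k^-1 / p - k^-1 / (p + k).
    rewrite (_ : _ - _ = p^-1 * (p + k)^-1); last by field; rewrite !gt_eqF.
    by rewrite expr2 ler_wpM2r ?invr_ge0 ?(ltW p1)// lef_pV2 ?posrE// lerDl ltW.
  by move: (k^-1 / p) (k^-1 / (p + k)) k^-1 (_ ^+ 2) => x y z t; lra.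
case: M => [|M]; first by rewrite big_ord0 addr_ge0// invr_ge0 ltW.
apply: (le_trans (h M)); rewrite gerBl mulr_ge0// invr_ge0 ?(ltW k0)//.
by have := decay_gt0 M%:R; rewrite normr_nat => /ltW.
Qed.

(** [M] only makes the number of slabs meeting [D] finite; the bound does not depend on it. [c]
    bounds the measure of each slab. *)
Lemma integral_decay_le (D : set T) (z : T -> R) (M : nat) (c : R) : measurable D ->
  measurable_fun setT z -> 0 <= c -> (forall y, D y -> `|z y| < M%:R) ->
  (forall j, (m (D `&` [set y | (j%:R <= `|z y| < j.+1%:R)%R]) <= c%:E)%E) ->
  (\int[m]_(y in D) (decay k (z y))%:E <= ((1 + k^-1) * c)%:E)%E.
Proof.
move=> mD mz c0 zM hc.
pose S (j : nat) : set T := [set y | j%:R <= `|z y| < j.+1%:R].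
have maz : measurable_fun setT (fun y => `|z y|) by exact: measurableT_comp.
have mS j : measurable (S j).
  rewrite (_ : S j = (fun y => `|z y|) @^-1` `[j%:R, j.+1%:R[%classic).
    by apply: measurable_preimageT maz _; exact: measurable_itv.
  by apply/seteqP; split=> y; rewrite /= in_itv.
have mdS j : measurable_fun D (fun y => (decay k j%:R * \1_(S j) y)%:E).
  by apply/measurable_EFinP; apply: measurable_funM => //; exact: measurable_indic.
apply: (@le_trans _ _ (\int[m]_(y in D) (\sum_(j < M) (decay k j%:R * \1_(S j) y)%:E))%E).
  apply: le_integral_ge0 => y Dy; first by rewrite lee_fin decay_ge0.
  have /andP[t1 t2] := Num.Theory.truncn_itv (normr_ge0 (z y)).
  set j := Num.truncn `|z y| in t1 t2.
  have jM : (j < M)%N by rewrite -(ltr_nat R) (le_lt_trans t1)// zM.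
  rewrite (bigD1 (Ordinal jM))//= sumEFin -EFinD lee_fin.
  rewrite indicE mem_set /S/= ?t1 ?t2// mulr1 (le_trans (decay_anti (s := j%:R) _)) ?normr_nat//.
  by rewrite lerDl sumr_ge0// => i _; rewrite mulr_ge0 ?decay_ge0// indicE.
rewrite ge0_integral_sum//; last by move=> j y _; rewrite lee_fin mulr_ge0 ?decay_ge0// indicE.
apply: (@le_trans _ _ (\sum_(j < M) (decay k j%:R * c)%:E)%E).
  apply: lee_sum => j _; under eq_integral do rewrite EFinM.
  have i0 y : D y -> (0 <= (\1_(S j) y)%:E :> \bar R)%E by move=> _; rewrite lee_fin indicE.
  have mi : measurable_fun D (fun y => (\1_(S j) y)%:E : \bar R).
    by apply/measurable_EFinP; exact: measurable_indic.
  rewrite (ge0_integralZl_EFin m mD i0 mi (decay_ge0 _)).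
  rewrite integral_indic// [leRHS]EFinM; apply: lee_wpmul2l; first by rewrite lee_fin decay_ge0.
  by rewrite setIC; exact: hc.
rewrite sumEFin lee_fin -mulr_suml ler_wpM2r//; exact: sum_decay.
Qed.

End decay_integral.

Section slabs.
Context {R : realType} {n : nat}.
Local Notation E := 'rV[R]_n.
Local Notation mu := (@lebesgue_rV R n).
Local Notation la := (@lebesgue_measure R).
Variables (B : 'M[R]_n) (BBT : B *m B^T = 1%:M).

Definition annulus (l m : R) : set (measurableTypeR R) := [set t | l <= `|t| < m].

Lemma measurable_annulus l m : measurable (annulus l m).
Proof.
rewrite (_ : annulus l m = (fun t : R => `|t|) @^-1` `[l, m[%classic).
  apply: measurable_preimageT; last exact: measurable_itv.
  exact: (continuous_measurable_fun (@norm_continuous _ R^o)).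
by apply/seteqP; split=> y; rewrite /= in_itv.
Qed.

Lemma annulus_le l m : l <= m -> (la (annulus l m) <= (2 * (m - l))%:E)%E.
Proof.
move=> lm; have len (c d : R) : c <= d -> la `[c, d]%classic = (d - c)%:E.
  move=> cd; apply: (eq_trans (lebesgue_measure_itv _)); rewrite /= lte_fin.
  by case: ltgtP cd => // -> _; rewrite subrr.
apply: (@le_trans _ _ (la (`[l, m]%classic `|` `[- m, - l]%classic))).
  apply: le_measure; rewrite ?inE.
  - exact: measurable_annulus.
  - by apply: measurableU; exact: measurable_itv.
  move=> t /= /andP[lt tm]; rewrite !in_itv/=; case: (ger0P t) lt tm => t0 lt tm.
    by left; rewrite lt ltW.
  by right; apply/andP; split; lra.
apply: (le_trans (@measureU2 _ _ _ la _ _ (measurable_itv _) (measurable_itv _))).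
apply: (@le_trans _ _ ((m - l)%:E + (- l - - m)%:E)%E).
  by apply: leeD; rewrite le_eqVlt; apply/orP; left; apply/eqP; apply: len; rewrite ?lerN2.
rewrite -EFinD lee_fin; lra.
Qed.

(** Bounding absolute values of coordinates from both sides describes at once the slabs around the
    hyperplane and the pairs of opposite layers of the collar. *)
Definition rotated_box (l m : 'I_n -> R) : set E :=
  [set y | forall i, annulus (l i) (m i) ((y *m B^T) ord0 i)].

Let box_measurable l m : measurable [set x : E | forall i, annulus (l i) (m i) (x ord0 i)].
Proof.
rewrite (_ : [set _ | _] = \bigcap_(i in [set` index_enum 'I_n])
    ((fun x : E => x ord0 i) @^-1` annulus (l i) (m i))).
  rewrite bigcap_seq; apply: bigsetI_measurable => i _.
  exact: measurable_preimageT (measurable_rV_coord i) (measurable_annulus _ _).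
apply/seteqP; split=> [x xA i _|x xA i]; first exact: xA.
by apply: xA; rewrite /= mem_index_enum.
Qed.

Lemma measurable_rotated_box l m : measurable (rotated_box l m).
Proof. exact: measurable_preimageT (measurable_mulmx B^T) (box_measurable l m). Qed.

(** Orthogonal invariance reduces the measure to a product over the coordinates; the factors 2 count
    the two intervals of each [annulus]. *)
Lemma rotated_box_le l m : (forall i, l i <= m i) ->
  (mu (rotated_box l m) <= (\prod_(i < n) (2 * (m i - l i)))%:E)%E.
Proof.
move=> lm; have [_ h] := mpres_orthogonal (trmx_orthogonal BBT).
rewrite /rotated_box (h _ (box_measurable l m)).
rewrite (lebesgue_rV_box (A := fun i => annulus (l i) (m i))); last first.
  by move=> i; exact: measurable_annulus.
have [] : (0 <= \prod_(i < n) la (annulus (l i) (m i)) /\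
  \prod_(i < n) la (annulus (l i) (m i)) <= (\prod_(i < n) (2 * (m i - l i)))%:E)%E; last by [].
apply: (big_ind2 (fun x (y : R) => 0 <= x /\ x <= y%:E)%E).
- by rewrite lee01 lexx.
- move=> x1 x2 y1 y2 [h1 h2] [h3 h4]; rewrite mule_ge0// EFinM lee_pmul//.
- by move=> i _; rewrite measure_ge0 annulus_le.
Qed.

Variables (i0 : 'I_n) (k : R) (k0 : 0 < k).
Let nu := row i0 B.

Lemma coord_lt_cube T y i : cube B T y -> `|(y *m B^T) ord0 i| < T / 2.
Proof. by move=> yT; exact: le_lt_trans (coord_le_norm _ i) yT. Qed.

Lemma prod_except (c x : R) : \prod_(i < n) (if i == i0 then c else x) = c * x ^+ n.-1.
Proof.
rewrite (bigD1 i0)//= eqxx; congr (_ * _).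
rewrite (eq_bigr (fun=> x)); last by move=> i /negbTE ->.
by rewrite prodr_const cardC1 card_ord.
Qed.

Lemma prod_except2 (j : 'I_n) (c c' x : R) : j != i0 ->
  \prod_(i < n) (if i == i0 then c else if i == j then c' else x) = c * (c' * x ^+ n.-2).
Proof.
move=> ji; rewrite (bigD1 i0)//= eqxx (bigD1 j)//= (negbTE ji) eqxx; congr (_ * (_ * _)).
rewrite (eq_bigr (fun=> x)); last by move=> i /andP[/negbTE -> /negbTE ->].
rewrite prodr_const; congr (_ ^+ _).
have := cardC (pred2 i0 j); rewrite card2 card_ord eq_sym ji/= => h.
transitivity #|[predC pred2 i0 j]|; last by rewrite -[in RHS]h.
by apply: eq_card => i; rewrite !inE negb_or.
Qed.

Let mz : measurable_fun setT (fun y : E => dotv y nu).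
Proof. by apply: continuous_measurable_rV; exact: lip_continuous (dotv_lip nu). Qed.

Let cube_bnd T y : cube B T y -> `|dotv y nu| < (Num.truncn T).+1%:R.
Proof.
move=> yT; rewrite /nu dotv_row; apply: (lt_trans (coord_lt_cube i0 yT)).
have T0 : 0 < T by have := le_lt_trans (normr_ge0 _) (coord_lt_cube i0 yT); lra.
by apply: lt_trans (truncnS_gt T); lra.
Qed.

(** A slab [j <= |y.nu| < j + 1] meets the cube in two layers of thickness 1 and cross-section at
    most [T ^+ n.-1]. *)
Lemma cube_decay_le T : 0 < T ->
  (\int[mu]_(y in cube B T) (decay k (dotv y nu))%:E <=
   ((1 + k^-1) * (2 * T ^+ n.-1))%:E)%E.
Proof.
move=> T0; apply: (integral_decay_le k0 _ mz _ (@cube_bnd T)).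
- exact: measurable_cube.
- by rewrite mulr_ge0// exprn_ge0// ltW.
move=> j.
pose l i : R := if i == i0 then j%:R else 0; pose m i : R := if i == i0 then j.+1%:R else T / 2.
apply: (@le_trans _ _ (mu (rotated_box l m))).
  apply: le_measure; rewrite ?inE.
  - apply: measurableI; first exact: measurable_cube.
    rewrite (_ : [set _ | _] = (fun y : E => dotv y nu) @^-1` annulus j%:R j.+1%:R)//.
    exact: measurable_preimageT mz (measurable_annulus _ _).
  - exact: measurable_rotated_box.
  move=> y [yT jy] i; rewrite /annulus/= /l /m; case: ifPn => [/eqP ->|_].
    by move: jy; rewrite /= /nu dotv_row.
  by rewrite normr_ge0 coord_lt_cube.
apply: (le_trans (rotated_box_le _)).
  by move=> i; rewrite /l /m; case: ifP => _; rewrite ?ler_nat// divr_ge0// ltW.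
rewrite lee_fin (eq_bigr (fun i => if i == i0 then 2 else T)); last first.
  move=> i _; rewrite /l /m; case: ifP => _; last by field.
  by rewrite -natrB// subSnn mulr1.
by rewrite prod_except.
Qed.

(** The collar is covered by sets [Cj j] where the j-th coordinate in the frame [B] is at least
    [T / 2 - 2] in absolute value. For [j = i0] the decay is at most [4 / (k * T)] on a set of
    measure of order [T ^+ n.-1]. For other [j] each unit slab meets [Cj j] in measure at most
    [12 * (T + 2) ^+ n.-2], and the slabs are summable. The condition [8 <= T] yields
    [T / 4 <= T / 2 - 2] and [T + 2 <= 2 * T]. *)
Lemma collar_decay_cvg : exists2 C, 0 <= C & forall T, 8 <= T ->
  (\int[mu]_(y in cube B (T + 2) `\` cube B (T - 4)) (decay k (dotv y nu))%:E <=
   (C * T ^+ n.-1 / T)%:E)%E.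
Proof.
pose C1 : R := 6 * 2 ^+ n.-1 * (4 / k).
pose C2 : R := (1 + k^-1) * (12 * 2 ^+ n.-2).
have C10 : 0 <= C1 by rewrite !mulr_ge0 ?exprn_ge0 ?invr_ge0 ?(ltW k0).
have C20 : 0 <= C2 by rewrite !mulr_ge0 ?addr_ge0 ?exprn_ge0 ?invr_ge0 ?(ltW k0).
exists (C1 + n%:R * C2) => [|T T8]; first by rewrite addr_ge0// mulr_ge0.
have T0 : 0 < T by lra.
have S0 : 0 < T + 2 by lra.
pose Cj j : set E := cube B (T + 2) `&` [set y | T / 2 - 2 <= `|(y *m B^T) ord0 j|].
have mCj j : measurable (Cj j).
  apply: measurableI; first exact: measurable_cube.
  rewrite (_ : [set _ | _] = (fun y : E => (y *m B^T) ord0 j) @^-1` (~` annulus 0 (T / 2 - 2))).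
    apply: measurable_preimageT; last by apply: measurableC; exact: measurable_annulus.
    exact: (measurableT_comp (measurable_rV_coord j) (measurable_mulmx B^T)).
  apply/seteqP; split=> y; rewrite /annulus/= normr_ge0/= leNgt; first by move/negP.
  by move=> h; apply/negP.
pose f y := decay k (dotv y nu).
have mf : measurable_fun setT f by exact: measurable_decay.
have f0 y : 0 <= f y by exact: decay_ge0.
have hC j : (\int[mu]_(y in Cj j) (f y)%:E <=
    (if j == i0 then C1 * T ^+ n.-1 / T else C2 * T ^+ n.-1 / T)%:E)%E.
  (* Used when some [j] differs from [i0]: then [n] is at least 2 and the truncated predecessors are
     exact. *)
  have T2 i : n.-1 = i.+1 -> (T + 2) ^+ i <= 2 ^+ i * (T ^+ n.-1 / T).
    move=> ->; rewrite exprS mulrAC mulfV ?gt_eqF// mul1r -exprMn.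
    by rewrite lerXn2r ?nnegrE//; lra.
  have T1 : (T + 2) ^+ n.-1 <= 2 ^+ n.-1 * T ^+ n.-1.
    by rewrite -exprMn lerXn2r ?nnegrE//; lra.
  pose m (i : 'I_n) : R := (T + 2) / 2.
  case: ifPn => [/eqP ->|ji].
    pose l i : R := if i == i0 then T / 2 - 2 else 0.
    have sub : Cj i0 `<=` rotated_box l m.
      move=> y [yT yj] i; rewrite /annulus/= /l /m coord_lt_cube// andbT.
      by case: ifPn => [/eqP ->|].
    (* 6 counts two opposite layers of thickness 3, from [T / 2 - 2] to [(T + 2) / 2]. *)
    have hm : (mu (Cj i0) <= (6 * (T + 2) ^+ n.-1)%:E)%E.
      apply: (@le_trans _ _ (mu (rotated_box l m))).
        by apply: le_measure; rewrite ?inE//; exact: measurable_rotated_box.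
      apply: (le_trans (rotated_box_le _)); first by move=> i; rewrite /l /m; case: ifP => _; lra.
      rewrite lee_fin (eq_bigr (fun i => if i == i0 then 6 else T + 2)) ?prod_except//.
      by move=> i _; rewrite /l /m; case: ifP => _; field.
    apply: (@le_trans _ _ (\int[mu]_(y in Cj i0) (cst (4 / (k * T))%:E y))%E).
      apply: le_integral_ge0 => y [yT yj]; first by rewrite lee_fin; exact: f0.
      rewrite lee_fin /f.
      have T20 : 0 < T / 2 - 2 by lra.
      apply: (@le_trans _ _ (decay k (T / 2 - 2))).
        by apply: decay_anti => //; rewrite (gtr0_norm T20) /nu dotv_row.
      apply: (le_trans (decay_le k0 T20)).
      rewrite -[leLHS]mul1r ler_pdivrMr ?mulr_gt0// mulrAC ler_pdivlMr ?mulr_gt0//.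
      by rewrite mul1r mulrCA ler_pM2l//; lra.
    rewrite integral_cst//; apply: (@le_trans _ _ ((4 / (k * T))%:E * (6 * (T + 2) ^+ n.-1)%:E)%E).
      by apply: lee_wpmul2l => //; rewrite lee_fin divr_ge0 ?mulr_ge0 ?ltW.
    rewrite -EFinM lee_fin; apply: (@le_trans _ _ (4 / (k * T) * (6 * (2 ^+ n.-1 * T ^+ n.-1)))).
      by rewrite ler_wpM2l ?divr_ge0 ?mulr_ge0 ?(ltW k0) ?(ltW T0)// ler_pM2l.
    by rewrite /C1 le_eqVlt; apply/orP; left; apply/eqP; field; rewrite !gt_eqF.
  apply: (@le_trans _ _ ((1 + k^-1) * (12 * (T + 2) ^+ n.-2))%:E).
    apply: (integral_decay_le k0 (mCj j) mz) => //.
    - by rewrite mulr_ge0// exprn_ge0// ltW.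
    - by move=> y [yT _]; exact: cube_bnd yT.
    move=> p.
    pose l i : R := if i == i0 then p%:R else if i == j then T / 2 - 2 else 0.
    pose m' i : R := if i == i0 then p.+1%:R else (T + 2) / 2.
    apply: (@le_trans _ _ (mu (rotated_box l m'))).
      apply: le_measure; rewrite ?inE.
      - apply: measurableI => //.
        rewrite (_ : [set _ | _] = (fun y : E => dotv y nu) @^-1` annulus p%:R p.+1%:R)//.
        exact: measurable_preimageT mz (measurable_annulus _ _).
      - exact: measurable_rotated_box.
      move=> y [[yT yj] py] i; rewrite /annulus/= /l /m'; case: ifPn => [/eqP ->|_].
        by move: py; rewrite /= /nu dotv_row.
      by rewrite coord_lt_cube// andbT; case: ifPn => [/eqP ->|].
    apply: (le_trans (rotated_box_le _)).
      move=> i; rewrite /l /m'; case: ifP => _; first by rewrite ler_nat.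
      by case: ifP => _; lra.
    rewrite lee_fin (eq_bigr (fun i => if i == i0 then 2 else if i == j then 6 else T + 2)); last first.
      move=> i _; rewrite /l /m'; case: ifP => _; first by rewrite -natrB// subSnn mulr1.
      by case: ifP => _; field.
    by rewrite prod_except2// mulrA -natrM.
  rewrite lee_fin /C2 -!mulrA ler_wpM2l ?addr_ge0 ?invr_ge0 ?(ltW k0)// ler_wpM2l//.
  apply: T2; have := ltn_ord j; have := ltn_ord i0; move: ji; rewrite -val_eqE/=.
  by move: (nat_of_ord j) (nat_of_ord i0); lia.
apply: (@le_trans _ _ (\sum_(j < n) \int[mu]_(y in Cj j) (f y)%:E)%E).
  rewrite integral_mkcond; under eq_bigr do rewrite integral_mkcond.
  rewrite -ge0_integral_sum//; last 2 first.
  - by move=> j; apply/measurable_restrict => //; apply/measurable_EFinP; exact: measurable_funS mf.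
  - by move=> j y _; rewrite patchE; case: ifP => // _; rewrite lee_fin.
  apply: le_integral_ge0 => y _; rewrite patchE; case: ifPn => [/set_mem [yS yT]|_] //.
  - by rewrite lee_fin; exact: f0.
  - have [j hj] : exists j, T / 2 - 2 <= `|(y *m B^T) ord0 j|.
      apply: contrapT => /forallNP h; apply: yT; apply: rV_norm_lt; first lra.
      by move=> j; have /negP := h j; rewrite -ltNge; lra.
    rewrite (bigD1 j)//= patchE mem_set//= leeDl//.
    by apply: sume_ge0 => i _; rewrite patchE; case: ifP => // _; rewrite lee_fin.
  - by apply: sume_ge0 => i _; rewrite patchE; case: ifP => // _; rewrite lee_fin.
apply: (le_trans (lee_sum _ (fun j _ => hC j))).
rewrite sumEFin lee_fin.
have Tn : 0 <= T ^+ n.-1 / T by rewrite divr_ge0 ?exprn_ge0 ?ltW.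
apply: (@le_trans _ _ (\sum_(j < n) ((if j == i0 then C1 * T ^+ n.-1 / T else 0) + C2 * T ^+ n.-1 / T))).
  by apply: ler_sum => j _; case: ifP => _; rewrite ?add0r// lerDl -mulrA mulr_ge0.
rewrite big_split/= -big_mkcond/= big_pred1_eq sumr_const card_ord.
move: C1 C2 (T ^+ n.-1) T^-1 {Tn hC C10 C20} => C1 C2 x y.
by rewrite -[_ *+ n]mulr_natl le_eqVlt; apply/orP; left; apply/eqP; ring.
Qed.

End slabs.

(** * Gluing the planar profile to the boundary datum *)

Section partial_linear.
Context {R : realType} {n : nat}.
Local Notation E := 'rV[R]_n.

Lemma partialD (f g : E -> R) i x : derivable f x (basis_vec i) ->
  derivable g x (basis_vec i) ->
  partial i (fun y => f y + g y) x = partial i f x + partial i g x.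
Proof. exact: (@deriveD R E R f g). Qed.

Lemma partialB (f g : E -> R) i x : derivable f x (basis_vec i) ->
  derivable g x (basis_vec i) ->
  partial i (fun y => f y - g y) x = partial i f x - partial i g x.
Proof. exact: (@deriveB R E R f g). Qed.

End partial_linear.

Section interpolation.
Context {R : realType} {n : nat}.
Local Notation E := 'rV[R]_n.
Local Notation mu := (@lebesgue_rV R n).
Variables (B : 'M[R]_n) (BBT : B *m B^T = 1%:M) (u w : E -> R) (Ku L T : R).
Hypotheses (Ku0 : 0 <= Ku) (L0 : 0 <= L) (lu : lip Ku u) (lw : lip L w).
Hypotheses (u1 : forall x, `|u x| <= 1) (w1 : forall x, `|w x| <= 1)
  (dw : forall i x, derivable w x (basis_vec i)).

(** The transition ends at cube norm [T / 2 - 1], one unit inside the boundary, which leaves room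
    for the mollification. *)
Definition cutoff (y : E) : R := Num.min 1 (Num.max 0 (T / 2 - 1 - cnorm B y)).

Lemma cutoff01 y : 0 <= cutoff y <= 1.
Proof. by rewrite /cutoff le_min ler01 le_max lexx ge_min lexx. Qed.

Lemma cutoff_lip : lip 1 cutoff.
Proof.
move=> x y; apply: le_trans (cnorm_lip BBT x y); rewrite ler_norml /cutoff.
move: (cnorm B x) (cnorm B y) => c e; have h1 := ler_norm (c - e); have := ler_norm (e - c).
rewrite distrC => h2; move: `|c - e| h1 h2 => d h1 h2.
rewrite !minEle !maxEle; case: (leP 0 (T / 2 - 1 - c)) => p1; case: (leP 0 (T / 2 - 1 - e)) => p2;
  rewrite ?ler10; case: (leP 1 (T / 2 - 1 - c)) => p3; case: (leP 1 (T / 2 - 1 - e)) => p4;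
  apply/andP; split; lra.
Qed.

Definition interpolant (y : E) : R := w y + cutoff y * (u y - w y).
Let V := interpolant.

Lemma interpolant_le1 y : `|V y| <= 1.
Proof.
have := cutoff01 y; rewrite /V /interpolant; move: (cutoff y) (u y) (w y) (u1 y) (w1 y) => p s t s1 t1 /andP[p0 p1].
have -> : t + p * (s - t) = (1 - p) * t + p * s by ring.
rewrite (le_trans (ler_normD _ _))// !normrM (ger0_norm p0) ger0_norm ?subr_ge0//.
rewrite -[leRHS](subrK p); apply: lerD; last by rewrite ler_piMr.
by rewrite ler_piMr// subr_ge0.
Qed.

(** [L] comes from [w], [Ku + L] from [u - w] under the cutoff, and 2 from the slope 1 of the cutoff
    times the bound 2 on [u - w]. *)
Lemma interpolant_lip : lip (L + (Ku + L + 2)) V.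
Proof.
move=> x y; rewrite /V /interpolant.
have := cutoff_lip x y; have := lu x y; have := lw x y; have /andP[p0 p1] := cutoff01 x.
move: (u1 y) (w1 y); move: (enorm (x - y)) (cutoff x) (cutoff y) (u x) (u y) (w x) (w y) p0 p1.
move=> d p p' s s' t t' p0 p1 s1 t1 ht hs hp.
have -> : t + p * (s - t) - (t' + p' * (s' - t')) =
  (t - t') + (p * ((s - s') - (t - t')) + (p - p') * (s' - t')) by ring.
rewrite [leRHS]mulrDl (le_trans (ler_normD _ _))//; apply: lerD => //.
rewrite [(_ + 2) * d]mulrDl (le_trans (ler_normD _ _))//; apply: lerD.
  rewrite normrM (ger0_norm p0) (@le_trans _ _ `|(s - s') - (t - t')|)//.
    by rewrite ler_piMl.
  by rewrite [leRHS]mulrDl (le_trans (ler_normB _ _))// lerD.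
rewrite normrM mulrC; apply: ler_pM => //; last by rewrite mul1r in hp.
by rewrite (le_trans (ler_normB _ _))// (_ : 2 = 1 + 1)// lerD.
Qed.

Lemma interpolant_outer y : T / 2 - 1 <= cnorm B y -> V y = w y.
Proof.
move=> yT; rewrite /V /interpolant (_ : cutoff y = 0) ?mul0r ?addr0//.
by rewrite /cutoff max_l ?subr_le0// min_r.
Qed.

Lemma interpolant_inner y : cnorm B y <= T / 2 - 2 -> V y = u y.
Proof.
move=> yT; rewrite /V /interpolant (_ : cutoff y = 1) ?mul1r ?[w y + _]addrC ?subrK//.
rewrite /cutoff min_l// le_max; apply/orP; right; lra.
Qed.

Lemma interpolant_grad_inner y : cube B (T - 4) y -> grad V y = grad u y.
Proof.
move=> yT; apply/rowP => i; rewrite !mxE /partial.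
have FF := @nbhs_filter E y.
have h : \forall x \near y, cnorm B x < T / 2 - 2.
  apply: (cvgr_lt _ (cnorm_continuous BBT (x := y))).
  by apply: lt_le_trans yT _; lra.
have h' : \forall x \near y, V x = u x.
  by apply: filterS h => x /ltW; exact: interpolant_inner.
exact: near_eq_derive h'.
Qed.

Lemma interpolant_partial_ae : {ae mu, forall y, forall i,
  [/\ `|partial i w y| <= L, `|partial i cutoff y| <= 1 &
   partial i V y = partial i w y + (cutoff y * (partial i u y - partial i w y) +
     partial i cutoff y * (u y - w y))]}.
Proof.
have FF := ae_filter_ringOfSetsType mu.
have aeu : {ae mu, forall y, forall i, derivable u y (basis_vec i)}.
  by apply: filter_forall => i; exact: lip_ae_derivable lu.
have aep : {ae mu, forall y, forall i, derivable cutoff y (basis_vec i)}.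
  by apply: filter_forall => i; exact: lip_ae_derivable cutoff_lip.
apply: filterS2 aeu aep => y du dp i; split.
- by apply: (le_trans (derive_le _ _ lw)); rewrite basis_vec_enorm mulr1 ger0_norm.
- by apply: (le_trans (derive_le _ _ cutoff_lip)); rewrite basis_vec_enorm mulr1 ger0_norm.
have duw : derivable (fun y => u y - w y) y (basis_vec i) by exact: derivableB.
have [dpm pm] := partialM (dp i) duw.
have -> : partial i V y = partial i w y + partial i (fun y => cutoff y * (u y - w y)) y.
  by apply: partialD; [exact: dw|exact: dpm].
by rewrite pm partialB; [|exact: du|exact: dw].
Qed.

Variables (a : E -> R) (Theta k : R) (nu : E) (k0 : 0 < k)
  (a_bnd : forall x, 0 <= a x <= Theta).
Hypotheses (u_decay : forall y, 1 - u y ^+ 2 <= 4 * decay k (dotv y nu))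
  (u_grad : {ae mu, forall y, enorm (grad u y) <= Ku * (1 - u y ^+ 2)})
  (u_far : forall y, 1 < `|dotv y nu| -> `|u y - w y| <= 1 - u y ^+ 2)
  (w_far : forall y, 1 < `|dotv y nu| -> `|w y| = 1)
  (pw_far : forall y i, 1 < `|dotv y nu| -> partial i w y = 0).

Let M := L + (Ku + L + 2).
Let C0 := 4 + (1 + k) ^+ 2.
Let M0 : 0 <= M. Proof. by rewrite !addr_ge0. Qed.

(** Beyond distance 1 from the hyperplane [w] is a constant well of [W], so [|V - w|] and the
    gradient of [V] are controlled by [1 - u^2], at most 4 times the decay. Within distance 1 the
    decay is at least the inverse of [(1 + k) ^+ 2], so crude bounds suffice. [C0] is the sum of the
    two constants. *)
Lemma interpolant_density_ae : {ae mu, forall y,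
  a y * W (V y) + 2^-1 * enorm (grad V y) ^+ 2 <=
  (Theta * (4 * C0) + 2^-1 * (n%:R * (M ^+ 2 * C0))) * decay k (dotv y nu)}.
Proof.
have FF := ae_filter_ringOfSetsType mu.
apply: filterS2 interpolant_partial_ae u_grad => y pV gu.
have := u_decay y; have := @u_far y; have := @w_far y; have := @pw_far y.
have dec1 : `|dotv y nu| <= 1 -> 1 <= C0 * decay k (dotv y nu).
  move=> y1; apply: (@le_trans _ _ ((1 + k) ^+ 2 * decay k 1)).
    rewrite /decay normr1 mulr1 exprVn mulfV// expf_neq0// gt_eqF//.
    by rewrite addr_gt0.
  apply: ler_pM; rewrite ?sqr_ge0 ?decay_ge0 ?lerDr//.
  by apply: decay_anti; rewrite // normr1.
have := decay_ge0 k (dotv y nu).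
move: dec1; set dc := decay k (dotv y nu) => dec1 dc0 pwf wf uf udc.
suff [hW hp] : W (V y) <= 4 * C0 * dc /\ forall i, `|partial i V y| ^+ 2 <= M ^+ 2 * C0 * dc.
  rewrite [leRHS]mulrDl; apply: lerD.
    have /andP[a0 aT] := a_bnd y.
    rewrite -[leRHS]mulrA; apply: ler_pM => //; exact: W_ge0.
  rewrite enorm_sqrE -[leRHS]mulrA ler_pM2l ?invr_gt0// -[leRHS]mulrA mulr_natl.
  rewrite -[n in _ *+ n]card_ord -sumr_const; apply: ler_sum => i _.
  by rewrite mxE -real_normK ?num_real.
have /andP[p0 p1] := cutoff01 y; have V1 := interpolant_le1 y.
case: (ltP 1 `|dotv y nu|) => y1.
  have {uf} us := uf y1; have {wf} ws := wf y1.
  have Vs : `|V y - w y| <= 1 - u y ^+ 2.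
    rewrite /V /interpolant [w y + _]addrC addrK normrM (ger0_norm p0).
    by rewrite (le_trans _ us)// ler_piMl.
  have d1 : 1 - u y ^+ 2 <= 1 by rewrite gerBl sqr_ge0.
  move: (1 - u y ^+ 2) us gu udc Vs d1 => d us gu udc Vs d1.
  have d0 : 0 <= d by exact: le_trans us.
  have d2 : d ^+ 2 <= d by rewrite expr2 ler_piMl.
  have dC : d <= C0 * dc by rewrite (le_trans udc)// ler_wpM2r// lerDl sqr_ge0.
  split.
    apply: (@le_trans _ _ (4 * d)); last by rewrite -mulrA ler_pM2l.
    (* Here [w y] has square 1, so [1 - V^2] is a difference of two squares. *)
    have -> : W (V y) = `|V y - w y| ^+ 2 * `|V y + w y| ^+ 2.
      have w2 : w y ^+ 2 = 1 by rewrite -real_normK ?num_real// ws expr1n.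
      by rewrite !real_normK ?num_real// -exprMn -subr_sqr w2 -sqrrN opprB.
    have h1 : `|V y - w y| ^+ 2 <= d by rewrite (le_trans _ d2)// lerXn2r ?nnegrE.
    have h2 : `|V y + w y| ^+ 2 <= 4.
      rewrite (_ : 4 = 2 ^+ 2); last by rewrite expr2 -natrM.
      rewrite lerXn2r ?nnegrE// (le_trans (ler_normD _ _))// (_ : 2 = 1 + 1)// lerD//.
    by rewrite mulrC; exact: ler_pM.
  move=> i; have [_ pp ->] := pV i; rewrite (pwf i y1) add0r subr0.
  have hu : `|partial i u y| <= Ku * d.
    by apply: le_trans gu; have := coord_le_enorm (grad u y) i; rewrite mxE.
  have hV : `|cutoff y * partial i u y + partial i cutoff y * (u y - w y)| <= M * d.
    apply: (le_trans (ler_normD _ _)); rewrite !normrM (ger0_norm p0).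
    apply: (@le_trans _ _ (Ku * d + 1 * d)).
      by apply: lerD; [rewrite (le_trans _ hu)// ler_piMl|apply: ler_pM].
    by rewrite -mulrDl ler_wpM2r// /M; move: L0 Ku0; lra.
  apply: (@le_trans _ _ ((M * d) ^+ 2)); first by rewrite lerXn2r ?nnegrE// mulr_ge0.
  by rewrite exprMn -mulrA ler_wpM2l ?sqr_ge0// (le_trans d2).
have dC := dec1 y1.
split.
  apply: (@le_trans _ _ 1); last by rewrite -mulrA; move: dC; lra.
  have V2 : V y ^+ 2 <= 1 by rewrite -real_normK ?num_real// expr_le1.
  by rewrite /W expr_le1// ?subr_ge0// gerBl sqr_ge0.
move=> i; apply: (@le_trans _ _ (M ^+ 2)); last by rewrite -mulrA ler_peMr ?sqr_ge0.
rewrite lerXn2r ?nnegrE//; apply: (le_trans (derive_le _ _ interpolant_lip)).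
by rewrite basis_vec_enorm mulr1 ger0_norm.
Qed.

End interpolation.

Section planar_competitor.
Context {R : realType} {n : nat}.
Local Notation E := 'rV[R]_n.
Local Notation mu := (@lebesgue_rV R n).
Variables (a : E -> R) (theta Theta : R) (a_cont : continuous a) (theta0 : 0 < theta)
  (a_bnd : forall x, theta <= a x <= Theta).
Variables (B : 'M[R]_n) (BBT : B *m B^T = 1%:M) (i0 : 'I_n).
Let nu := row i0 B.
Let k := Num.sqrt (2 * theta).
Let k0 : 0 < k. Proof. by rewrite sqrtr_gt0 mulr_gt0. Qed.
Let u := planar_profile a nu.

Lemma row_enorm : enorm nu = 1.
Proof.
rewrite /enorm dotv_row /nu -row_mul BBT !mxE eqxx sqrtr1//.
Qed.

Let a0 x : 0 <= a x.
Proof. by have /andP[ta _] := a_bnd x; exact: le_trans (ltW theta0) ta. Qed.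
Let Theta0 : 0 <= Theta.
Proof. by have /andP[_ aT] := a_bnd 0; exact: le_trans aT. Qed.
Let ma : measurable_fun setT a. Proof. exact: continuous_measurable_rV. Qed.

Lemma energy_ge0 D (v : E -> R) (g : E -> E) : (0 <= energy a D v g)%E.
Proof. by apply: integral_ge0 => y _; rewrite lee_fin energy_density_ge0. Qed.

Lemma cell_inf_ge0 (rho : E -> R) (v : E) D : (0 <= cell_inf a rho v D)%E.
Proof. by apply: le_ereal_inf_tmp => _ [f [g [_ ->]]]; exact: energy_ge0. Qed.

Let mdecay : measurable_fun setT (fun y : E => decay k (dotv y nu)).
Proof.
apply: measurable_decay => //.
by apply: continuous_measurable_rV; exact: lip_continuous (dotv_lip nu).
Qed.

Lemma energy_le_decay (D : set E) (v : E -> R) (C K : R) : measurable D -> lip K v -> 0 <= C ->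
  {ae mu, forall y, a y * W (v y) + 2^-1 * enorm (grad v y) ^+ 2 <= C * decay k (dotv y nu)} ->
  (energy a D v (grad v) <= C%:E * \int[mu]_(y in D) (decay k (dotv y nu))%:E)%E.
Proof.
move=> mD lv C0 hC; have d0 y : D y -> (0 <= (decay k (dotv y nu))%:E)%E.
  by move=> _; rewrite lee_fin decay_ge0.
have md : measurable_fun D (fun y => (decay k (dotv y nu))%:E).
  by apply/measurable_EFinP; exact: measurable_funS mdecay.
rewrite -(ge0_integralZl_EFin mu mD d0 md C0).
have mdens := measurable_energy_density ma (lip_continuous lv).
apply: ae_ge0_le_integral => //.
- by move=> y _; rewrite lee_fin energy_density_ge0.
- by apply/measurable_EFinP; exact: measurable_funS mdens.
- by move=> y _; rewrite -EFinM lee_fin mulr_ge0 ?decay_ge0.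
- exact: measurable_funeM.
have FF := ae_filter_ringOfSetsType mu.
by apply: filterS hC => y hy _; rewrite -EFinM lee_fin.
Qed.

Lemma planar_energy_cube_le T : 0 < T ->
  (energy a (cube B T) u (grad u) <= (16 * Theta * (1 + k^-1) * T ^+ n.-1)%:E)%E.
Proof.
move=> T0; have hd := planar_density_ae theta0 a_bnd row_enorm.
have C0 : 0 <= 8 * Theta by rewrite mulr_ge0.
apply: (le_trans (energy_le_decay (measurable_cube BBT T) (planar_lip a_bnd row_enorm) C0 hd)).
apply: (@le_trans _ _ ((8 * Theta)%:E * ((1 + k^-1) * (2 * T ^+ n.-1))%:E)%E).
  by apply: lee_wpmul2l; [rewrite lee_fin|exact: cube_decay_le].
rewrite -EFinM lee_fin le_eqVlt; apply/orP; left; apply/eqP; ring.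
Qed.

Variables (rho : E -> R) (rho_test : test_function [set x | enorm x < 1] rho).
Hypotheses (rho_bnd : forall x, 0 <= rho x <= 1)
  (rho_int : (\int[mu]_(x in [set: E]) (rho x)%:E = 1)%E).
Let w := mollified_phase rho nu.

(** The strict inequality persists near [y], so [w] is locally constant there. *)
Lemma mollified_phase_partial_far y i : 1 < `|dotv y nu| -> partial i w y = 0.
Proof.
move=> y1; set s := Num.sg (dotv y nu).
have FF := @nbhs_filter E y.
have s1 : s * dotv y nu = `|dotv y nu| by rewrite -normrEsg.
have c : continuous (fun x : E => s * dotv x nu).
  move=> x; have FFx := @nbhs_filter E x.
  by apply: cvgM; [exact: cvg_cst|exact: (lip_continuous (dotv_lip nu))].
have h : \forall x \near y, 1 < s * dotv x nu.
  by apply: (cvgr_gt _ (c y)); rewrite s1.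
have h' : \forall x \near y, w x = cst s x.
  apply: filterS h => x hx; rewrite /w (mollified_phase_far rho_test rho_bnd rho_int row_enorm).
    move: hx; rewrite /s; case: (sgrP (dotv y nu)) => _; rewrite ?mul0r ?mul1r ?mulN1r => hx.
    - by move: hx; rewrite ltr10.
    - by rewrite gtr0_sg// (lt_trans ltr01).
    - by rewrite ltr0_sg// -oppr_gt0 (lt_trans ltr01).
  apply: (lt_le_trans hx); rewrite (le_trans (ler_norm _))// normrM normr_sg.
  by case: (_ == _); rewrite ?mul1r ?mul0r.
by rewrite /partial (near_eq_derive _ h') derive_cst.
Qed.

(** On the cube of side [T - 4] the glued function is [u], so only the collar between sides [T - 4]
    and [T + 2] goes into the error; the outer side comes from the mollification. *)
Lemma cell_inf_le_planar : exists2 C, 0 <= C & forall T, 8 <= T ->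
  (cell_inf a rho nu (cube B T) <=
   energy a (cube B T) u (grad u) + (C * T ^+ n.-1 / T)%:E)%E.
Proof.
have [L L0 lw] := mollified_phase_lip rho_test rho_bnd rho_int nu [::].
have sw := mollified_phase_smooth rho_test rho_bnd rho_int nu.
have [_ dw] := sw [::].
have w1 := mollified_phase_le1 rho_test rho_bnd rho_int nu.
pose Ku := Num.sqrt 2 * Num.sqrt Theta.
have Ku0 : 0 <= Ku by rewrite mulr_ge0 ?sqrtr_ge0.
have lu : lip Ku u by exact: (planar_lip a_bnd row_enorm).
have u1 x : `|u x| <= 1 by rewrite ltW// planar_lt1.
have nu0 y : 1 < `|dotv y nu| -> dotv y nu != 0.
  by move=> y1; rewrite -normr_gt0 (lt_trans ltr01).
have wE y : 1 < `|dotv y nu| -> w y = Num.sg (dotv y nu).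
  by move=> y1; exact: (mollified_phase_far rho_test rho_bnd rho_int row_enorm).
have u_far y : 1 < `|dotv y nu| -> `|u y - w y| <= 1 - u y ^+ 2.
  by move=> y1; rewrite wE//; apply: (planar_sg_le a_bnd row_enorm); exact: nu0.
have w_far y : 1 < `|dotv y nu| -> `|w y| = 1.
  by move=> y1; rewrite wE// normr_sg nu0.
have a_bnd' x : 0 <= a x <= Theta by rewrite a0; have /andP[] := a_bnd x.
have [C C0 hC] := collar_decay_cvg BBT i0 k0.
pose D := Theta * (4 * (4 + (1 + k) ^+ 2)) +
  2^-1 * (n%:R * ((L + (Ku + L + 2)) ^+ 2 * (4 + (1 + k) ^+ 2))).
have D0 : 0 <= D by rewrite !(addr_ge0, mulr_ge0, sqr_ge0, invr_ge0, ler0n)// ltW.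
exists (D * C) => [|T T8]; first exact: mulr_ge0.
pose V := interpolant B u w T.
have lV : lip (L + (Ku + L + 2)) V by exact: interpolant_lip.
have hV := interpolant_density_ae BBT T Ku0 L0 lu lw u1 w1 dw k0 a_bnd'
  (onem_planar_sqr_le a_bnd row_enorm) (planar_grad_ae a_bnd row_enorm)
  u_far w_far mollified_phase_partial_far.
have K0 : 0 <= L + (Ku + L + 2) by rewrite !addr_ge0.
have VB := cell_inf_le_competitor rho_test rho_bnd rho_int ma (ltW theta0) a_bnd BBT K0 lV
  (interpolant_le1 B T u1 w1) (@interpolant_outer _ _ B u w T).
apply: (le_trans VB); have mdens := measurable_energy_density ma (lip_continuous lV).
have m1 := measurable_cube BBT (T - 4); have m2 := measurable_cube BBT (T + 2).
have sub : cube B (T - 4) `<=` cube B (T + 2).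
  by move=> y; rewrite /cube/=; move: (cnorm B y) => c; lra.
have sub' : cube B (T - 4) `<=` cube B T.
  by move=> y; rewrite /cube/=; move: (cnorm B y) => c; lra.
have -> : energy a (cube B (T + 2)) V (grad V) =
    (energy a (cube B (T - 4)) V (grad V) +
     energy a (cube B (T + 2) `\` cube B (T - 4)) V (grad V))%E.
  rewrite /energy -{1}(setDUK sub) ge0_integral_setU//.
  - exact: measurableD.
  - by apply/measurable_EFinP; exact: measurable_funS mdens.
  - by move=> y _; rewrite lee_fin energy_density_ge0.
  - by apply/disj_setPS => y [h1 [_ h2]].
apply: leeD.
  apply: (@le_trans _ _ (energy a (cube B (T - 4)) u (grad u))).
    rewrite le_eqVlt; apply/orP; left; apply/eqP; apply: eq_integral => y /set_mem yT.
    have yT2 : cnorm B y <= T / 2 - 2.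
      by move: yT; rewrite /cube/=; move: (cnorm B y) => c; lra.
    by rewrite /V (interpolant_grad_inner BBT _ _ yT) (interpolant_inner _ _ yT2).
  apply: ge0_subset_integral => //; first exact: measurable_cube.
    have mu_dens := measurable_energy_density ma (lip_continuous lu).
    by apply/measurable_EFinP; exact: measurable_funS mu_dens.
  by move=> y _; rewrite lee_fin energy_density_ge0.
apply: (le_trans (energy_le_decay (measurableD m2 m1) lV D0 hV)).
apply: (@le_trans _ _ (D%:E * (C * T ^+ n.-1 / T)%:E)%E).
  by apply: lee_wpmul2l; [rewrite lee_fin|exact: hC].
by rewrite -EFinM !mulrA.
Qed.

End planar_competitor.

(** * Passing to the limit *)

Section limits.
Context {R : realType}.

Lemma limf_esup_bnd (f : R -> \bar R) (b : \bar R) :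
  (forall T, 0 < T -> (0 <= f T <= b)%E) -> (0 <= limf_esup f (pinfty_nbhs R) <= b)%E.
Proof.
move=> hf; apply/andP; split.
  apply: le_ereal_inf_tmp => _ [A nA <-].
  have [M M0 AM] := pinfty_ex_gt0 nA.
  apply: ereal_sup_ge; exists (f M); first by exists M.
  by have /andP[] := hf _ M0.
apply: ereal_inf_le; exists (ereal_sup [set f x | x in [set T | 0 < T]]).
  by exists [set T | 0 < T] => //; exact: nbhs_pinfty_gt.
by apply: ge_ereal_sup => _ [T T0 <-]; have /andP[] := hf T T0.
Qed.

(** The error [C / T] disappears at infinity. The liminf is minus an infimum of suprema of [- g]
    over neighbourhoods of infinity, so one neighbourhood on which [g] is at least [s - e]
    suffices. *)
Lemma cvg_le_limf_einf (f g : R -> \bar R) (s C : R) :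
  f T @[T --> +oo] --> s%:E ->
  (forall T, 8 <= T -> (f T <= g T + (C / T)%:E)%E) -> (s%:E <= limf_einf g (pinfty_nbhs R))%E.
Proof.
move=> fs fg; apply/lee_addgt0Pr => e e0; rewrite -leeBlDr//.
rewrite /limf_einf leeNr; apply: ereal_inf_le.
have [A nA hA] : exists2 A, pinfty_nbhs R A & forall T, A T -> ((s - e)%:E <= g T)%E.
  (* Half of [e] absorbs the gap between [f T] and [s], the other half absorbs [C / T]. *)
  exists [set T | ((s - e / 2)%:E < f T)%E /\ (8 <= T /\ `|C| * 2 / e <= T)].
    apply: filterI; last by apply: filterI; apply: nbhs_pinfty_ge; exact: num_real.
    have h : nbhs s%:E [set y | ((s - e / 2)%:E < y)%E].
      by apply: (@nbhs_open_ereal_gt R s (fun x => x - e / 2)); rewrite gtrBl divr_gt0.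
    exact: (fs _ h).
  move=> T [fT [T8 CT]]; have T0 : 0 < T by exact: lt_le_trans T8.
  have := le_trans (ltW fT) (fg T T8).
  rewrite -leeBlDr// -EFinB; apply: le_trans; rewrite lee_fin -addrA lerD2l -opprD lerN2.
  rewrite [leRHS](splitr e) lerD2l ler_pdivrMr//.
  apply: (le_trans (ler_norm _)); move: CT; rewrite ler_pdivrMr// => CT.
  by rewrite mulrAC ler_pdivlMr// [e * T]mulrC.
exists (ereal_sup [set (- g T)%E | T in A]); first by exists A.
apply: ge_ereal_sup => _ [T AT <-].
by rewrite leeN2 -EFinB hA.
Qed.

Lemma cvg_ge0_ereal (f : R -> \bar R) (s : R) : f T @[T --> +oo] --> s%:E ->
  (forall T, 0 < T -> (0 <= f T)%E) -> 0 <= s.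
Proof.
move=> fs f0; rewrite -lee_fin -(cvg_lim _ fs)//; apply: lime_ge.
  by apply/cvg_ex; exists s%:E.
by apply: filterS (nbhs_pinfty_gt (num_real 0)) => T; exact: f0.
Qed.

End limits.

Theorem theorem1p2 (R : realType) (theta Theta : R)
    (htheta : 0 < theta) (htT : theta < Theta) :
  exists Lambda0 : R, 0 < Lambda0 /\
  forall (N : nat) (hN : (2 <= N)%N)
    (a : 'rV[R]_N -> R)
    (a_cont : continuous a)
    (a_pos : forall x, 0 < a x)
    (a_per : forall x (k : int) (i : 'I_N), a (x + k%:~R *: basis_vec i) = a x)
    (a_bnd : forall x, theta <= a x <= Theta)
    (rho : 'rV[R]_N -> R)
    (rho_test : test_function [set x | enorm x < 1] rho)
    (rho_bnd : forall x, 0 <= rho x <= 1)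
    (rho_int : (\int[lebesgue_rV N]_(x in [set: 'rV[R]_N]) (rho x)%:E = 1)%E)
    (Q : 'rV[R]_N -> set 'rV[R]_N)
    (Q_cube : forall nu, sphere R N nu -> unit_cube nu (Q nu))
    (sigma : 'rV[R]_N -> R)
    (sigma_def : is_surface_energy a rho Q sigma),
  exists lambda0 : 'rV[R]_N -> R,
    forall nu, sphere R N nu ->
      0 <= lambda0 nu <= Lambda0 /\
      (lambda_sup a Q nu - (lambda0 nu)%:E <= (sigma nu)%:E <=
         lambda_inf a Q nu)%E.
Proof.
pose Lambda0 := 16 * Theta * (1 + (Num.sqrt (2 * theta))^-1).
exists Lambda0; split.
  rewrite /Lambda0 !mulr_gt0// ?(lt_trans htheta)// ltr_pwDl// invr_ge0 sqrtr_ge0//.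
move=> N hN a a_cont a_pos a_per a_bnd rho rho_test rho_bnd rho_int Q Q_cube sigma sigma_def.
(* The limsup lies between 0 and [Lambda0], so [fine] does not alter it; subtracting it leaves 0,
   which is at most [sigma nu]. *)
exists (fun nu => fine (lambda_sup a Q nu)) => nu hnu.
have [B [BBT [i0 Bi0] DQ]] := unit_cube_dilate (Q_cube nu hnu).
have norm_le T x y : 0 < T -> (x <= y)%E -> (normalize (N := N) T x <= normalize (N := N) T y)%E.
  by move=> T0 xy; apply: lee_wpmul2l => //; rewrite lee_fin invr_ge0 exprn_ge0// ltW.
have normE T (c : R) : 0 < T -> normalize (N := N) T (c * T ^+ N.-1)%:E = c%:E.
  by move=> T0; rewrite /normalize -EFinM mulrCA mulVf ?mulr1// expf_neq0// gt_eqF.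
have bnd T : 0 < T -> (0 <= planar_energy a Q nu T <= Lambda0%:E)%E.
  move=> T0; apply/andP; split.
    apply: mule_ge0; last exact: energy_ge0 htheta a_bnd _ _ _.
    by rewrite lee_fin invr_ge0 exprn_ge0// ltW.
  rewrite -(normE T)// /planar_energy; apply: norm_le => //.
  rewrite DQ// -Bi0; exact: planar_energy_cube_le.
have /andP[ls0 lsL] := limf_esup_bnd bnd.
have lsfin : lambda_sup a Q nu \is a fin_num.
  by rewrite ge0_fin_numE// (le_lt_trans lsL)// ltry.
have sig := sigma_def nu hnu.
have s0 : 0 <= sigma nu.
  apply: (cvg_ge0_ereal sig) => T T0; apply: mule_ge0; last exact: cell_inf_ge0 htheta a_bnd _ _ _.
  by rewrite lee_fin invr_ge0 exprn_ge0// ltW.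
split; first by rewrite fine_ge0//= -lee_fin fineK.
apply/andP; split; first by rewrite fineK// subee// lee_fin.
have [C C0 hC] := cell_inf_le_planar a_cont htheta a_bnd BBT i0 rho_test rho_bnd rho_int.
apply: (cvg_le_limf_einf (C := C) sig) => T T8; have T0 : 0 < T by exact: lt_le_trans T8.
(* [C / T] is the normalization of the collar error [C * T ^+ N.-1 / T]. *)
rewrite -(normE T)// mulrAC /planar_energy DQ// -muleDr//.
  by apply: norm_le => //; rewrite -Bi0; exact: hC.
apply: ge0_adde_def; rewrite inE; first exact: energy_ge0 htheta a_bnd _ _ _.
by rewrite lee_fin divr_ge0 ?mulr_ge0 ?exprn_ge0 ?(ltW T0).
Qed.
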